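(* Let $\phi\in L^2(-1,0)$, let $D(z)=-iz+e^{-iz}+\int_{-1}^0e^{i\tau z}\phi(\tau)\,d\tau$ and let $\Lambda$ be its zero set. For $\lambda\in\Lambda$ let $\vec e_\lambda=(1,e^{i\lambda\tau})\in\mathcal M$ and let $\{\vec x_\lambda\}_{\lambda\in\Lambda}$ be the biorthogonal system. Let $l_n,R_n>0$ ($n\in\mathbb N$) satisfy $l_n\to\infty$, $R_n\to\infty$, $l_n^2/n\to0$, $n/R_n\to0$ and $e^{-\pi l_n/2}R_n\to0$ as $n\to\infty$. Let $W_n(z)=\exp\!\big(-l_n\pi-il_n\log\frac{z-n}{z+n}\big)$, $z\in\mathbb C_+$, define $w_n(\lambda)=W_n(\lambda)$ if $|\lambda|<R_n$ and $w_n(\lambda)=0$ otherwise, and let $$S_n\vec x=\sum_{\lambda\in\Lambda}w_n(\lambda)\langle\vec x,\vec x_\lambda\rangle\vec e_\lambda,\qquad\vec x\in\mathcal M.$$ Then $S_n\vec x\to\vec x$ in $\mathcal M$ as $n\to\infty$, for every $\vec x\in\mathcal M$.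
   Context: $\mathcal M=\mathbb C\times L^2(-1,0)$ with inner product $\langle(\xi,x),(\eta,y)\rangle=\xi\bar\eta+\int_{-1}^0x(t)\overline{y(t)}\,dt$. Standing assumptions: all zeros of $D$ lie in $\mathbb C_+=\{\operatorname{Im}z>0\}$ and are simple. The system $\{\vec e_\lambda\}_{\lambda\in\Lambda}$ is complete and minimal in $\mathcal M$, and $\{\vec x_\lambda=(\xi_\lambda,x_\lambda)\}_{\lambda\in\Lambda}$ is the unique system in $\mathcal M$ with $\langle\vec e_\mu,\vec x_\lambda\rangle=\delta_{\lambda,\mu}$. The logarithm is the branch with imaginary part in $(0,\pi)$ (for $z\in\mathbb C_+$, $\frac{z-n}{z+n}\in\mathbb C_+$). The sum defining $S_n$ is finite since $\Lambda$ has finitely many points in each disc. *)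

(* Defs.v *)
From HB Require Import structures.
From mathcomp Require Import all_boot all_order all_algebra.
From mathcomp Require Import all_classical all_reals all_analysis.
From mathcomp Require Import complex.
Set Implicit Arguments. Unset Strict Implicit. Unset Printing Implicit Defensive.
Import Order.TTheory GRing.Theory Num.Theory.
Import numFieldNormedType.Exports.
Local Open Scope ring_scope.
Local Open Scope classical_set_scope.

Section Defs.
Variable R : realType.
Local Notation C := R[i].
Local Notation mu := (@lebesgue_measure R).

Definition ci : C := Complex 0 1.
Definition rc (x : R) : C := Complex x 0.
Definition cRe (z : C) : R := complex.Re z.
Definition cIm (z : C) : R := complex.Im z.
Definition cconj (z : C) : C := Complex (cRe z) (- cIm z).
Definition cabs (z : C) : R := Num.sqrt (cRe z ^+ 2 + cIm z ^+ 2).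

Definition cexp (z : C) : C :=
  Complex (expR (cRe z) * cos (cIm z)) (expR (cRe z) * sin (cIm z)).

(* Argument in (0, pi) of a point of the open upper half-plane *)
Definition argUp (w : C) : R := acos (cRe w / cabs w).
(* the branch of log with imaginary part in (0, pi), on C_+ *)
Definition logUp (w : C) : C := Complex (ln (cabs w)) (argUp w).

Definition Iv : set R := `[(-1)%R, 0%R]%classic.

Definition cint (f : R -> C) : C :=
  Complex (Rintegral mu Iv (fun t => cRe (f t)))
          (Rintegral mu Iv (fun t => cIm (f t))).

Definition inL2 (f : R -> C) : Prop :=
  measurable_fun Iv (fun t => cRe (f t)) /\
  measurable_fun Iv (fun t => cIm (f t)) /\
  mu.-integrable Iv (fun t => ((cabs (f t)) ^+ 2)%:E).

(* the space M = C x L^2(-1,0) (elements represented by pairs) *)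
Definition Melt := (C * (R -> C))%type.
Definition inM (u : Melt) : Prop := inL2 u.2.

Definition ipM (u v : Melt) : C :=
  u.1 * cconj v.1 + cint (fun t => u.2 t * cconj (v.2 t)).

Definition normM (u : Melt) : R :=
  Num.sqrt (cabs u.1 ^+ 2 + Rintegral mu Iv (fun t => cabs (u.2 t) ^+ 2)).

Definition subM (u v : Melt) : Melt := (u.1 - v.1, fun t => u.2 t - v.2 t).

Definition Dfun (phi : R -> C) (z : C) : C :=
  - (ci * z) + cexp (- (ci * z)) + cint (fun tau => cexp (ci * rc tau * z) * phi tau).

Definition Lam (phi : R -> C) : set C := [set z | Dfun phi z = 0].

Definition evec (lam : C) : Melt := (1, fun tau => cexp (ci * lam * rc tau)).

Definition lincomb (s : seq C) (c : C -> C) : Melt :=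
  (\sum_(lam <- s) c lam * (evec lam).1,
   fun t => \sum_(lam <- s) c lam * (evec lam).2 t).

Definition Wn (l : R) (n : nat) (z : C) : C :=
  cexp (- rc (l * pi) - ci * rc l * logUp ((z - rc n%:R) / (z + rc n%:R))).

Definition wn (l Rn : R) (n : nat) (lam : C) : C :=
  if cabs lam < Rn then Wn l n lam else 0.

Definition Sn (phi : R -> C) (xs : C -> Melt) (l Rn : R) (n : nat) (x : Melt) : Melt :=
  ((\sum_(lam \in Lam phi) wn l Rn n lam * ipM x (xs lam) * (evec lam).1)%R,
   fun t => (\sum_(lam \in Lam phi) wn l Rn n lam * ipM x (xs lam) * (evec lam).2 t)%R).

End Defs.

(* Main.v *)
Require Import Defs.
From HB Require Import structures.
From mathcomp Require Import all_boot all_order all_algebra.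
From mathcomp Require Import all_classical all_reals all_analysis.
From mathcomp Require Import finmap measurable_realfun complex ring lra.
Import Order.TTheory GRing.Theory Num.Theory.
Import numFieldNormedType.Exports.
Set Implicit Arguments. Unset Strict Implicit. Unset Printing Implicit Defensive.
Local Open Scope ring_scope.
Local Open Scope classical_set_scope.

(* To lambda in Lambda corresponds the exponential exp(i lambda t) on (-1,+oo), which solves a delay equation.
   Its values on (0,+oo) are controlled by the state in M: with F(z) = sum_lambda c_lambda / (lambda - z), the
   product F(t) D(t) is bounded by the norm of sum_lambda c_lambda e_lambda for real t, while |D(t)| >= k (1 + |t|).
   Hence the M-norm of sum_lambda c_lambda e_lambda is equivalent to the L^2(-1,+oo)-norm of
   sum_lambda c_lambda exp(i lambda t), a quadratic form with the explicit kernel i / (z - conj w).  For that form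
   a multiplier exp(- h(lambda)) is a contraction whenever the kernel of h is positive (differentiate along
   exp(- t h)), which covers W_n and z / (z + i x).

   The truncation to |lambda| < R_n is compared with the multiplier W_n Psi, where Psi = (1 - (z / (z + i x))^16)^3
   with x = R_n^(9/8).  Below R_n the function 1 - Psi is O(R_n^-2).  Beyond R_n one has |W_n| <= C exp(- pi l_n)
   on Lambda and Psi decays cubically; the crude sum of norms would only give exp(- pi l_n) x^2, and the gain of
   a power of R_n comes from the off-diagonal decay of the kernel together with the separation of the zeros of D:
   distinct large zeros have real parts at distance at least 1/16.  So the operators S_n are uniformly bounded on
   finite linear combinations of the e_lambda, on which they converge; completeness gives the theorem. *)

(** * Complex numbers and differentiation of complex functions of a real variable *)

Section Cplx.
Variable R : realType.
Local Notation C := R[i].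
Implicit Types (z w : C) (x y : R).

(** The growth of the coefficients is the obstacle. The norm in M controls each c_z, but on (-1,+oo)
    the coefficient becomes c_z exp(-iz), larger by a factor up to about |z|, so an error estimated
    term by term must beat both this growth and the number of zeros. The exponents come from this
    balance. With R_n = r^8 and x = r^9, the power 16 gives (R_n / x)^16 = r^-16, which cancels at
    most about r^8 zeros with coefficients of size r^8; the cube turns linear growth into a summable
    |z|^-2. Beyond R_n, with E = exp(- pi l_n), the coefficients are at most E x and their sum at
    most E x^2, up to constants; treating the kernel separately within and beyond horizontal
    distance r^4 bounds the form by E^2 r^32 = (E R_n^2)^2, and E R_n^2 is the square of exp(- pi
    l_n / 2) R_n. Only finite exponential sums occur: the half-line norm is an explicit Hermitian
    form, and integrals over unbounded intervals are replaced by monotonicity of such forms in a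
    real parameter. *)

Lemma complex_eqP z w : cRe z = cRe w -> cIm z = cIm w -> z = w.
Proof. by case: z w => a b [c d] /= -> ->. Qed.

Lemma cReD z w : cRe (z + w) = cRe z + cRe w. Proof. by case: z w => a b [c d]. Qed.
Lemma cImD z w : cIm (z + w) = cIm z + cIm w. Proof. by case: z w => a b [c d]. Qed.
Lemma cReN z : cRe (- z) = - cRe z. Proof. by case: z. Qed.
Lemma cImN z : cIm (- z) = - cIm z. Proof. by case: z. Qed.
Lemma cReM z w : cRe (z * w) = cRe z * cRe w - cIm z * cIm w.
Proof. by case: z w => a b [c d]. Qed.
Lemma cImM z w : cIm (z * w) = cRe z * cIm w + cIm z * cRe w.
Proof. by case: z w => a b [c d]. Qed.
Lemma cRe_sum I (r : seq I) (P : pred I) (F : I -> C) :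
  cRe (\sum_(i <- r | P i) F i) = \sum_(i <- r | P i) cRe (F i).
Proof. exact: (big_morph (@cRe R) cReD). Qed.
Lemma rcE x : rc x = (x%:C)%C. Proof. by []. Qed.
Lemma rcD x y : rc (x + y) = rc x + rc y. Proof. by rewrite !rcE rmorphD. Qed.
Lemma rcN x : rc (- x) = - rc x. Proof. by rewrite !rcE rmorphN. Qed.
Lemma rcM x y : rc (x * y) = rc x * rc y. Proof. by rewrite !rcE rmorphM. Qed.
Lemma rc0 : rc 0 = 0 :> C. Proof. by []. Qed.
Lemma rc1 : rc 1 = 1 :> C. Proof. by []. Qed.
Lemma rcV x : rc x^-1 = (rc x)^-1. Proof. by rewrite !rcE fmorphV. Qed.
Lemma cRe_rcM x z : cRe (rc x * z) = x * cRe z.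
Proof. by rewrite cReM /= mul0r subr0. Qed.
Lemma cIm_rcM x z : cIm (rc x * z) = x * cIm z.
Proof. by rewrite cImM /= mul0r addr0. Qed.
Lemma ciM z : ci R * z = Complex (- cIm z) (cRe z).
Proof. by case: z => a b; apply: complex_eqP; rewrite ?cReM ?cImM /=; ring. Qed.
Lemma ci2 : ci R * ci R = -1.
Proof. by apply: complex_eqP; rewrite ?cReM ?cImM /=; ring. Qed.
Lemma ci_neq0 : ci R != 0.
Proof. by apply/eqP => /(congr1 (@cIm R)) /= /eqP; rewrite oner_eq0. Qed.

Lemma cconjE z : cconj z = conjc z. Proof. by case: z. Qed.
Lemma cconjD z w : cconj (z + w) = cconj z + cconj w.
Proof. by rewrite !cconjE rmorphD. Qed.
Lemma cconjN z : cconj (- z) = - cconj z.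
Proof. by rewrite !cconjE rmorphN. Qed.
Lemma cconjM z w : cconj (z * w) = cconj z * cconj w.
Proof. by rewrite !cconjE rmorphM. Qed.
Lemma cconjV z : cconj z^-1 = (cconj z)^-1.
Proof. by rewrite !cconjE fmorphV. Qed.
Lemma cconj_rc x : cconj (rc x) = rc x.
Proof. by rewrite /cconj /= oppr0. Qed.
Lemma cconj_ci : cconj (ci R) = - ci R.
Proof. by apply: complex_eqP; rewrite ?cReN ?cImN //= oppr0. Qed.
Lemma cconj_sum I (r : seq I) (P : pred I) (F : I -> C) :
  cconj (\sum_(i <- r | P i) F i) = \sum_(i <- r | P i) cconj (F i).
Proof. by apply: (big_morph (@cconj R) cconjD); rewrite /cconj /= oppr0. Qed.

Lemma cabs_normc z : cabs z = Normc.normc z. Proof. by case: z. Qed.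
Lemma cabs_ge0 z : 0 <= cabs z. Proof. exact: sqrtr_ge0. Qed.
Lemma cabsM z w : cabs (z * w) = cabs z * cabs w.
Proof. by rewrite !cabs_normc Normc.normcM. Qed.
Lemma cabsD z w : cabs (z + w) <= cabs z + cabs w.
Proof. by rewrite !cabs_normc le_normcD. Qed.
Lemma cabsN z : cabs (- z) = cabs z.
Proof. by rewrite !cabs_normc normcN. Qed.
Lemma cabsBC z w : cabs (z - w) = cabs (w - z).
Proof. by rewrite -cabsN opprB. Qed.
Lemma cabsB z w : cabs (z - w) <= cabs z + cabs w.
Proof. by rewrite (le_trans (cabsD _ _)) // cabsN. Qed.
Lemma cabsV z : cabs z^-1 = (cabs z)^-1.
Proof. by rewrite !cabs_normc Normc.normcV. Qed.
Lemma cabs0 : cabs 0 = 0 :> R.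
Proof. by rewrite cabs_normc Normc.normc0. Qed.
Lemma cabs1 : cabs 1 = 1 :> R.
Proof. by rewrite cabs_normc Normc.normc1. Qed.
Lemma cabs_eq0 z : (cabs z == 0) = (z == 0).
Proof.
apply/eqP/eqP => [|->]; last exact: cabs0.
by rewrite cabs_normc => /Normc.eq0_normc.
Qed.
Lemma cabs_gt0 z : (0 < cabs z) = (z != 0).
Proof. by rewrite lt_def cabs_eq0 cabs_ge0 andbT. Qed.
Lemma cabsX z n : cabs (z ^+ n) = cabs z ^+ n.
Proof. by elim: n => [|n IH]; rewrite ?expr0 ?cabs1 // !exprS cabsM IH. Qed.
Lemma sqr_cabs z : cabs z ^+ 2 = cRe z ^+ 2 + cIm z ^+ 2.
Proof. by rewrite sqr_sqrtr // addr_ge0 // sqr_ge0. Qed.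
Lemma cabs_conj z : cabs (cconj z) = cabs z.
Proof. by rewrite /cabs /= sqrrN. Qed.
Lemma cabs_rc x : cabs (rc x) = `|x|.
Proof. by rewrite /cabs /= expr0n addr0 sqrtr_sqr. Qed.
Lemma cabs_ci : cabs (ci R) = 1.
Proof. by rewrite /cabs /= expr0n add0r sqrtr_sqr normr1. Qed.
Lemma cabs_Re z : `|cRe z| <= cabs z.
Proof. by rewrite -sqrtr_sqr ler_wsqrtr // lerDl sqr_ge0. Qed.
Lemma cabs_Im z : `|cIm z| <= cabs z.
Proof. by rewrite -sqrtr_sqr ler_wsqrtr // lerDr sqr_ge0. Qed.
Lemma cabs_ReIm z : cabs z <= `|cRe z| + `|cIm z|.
Proof.
rewrite -(ler_pXn2r (ltn0Sn 1)) ?nnegrE ?cabs_ge0 ?addr_ge0 //.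
rewrite sqr_cabs -(real_normK (num_real (cRe z))) -(real_normK (num_real (cIm z))).
have := normr_ge0 (cRe z); have := normr_ge0 (cIm z); nra.
Qed.
Lemma cabs_sum I (r : seq I) (P : pred I) (F : I -> C) :
  cabs (\sum_(i <- r | P i) F i) <= \sum_(i <- r | P i) cabs (F i).
Proof.
elim/big_rec2: _ => [|i y x _ h]; first by rewrite cabs0.
by rewrite (le_trans (cabsD _ _)) // lerD2l.
Qed.
Lemma mul_cconj z : z * cconj z = rc (cabs z ^+ 2).
Proof.
by rewrite sqr_cabs; apply: complex_eqP; rewrite ?cReM ?cImM /=; ring.
Qed.

Lemma cexp0 : cexp 0 = 1 :> C.
Proof. by rewrite /cexp /= expR0 cos0 sin0 !mul1r. Qed.
Lemma cexpD z w : cexp (z + w) = cexp z * cexp w.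
Proof.
apply: complex_eqP; rewrite ?cReM ?cImM /= cReD cImD expRD ?cosD ?sinD; ring.
Qed.
Lemma cabs_cexp z : cabs (cexp z) = expR (cRe z).
Proof.
rewrite /cabs /= !exprMn -mulrDr cos2Dsin2 mulr1 sqrtr_sqr ger0_norm //.
Qed.
Lemma cconj_cexp z : cconj (cexp z) = cexp (cconj z).
Proof. by rewrite /cexp /cconj /= cosN sinN mulrN. Qed.
End Cplx.

Section Cder.
Variable R : realType.
Local Notation C := R[i].
Implicit Types (f g : R -> C) (t : R) (a b : C).

Definition cder f t a : Prop :=
  is_derive t 1 (fun s => cRe (f s)) (cRe a) /\
  is_derive t 1 (fun s => cIm (f s)) (cIm a).

Lemma is_derive_ext (h k : R -> R) t (d e : R) :
  is_derive t 1 h d -> h =1 k -> d = e -> is_derive t 1 k e.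
Proof. by move=> hd /funext <- <-. Qed.

Lemma cder_ext f g t a b : cder f t a -> f =1 g -> a = b -> cder g t b.
Proof. by move=> fa /funext <- <-. Qed.

Lemma cder_cst b t : cder (fun=> b) t 0.
Proof. by split; exact: is_derive_cst. Qed.

Lemma cder_rc (h : R -> R) t (d : R) :
  is_derive t 1 h d -> cder (fun s => rc (h s)) t (rc d).
Proof. by move=> hd; split => //=; exact: is_derive_cst. Qed.

Lemma cder_id t : cder (@rc R) t 1.
Proof. exact: (@cder_rc id t 1 (is_derive_id t 1)). Qed.

Lemma cderD f g t a b :
  cder f t a -> cder g t b -> cder (fun s => f s + g s) t (a + b).
Proof.
move=> [fa fa'] [gb gb']; split.
  apply: (is_derive_ext (is_deriveD fa gb)) => [s|]; by rewrite cReD.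
apply: (is_derive_ext (is_deriveD fa' gb')) => [s|]; by rewrite cImD.
Qed.

Lemma cderN f t a : cder f t a -> cder (fun s => - f s) t (- a).
Proof.
move=> [fa fa']; split.
  apply: (is_derive_ext (is_deriveN fa)) => [s|]; by rewrite cReN.
apply: (is_derive_ext (is_deriveN fa')) => [s|]; by rewrite cImN.
Qed.

Lemma cderM f g t a b :
  cder f t a -> cder g t b -> cder (fun s => f s * g s) t (a * g t + f t * b).
Proof.
move=> [fa fa'] [gb gb']; split.
  apply: (is_derive_ext (is_deriveB (is_deriveM fa gb) (is_deriveM fa' gb'))).
    by move=> s; rewrite cReM.
  by rewrite /GRing.scale /= !(cReD, cReM); ring.
apply: (is_derive_ext (is_deriveD (is_deriveM fa gb') (is_deriveM fa' gb))).
  by move=> s; rewrite cImM.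
by rewrite /GRing.scale /= !(cImD, cImM); ring.
Qed.

Lemma cder_conj f t a : cder f t a -> cder (fun s => cconj (f s)) t (cconj a).
Proof. by move=> [fa fa']; split => //=; exact: is_deriveN. Qed.

Lemma cder_sum I (r : seq I) (F : I -> R -> C) (G : I -> C) t :
  (forall i, cder (F i) t (G i)) ->
  cder (fun s => \sum_(i <- r) F i s) t (\sum_(i <- r) G i).
Proof.
move=> h; elim: r => [|i r IH].
  by rewrite big_nil; apply: (cder_ext (cder_cst 0 t)) => // s; rewrite big_nil.
rewrite big_cons; apply: (cder_ext (cderD (h i) IH)) => // s.
by rewrite big_cons.
Qed.

Lemma cderZ b f t a : cder f t a -> cder (fun s => b * f s) t (b * a).
Proof.
move=> fa; apply: (cder_ext (cderM (cder_cst b t) fa)) => //.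
by rewrite mul0r add0r.
Qed.

Lemma cder_exp f t a : cder f t a -> cder (fun s => cexp (f s)) t (a * cexp (f t)).
Proof.
move=> [fa fa'].
have He := is_derive1_comp (is_derive_expR (cRe (f t))) fa.
have Hc := is_derive1_comp (is_derive_cos (cIm (f t))) fa'.
have Hs := is_derive1_comp (is_derive_sin (cIm (f t))) fa'.
split.
  apply: (is_derive_ext (is_deriveM He Hc)) => //.
  by rewrite /GRing.scale /= cReM /=; ring.
apply: (is_derive_ext (is_deriveM He Hs)) => //.
by rewrite /GRing.scale /= cImM /=; ring.
Qed.

Lemma is_derive_cont (h : R -> R) t (d : R) :
  is_derive t 1 h d -> {for t, continuous h}.
Proof.
by move=> [hd _]; apply/differentiable_continuous/derivable1_diffP.
Qed.

Lemma is_derive_mvt (h dh : R -> R) (a b : R) : a <= b ->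
  (forall t, a <= t <= b -> is_derive t 1 h (dh t)) ->
  exists2 c, a <= c <= b & h b - h a = dh c * (b - a).
Proof.
move=> ab hd; have [||c] := @MVT_segment R h dh a b ab.
- by move=> t; rewrite in_itv /= => /andP[at' tb]; apply: hd; rewrite !ltW.
- apply: continuous_in_subspaceT => t /set_mem; rewrite /= in_itv /= => atb.
  exact: is_derive_cont (hd _ atb).
- by rewrite in_itv /= => acb e; exists c.
Qed.

Lemma is_derive_ndecr (h dh : R -> R) (a b : R) : a <= b ->
  (forall t, a <= t <= b -> is_derive t 1 h (dh t)) ->
  (forall t, a <= t <= b -> 0 <= dh t) -> h a <= h b.
Proof.
move=> ab hd h0; have [c /h0 dc e] := is_derive_mvt ab hd.
by rewrite -subr_ge0 e mulr_ge0 // subr_ge0.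
Qed.

Lemma is_derive_le (h k dh dk : R -> R) (a b : R) : a <= b ->
  (forall t, a <= t <= b -> is_derive t 1 h (dh t)) ->
  (forall t, a <= t <= b -> is_derive t 1 k (dk t)) ->
  (forall t, a <= t <= b -> dh t <= dk t) -> h b - h a <= k b - k a.
Proof.
move=> ab hd kd le.
suff : (k - h) a <= (k - h) b by rewrite /= !fctE; lra.
apply: (@is_derive_ndecr _ (fun t => dk t - dh t)) => // t tab.
  by apply: is_deriveB; [exact: kd | exact: hd].
by rewrite subr_ge0 le.
Qed.

(* The nonnegative function |u' - w|^2 with w the mean of u' gives Cauchy-Schwarz without integrals. *)
Lemma sqr_cabs_increment (u v : R -> C) (V g : R -> R) (a b : R) : a < b ->
  (forall t, a <= t <= b -> cder u t (v t)) ->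
  (forall t, a <= t <= b -> is_derive t 1 V (g t)) ->
  (forall t, a <= t <= b -> cabs (v t) ^+ 2 <= g t) ->
  cabs (u b - u a) ^+ 2 <= (b - a) * (V b - V a).
Proof.
move=> ab ud Vd vg; have ba : 0 < b - a by rewrite subr_gt0.
pose w := (u b - u a) / rc (b - a).
have hle := @is_derive_le (fun t => 2 * cRe (cconj w * u t))
   (fun t => V t + cabs w ^+ 2 * t)
   (fun t => 2 * cRe (cconj w * v t)) (fun t => g t + cabs w ^+ 2) a b (ltW ab).
have h : 2 * cRe (cconj w * u b) - 2 * cRe (cconj w * u a) <=
    V b + cabs w ^+ 2 * b - (V a + cabs w ^+ 2 * a).
  apply: hle.
- move=> t /ud ut; have [h _] := cderZ (cconj w) ut.
  by apply: (is_derive_ext (is_deriveZ 2 h)) => // s; rewrite /GRing.scale.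
- move=> t /Vd Vt.
  apply: (is_derive_ext (is_deriveD Vt (is_deriveZ (cabs w ^+ 2) (is_derive_id t 1)))) => //.
  by rewrite /GRing.scale /= mulr1.
- move=> t /vg h.
  have : 2 * cRe (cconj w * v t) <= cabs (v t) ^+ 2 + cabs w ^+ 2.
    rewrite !sqr_cabs cReM /=.
    by have := sqr_ge0 (cRe (v t) - cRe w); have := sqr_ge0 (cIm (v t) - cIm w); nra.
  by move=> h'; rewrite (le_trans h') // lerD2r.
have wE : cabs w = cabs (u b - u a) / (b - a).
  by rewrite cabsM cabsV cabs_rc gtr0_norm.
have E : cRe (cconj w * u b) - cRe (cconj w * u a) = cabs (u b - u a) ^+ 2 / (b - a).
  rewrite -cReN -cReD -mulrN -mulrDr /w cconjM cconjV cconj_rc mulrAC [_ * (_ - _)]mulrC.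
  rewrite mul_cconj -rcV -rcM //.
have b0 : b - a != 0 by rewrite gt_eqF.
rewrite mulrC -ler_pdivrMr //.
have e2 : cabs w ^+ 2 * (b - a) = cabs (u b - u a) ^+ 2 / (b - a).
  by rewrite wE expr_div_n; field.
by lra.
Qed.
End Cder.

(** * The quadratic form of exponentials on the half-line and its multipliers *)

Section Qform.
Variable R : realType.
Local Notation C := R[i].
Implicit Types (s : seq C) (c d : C -> C) (z w : C) (t x : R).

Lemma cder_sum_seq (I : eqType) (r : seq I) (F : I -> R -> C) (G : I -> C) t :
  (forall i, i \in r -> cder (F i) t (G i)) ->
  cder (fun u => \sum_(i <- r) F i u) t (\sum_(i <- r) G i).
Proof.
move=> h; rewrite big_seq.
suff : cder (fun u => \sum_(i <- r) (if i \in r then F i u else 0)) t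
         (\sum_(i <- r) if i \in r then G i else 0).
  move=> k; apply: (cder_ext k) => [u|]; last by rewrite [RHS]big_mkcond.
  by rewrite [RHS]big_seq [RHS]big_mkcond.
apply: cder_sum => i; case: ifPn => [ir|_]; first exact: h.
exact: cder_cst.
Qed.

(* The Gram kernel: kern z w is the inner product of exp(izt) and exp(iwt) on (0,+oo). *)
Definition kern z w : C := (- (ci R * (z - cconj w)))^-1.

(* The squared norm of sum_z d_z exp(izt) in L^2(0,+oo). *)
Definition gram s d : R :=
  cRe (\sum_(z <- s) \sum_(w <- s) d z * cconj (d w) * kern z w).

Definition exp_sum s c t : C := \sum_(z <- s) c z * cexp (ci R * z * rc t).

Definition upper s := forall z, z \in s -> 0 < cIm z.

Lemma subJ_Im z w : cIm (z - cconj w) = cIm z + cIm w.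
Proof. by rewrite cImD cImN /= opprK. Qed.

Lemma subJ_neq0 z w : 0 < cIm z -> 0 < cIm w -> z - cconj w != 0.
Proof.
move=> z0 w0; apply/eqP => /(congr1 (@cIm R)); rewrite subJ_Im /= => e.
by have := addr_gt0 z0 w0; rewrite e ltxx.
Qed.

Lemma cabs_kern z w : cabs (kern z w) = (cabs (z - cconj w))^-1.
Proof. by rewrite /kern cabsV cabsN cabsM cabs_ci mul1r. Qed.

Lemma sum_mul_conj s (a b : C -> C) :
  \sum_(z <- s) \sum_(w <- s) a z * cconj (b w) =
  (\sum_(z <- s) a z) * cconj (\sum_(z <- s) b z).
Proof.
rewrite big_distrl /=; apply: eq_bigr => z _.
by rewrite cconj_sum big_distrr.
Qed.

Lemma eq_gram s d e : (forall z, z \in s -> d z = e z) -> gram s d = gram s e.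
Proof.
move=> de; congr cRe; apply: eq_big_seq => z zs; apply: eq_big_seq => w ws.
by rewrite !de.
Qed.

Lemma gram_le_sum s d :
  gram s d <= \sum_(z <- s) \sum_(w <- s) cabs (d z) * cabs (d w) / cabs (z - cconj w).
Proof.
rewrite (le_trans (ler_norm _)) // (le_trans (cabs_Re _)) //.
rewrite (le_trans (cabs_sum _ _ _)) //; apply: ler_sum => z _.
rewrite (le_trans (cabs_sum _ _ _)) //; apply: ler_sum => w _.
by rewrite !cabsM cabs_conj cabs_kern.
Qed.

(** The form at t is the squared norm of the exponential sum over (t,+oo). Algebraically,
    differentiating exp(i(z - conj w)t) brings down the denominator of [kern], and the matrix that
    remains has rank one. *)
Lemma is_derive_gram s c t : upper s ->
  is_derive t 1 (fun t => gram s (fun z => c z * cexp (ci R * z * rc t)))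
    (- cabs (exp_sum s c t) ^+ 2).
Proof.
move=> us.
pose F z w := c z * cconj (c w) * kern z w.
pose E z w t := cexp (ci R * (z - cconj w) * rc t).
have EE z w x : cexp (ci R * z * rc x) * cconj (cexp (ci R * w * rc x)) = E z w x.
  rewrite cconj_cexp !cconjM cconj_ci cconj_rc -cexpD; congr cexp; ring.
have dE z w : cder (E z w) t (ci R * (z - cconj w) * E z w t).
  apply: cder_exp; apply: (cder_ext (cderZ _ (cder_id t))) => //.
  by rewrite mulr1.
have [h _] : cder (fun t => \sum_(z <- s) \sum_(w <- s) F z w * E z w t) t
   (\sum_(z <- s) \sum_(w <- s) F z w * (ci R * (z - cconj w) * E z w t)).
  by apply: cder_sum => z; apply: cder_sum => w; exact: cderZ.
apply: (is_derive_ext h) => [x|].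
  congr cRe; apply: eq_bigr => z _; apply: eq_bigr => w _.
  by rewrite -EE /F cconjM; ring.
rewrite -[RHS]/(cRe (rc (- cabs (exp_sum s c t) ^+ 2))) rcN -mul_cconj; congr cRe.
rewrite /exp_sum -sum_mul_conj -sumrN; apply: eq_big_seq => z zs.
rewrite -sumrN; apply: eq_big_seq => w ws.
rewrite -EE /F /kern cconjM.
have := subJ_neq0 (us _ zs) (us _ ws); have := @ci_neq0 R => i0 zw0.
have K : (- (ci R * (z - cconj w)))^-1 * (ci R * (z - cconj w)) = -1.
  by rewrite invrN mulNr mulVf // mulf_neq0.
transitivity (c z * cconj (c w) * cexp (ci R * z * rc t) *
  cconj (cexp (ci R * w * rc t)) * ((- (ci R * (z - cconj w)))^-1 * (ci R * (z - cconj w)))).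
  by set X := _^-1; ring.
by rewrite K; ring.
Qed.

Lemma gram_shift_ndecr s c t x : upper s -> t <= x ->
  gram s (fun z => c z * cexp (ci R * z * rc x)) <=
  gram s (fun z => c z * cexp (ci R * z * rc t)).
Proof.
move=> us tx; rewrite -lerN2.
apply: (@is_derive_ndecr _ (fun t => - gram s (fun z => c z * cexp (ci R * z * rc t)))
   (fun t => cabs (exp_sum s c t) ^+ 2)) => // y _; last exact: sqr_ge0.
by apply: (is_derive_ext (is_deriveN (is_derive_gram c y us))) => //; rewrite opprK.
Qed.

Lemma upper_min s : upper s -> exists2 m, 0 < m & forall z, z \in s -> m <= cIm z.
Proof.
elim: s => [|z s IH] us; first by exists 1.
case: IH => [w ws|m m0 hm]; first by apply: us; rewrite inE ws orbT.
have z0 : 0 < cIm z by apply: us; rewrite inE eqxx.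
exists (Num.min m (cIm z)); first by rewrite lt_min m0 z0.
by move=> w; rewrite inE ge_min => /orP[/eqP ->|/hm ->//]; rewrite lexx orbT.
Qed.

(** The exponential decay is weakened by 1 + u <= exp u to a rational bound, which [gram_ge0] can
    solve for t explicitly. *)
Lemma gram_shift_ge s c : upper s -> exists B m, [/\ 0 <= B, 0 < m &
  forall t, 0 <= t -> `|gram s (fun z => c z * cexp (ci R * z * rc t))| <= B / (1 + m * t)].
Proof.
move=> us; have [m m0 hm] := upper_min us.
exists (\sum_(z <- s) \sum_(w <- s) cabs (c z) * cabs (c w) / cabs (z - cconj w)), (m + m); split.
- apply: sumr_ge0 => z _; apply: sumr_ge0 => w _.
  by rewrite !mulr_ge0 ?invr_ge0 ?cabs_ge0.
- exact: addr_gt0.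
move=> t t0; rewrite (le_trans (cabs_Re _)) // (le_trans (cabs_sum _ _ _)) //.
rewrite mulr_suml big_seq [leRHS]big_seq; apply: ler_sum => z zs.
rewrite (le_trans (cabs_sum _ _ _)) // mulr_suml big_seq [leRHS]big_seq.
apply: ler_sum => w ws.
rewrite !cabsM cabs_conj cabsM cabs_kern !cabs_cexp.
have ReE v : cRe (ci R * v * rc t) = - (cIm v * t).
  by rewrite ciM !cReM /=; ring.
rewrite !ReE.
have -> : cabs (c z) * expR (- (cIm z * t)) * (cabs (c w) * expR (- (cIm w * t))) /
    cabs (z - cconj w) = cabs (c z) * cabs (c w) / cabs (z - cconj w) *
    expR (- ((cIm z + cIm w) * t)).
  by rewrite mulrDl opprD expRD; ring.
apply: ler_wpM2l; first by rewrite !mulr_ge0 ?invr_ge0 ?cabs_ge0.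
have mt0 : 0 <= (m + m) * t by rewrite mulr_ge0 // ltW // addr_gt0.
rewrite expRN lef_pV2 ?posrE ?expR_gt0 ?ltr_wpDr //.
rewrite (le_trans (expR_ge1Dx _)) // ler_expR ler_wpM2r //.
by rewrite lerD ?hm.
Qed.

(** The shifted form decreases in t and tends to 0 at +oo, so its value at t = 0 cannot be
    negative. *)
Lemma gram_ge0 s d : upper s -> 0 <= gram s d.
Proof.
move=> us; rewrite leNgt; apply/negP => q0.
have [B [m [B0 m0 h]]] := gram_shift_ge d us.
(* Here m t (- gram s d) = B, so the decay bound B / (1 + m t) falls strictly below - gram s d. *)
pose t := B / (m * - gram s d).
have mq : 0 < m * - gram s d by rewrite mulr_gt0 // oppr_gt0.
have t0 : 0 <= t by rewrite divr_ge0 // ltW.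
have := gram_shift_ndecr d us t0.
rewrite (@eq_gram s (fun z => d z * cexp (ci R * z * rc 0)) d); last first.
  by move=> z _; rewrite rc0 mulr0 cexp0 mulr1.
move: (h t t0); set q := gram s d in mq q0 t t0 *; set q' := gram s _ => h1 h2.
have h3 : - q <= B / (1 + m * t).
  by apply: le_trans h1; rewrite -normrN ler_normr lerN2 h2.
have mt : 0 < 1 + m * t by rewrite ltr_wpDr // mulr_ge0 // ltW.
move: h3; rewrite ler_pdivlMr // mulrDr mulr1.
have -> : - q * (m * t) = B.
  by rewrite /t; field; move: mq; lra.
by lra.
Qed.

(** The parallelogram identity, with the form at a + b dropped by positivity. *)
Lemma gramB s (a b : C -> C) : upper s ->
  gram s (fun z => a z - b z) <= 2 * gram s a + 2 * gram s b.
Proof.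
move=> us; have := gram_ge0 (fun z => a z + b z) us.
suff : gram s (fun z => a z + b z) + gram s (fun z => a z - b z) =
   2 * gram s a + 2 * gram s b by lra.
rewrite /gram -!cReD !mulr_natl !mulr2n -!cReD; congr cRe.
rewrite -!big_split /=; apply: eq_bigr => z _; rewrite -!big_split /=.
by apply: eq_bigr => w _; rewrite !cconjD cconjN; ring.
Qed.

Lemma cpos_neq0 z x : 0 < cIm z -> 0 < x -> z + ci R * rc x != 0.
Proof.
move=> z0 x0; apply/eqP => /(congr1 (@cIm R)).
by rewrite cImD ciM /= => h; have := addr_gt0 z0 x0; rewrite h ltxx.
Qed.

Definition origin_factor x z : C := z / (z + ci R * rc x).

(** With w' = conj w, (z + ix)(w' - ix) - z w' = x^2 - ix(z - w'). Multiplied by [kern z w] = i / (z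
    - w'), the last term becomes the constant x: the defect is a rank-one form plus a Gram form,
    both nonnegative. *)
Lemma gram_origin_factorE s d x : upper s -> 0 < x ->
  gram s d - gram s (fun z => origin_factor x z * d z) =
  x * cabs (\sum_(z <- s) d z / (z + ci R * rc x)) ^+ 2 +
  x ^+ 2 * gram s (fun z => d z / (z + ci R * rc x)).
Proof.
move=> us x0.
rewrite -[x * _]/(x * cRe (rc _)) -mul_cconj -sum_mul_conj -!cRe_rcM -cReN -!cReD.
congr cRe; rewrite !big_distrr /= -!sumrN -!big_split /=; apply: eq_big_seq => z zs.
rewrite !big_distrr /= -!sumrN -!big_split /=; apply: eq_big_seq => w ws.
have z0 := cpos_neq0 (us _ zs) x0.
have : cconj (w + ci R * rc x) != 0.
  by rewrite -cabs_eq0 cabs_conj cabs_eq0 cpos_neq0 // us.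
have zw := subJ_neq0 (us _ zs) (us _ ws).
rewrite /origin_factor !cconjM !cconjV cconjD cconjM cconj_ci cconj_rc /kern => w0.
have i0 := @ci_neq0 R; have := @ci2 R.
rewrite !expr2 !rcM; set i := ci R in i0 z0 w0 *; set X := rc x in z0 w0 *.
set w' := cconj w in zw w0 * => ii.
have -> : (- (i * (z - w')))^-1 = i / (z - w').
  by rewrite invrN invfM; apply: (mulfI i0); rewrite mulrN !mulrA mulfV // ii; ring.
by field: ii; rewrite zw w0.
Qed.

Lemma gram_origin_factor s d x : upper s -> 0 < x ->
  gram s (fun z => origin_factor x z * d z) <= gram s d.
Proof.
move=> us x0; rewrite -subr_ge0 gram_origin_factorE //.
apply: addr_ge0; apply: mulr_ge0; rewrite ?sqr_ge0 ?(ltW x0) //.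
exact: gram_ge0.
Qed.

(** Up to the factor i the sum is the inner product of sum_z d_z exp(izt) with exp(-t) on (0,+oo);
    it is the rank-one term of [gram_origin_factorE] at x = 1. *)
Lemma gram_eval s d : upper s ->
  cabs (\sum_(z <- s) d z / (z + ci R)) ^+ 2 <= gram s d.
Proof.
move=> us; have := gram_origin_factorE d us ltr01; rewrite mul1r expr1n mul1r rc1 mulr1.
have := gram_ge0 (fun z => origin_factor 1 z * d z) us.
by have := gram_ge0 (fun z => d z / (z + ci R)) us; lra.
Qed.
End Qform.

(** * The logarithm of (z - n) / (z + n) as a function of real n *)

Section Log.
Variable R : realType.
Local Notation C := R[i].
Implicit Types (s : seq C) (c d : C -> C) (z w : C) (t x n : R).

(* logUp ((z - n) / (z + n)) with the argument written through arctangents (see logUp_ratioE), so that it is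
   differentiable in a real n and vanishes at n = 0. *)
Definition log_ratio z n : C :=
  Complex ((ln ((cRe z - n) ^+ 2 + cIm z ^+ 2) -
            ln ((cRe z + n) ^+ 2 + cIm z ^+ 2)) / 2)
          (atan ((cRe z + n) / cIm z) - atan ((cRe z - n) / cIm z)).

Lemma log_ratio0 z : log_ratio z 0 = 0.
Proof. by rewrite /log_ratio subr0 addr0 !subrr mul0r. Qed.

Lemma sqD_gt0 (u v : R) : 0 < v -> 0 < u ^+ 2 + v ^+ 2.
Proof. by move=> v0; rewrite ltr_wpDl ?sqr_ge0 ?exprn_gt0. Qed.

Lemma is_derive_lnsq (u e v t : R) : 0 < v ->
  is_derive t 1 (fun n => ln ((u + e * n) ^+ 2 + v ^+ 2))
    (2 * e * (u + e * t) / ((u + e * t) ^+ 2 + v ^+ 2)).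
Proof.
move=> v0.
have D1 : is_derive t 1 (fun n => u + e * n) e.
  apply: (is_derive_ext (is_deriveD (is_derive_cst u t 1) (is_deriveZ e (is_derive_id t 1)))) => //.
  by rewrite /GRing.scale /= add0r mulr1.
have D2 : is_derive t 1 (fun n => (u + e * n) ^+ 2 + v ^+ 2) (2 * e * (u + e * t)).
  apply: (is_derive_ext (is_deriveD (is_deriveM D1 D1) (is_derive_cst (v ^+ 2) t 1))).
    by move=> r; rewrite expr2.
  by rewrite /GRing.scale /= addr0; ring.
have D3 := is_derive1_ln (sqD_gt0 (u + e * t) v0).
apply: (is_derive_ext
  (@is_derive1_comp R (@ln R) (fun n => (u + e * n) ^+ 2 + v ^+ 2) t _ _ D3 D2)) => //.
by rewrite mulrC.
Qed.

Lemma is_derive_atanlin (u e v t : R) : 0 < v ->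
  is_derive t 1 (fun n => atan ((u + e * n) / v))
    (e * v / ((u + e * t) ^+ 2 + v ^+ 2)).
Proof.
move=> v0.
have D1 : is_derive t 1 (fun n => (u + e * n) / v) (e / v).
  apply: (is_derive_ext (is_deriveD (is_derive_cst (u / v) t 1) (is_deriveZ (e / v) (is_derive_id t 1)))).
    by move=> r; rewrite -[LHS]/(u / v + e / v * r); ring.
  by rewrite /GRing.scale /= add0r mulr1.
apply: (is_derive_ext (@is_derive1_comp R (@atan R) (fun n => (u + e * n) / v) t _ _
  (is_derive1_atan _) D1)) => //.
have h := sqD_gt0 (u + e * t) v0; have h2 : 0 < 1 + ((u + e * t) / v) ^+ 2.
  by rewrite ltr_wpDr ?sqr_ge0.
field.
by rewrite (gt_eqF v0) andbT; move: h2; rewrite expr_div_n; move: h; lra.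
Qed.

Lemma crc_neq0 z t : 0 < cIm z -> z + rc t != 0.
Proof.
move=> z0; apply/eqP => /(congr1 (@cIm R)); rewrite cImD /= addr0 => h.
by rewrite h ltxx in z0.
Qed.

Lemma cRe_inv z : cRe z^-1 = cRe z / (cRe z ^+ 2 + cIm z ^+ 2).
Proof. by case: z. Qed.
Lemma cIm_inv z : cIm z^-1 = - cIm z / (cRe z ^+ 2 + cIm z ^+ 2).
Proof. by case: z => a b; rewrite mulNr. Qed.

Lemma cder_log_ratio z t : 0 < cIm z ->
  cder (log_ratio z) t (- (z - rc t)^-1 - (z + rc t)^-1).
Proof.
move=> z0; split.
  apply: (is_derive_ext (is_deriveZ 2^-1
    (is_deriveB (is_derive_lnsq (cRe z) (-1) t z0) (is_derive_lnsq (cRe z) 1 t z0)))).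
    by move=> n; rewrite /= /GRing.scale /= !fctE mulN1r mul1r mulrC.
  rewrite cReD !cReN !cRe_inv !cReD !cImD !cReN !cImN /= oppr0 !addr0.
  rewrite /GRing.scale /= mul1r mulN1r.
  by field; rewrite !gt_eqF ?sqD_gt0.
apply: (is_derive_ext
    (is_deriveB (is_derive_atanlin (cRe z) 1 t z0) (is_derive_atanlin (cRe z) (-1) t z0))).
  by move=> n; rewrite /= !fctE mulN1r mul1r.
rewrite cImD !cImN !cIm_inv !cReD !cImD !cReN !cImN /= oppr0 !addr0.
rewrite mul1r mulN1r.
by field; rewrite !gt_eqF ?sqD_gt0.
Qed.

Lemma le_atan_id t : 0 <= t -> atan t <= t.
Proof.
move=> t0; have := @is_derive_le R (@atan R) id (fun x => (1 + x ^+ 2)^-1) (fun=> 1) 0 t t0.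
rewrite atan0 !subr0; apply => x _; rewrite invf_le1 ?lerDl ?sqr_ge0 //.
by rewrite ltr_wpDr ?sqr_ge0.
Qed.

Lemma pihalf_atan t : 0 < t -> 0 <= pi / 2 - atan t <= t^-1.
Proof.
move=> t0; have a0 : 0 < atan t by rewrite -(@atan0 R) lt_atan.
have a1 := atan_ltpi2 t; rewrite subr_ge0 (ltW a1) /=.
have p0 := pi_gt0 R.
have E : tan (pi / 2 - atan t) = t^-1.
  rewrite /tan sinB cosB cos_pihalf sin_pihalf !mul0r mul1r subr0 add0r mul1r.
  by rewrite -[in RHS](atanK t) /tan invf_div.
rewrite -E -[leLHS]tanK.
  by apply: le_atan_id; rewrite E invr_ge0 ltW.
by rewrite in_itv /=; apply/andP; split; lra.
Qed.

Definition i_pi : C := Complex 0 pi.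

(** This is why W_n tends to 1: the limit i pi of the logarithm makes the exponent - l pi - i l log
    equal to 0, with an error of order l |z| / n. *)
Lemma log_ratio_cvg z n : 0 < cIm z -> 0 < n -> 2 * cabs z <= n ->
  cabs (log_ratio z n - i_pi) <= 12 * cabs z / n.
Proof.
move=> z0 n0 zn; have := cabs_Re z; have := cabs_Im z.
rewrite ler_norml ler_norml => /andP[_ yz] /andP[xz1 xz2].
rewrite (le_trans (cabs_ReIm _)) // cReD cImD cReN cImN /= subr0.
set x := cRe z in xz1 xz2 *; set y := cIm z in z0 yz *.
set a := cabs z in zn yz xz1 xz2 *.
have np : n / 2 <= n + x by lra.
have nm : n / 2 <= n - x by lra.
have [np0 nm0] : 0 < n + x /\ 0 < n - x by split; lra.
have H1 : `|(ln ((x - n) ^+ 2 + y ^+ 2) - ln ((x + n) ^+ 2 + y ^+ 2)) / 2| <= 8 * a / n.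
  have A0 : 0 < (x - n) ^+ 2 + y ^+ 2 by exact: sqD_gt0.
  have B0 : 0 < (x + n) ^+ 2 + y ^+ 2 by exact: sqD_gt0.
  have An : n ^+ 2 / 4 <= (x - n) ^+ 2 + y ^+ 2 by nra.
  have Bn : n ^+ 2 / 4 <= (x + n) ^+ 2 + y ^+ 2 by nra.
  have key (A B : R) : 0 < A -> 0 < B -> n ^+ 2 / 4 <= B -> A - B <= 4 * a * n ->
      ln A - ln B <= 16 * a / n.
    move=> pA pB hB hAB; rewrite -ln_div ?posrE //.
    have -> : A / B = 1 + (A - B) / B by field; rewrite gt_eqF.
    rewrite (le_trans (le_ln1Dx _)) //.
      by rewrite mulrBl divff ?gt_eqF // ltrBrDl subrr divr_gt0.
    rewrite ler_pdivrMr // (le_trans hAB) //.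
    have : 16 * a / n * (n ^+ 2 / 4) <= 16 * a / n * B.
      by rewrite ler_wpM2l // !mulr_ge0 ?invr_ge0 ?(ltW n0) ?cabs_ge0.
    apply: le_trans; rewrite le_eqVlt; apply/orP; left; apply/eqP.
    by field; rewrite gt_eqF.
  have h1 := key _ _ A0 B0 Bn; have h2 := key _ _ B0 A0 An.
  rewrite normrM (@ger0_norm _ 2^-1) ?invr_ge0 // ler_pdivrMr // ler_norml lerNl opprB.
  apply/andP; split.
    have -> : 8 * a / n * 2 = 16 * a / n by ring.
    by apply: h2; nra.
  have -> : 8 * a / n * 2 = 16 * a / n by ring.
  by apply: h1; nra.
have H2 : `|atan ((x + n) / y) - atan ((x - n) / y) - pi| <= 4 * a / n.
  have -> : (x - n) / y = - ((n - x) / y) by rewrite -opprB mulNr.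
  rewrite atanN opprK [x + n]addrC.
  have /andP[h1 h2] := pihalf_atan (divr_gt0 np0 z0).
  have /andP[h3 h4] := pihalf_atan (divr_gt0 nm0 z0).
  rewrite invf_div in h2; rewrite invf_div in h4.
  have e1 : y / (n + x) <= 2 * a / n.
    rewrite ler_pdivrMr // mulrAC ler_pdivlMr //.
    by have : 0 < y by []; nra.
  have e2 : y / (n - x) <= 2 * a / n.
    rewrite ler_pdivrMr // mulrAC ler_pdivlMr //.
    by have : 0 < y by []; nra.
  have -> : 4 * a / n = 2 * a / n + 2 * a / n by ring.
  by rewrite ler_norml; apply/andP; split; lra.
have -> : 12 * a / n = 8 * a / n + 4 * a / n by ring.
exact: lerD.
Qed.

Lemma sqrt_atan (u v : R) : 0 < v -> Num.sqrt (1 + (u / v) ^+ 2) = Num.sqrt (u ^+ 2 + v ^+ 2) / v.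
Proof.
move=> v0; have -> : 1 + (u / v) ^+ 2 = (u ^+ 2 + v ^+ 2) / v ^+ 2.
  by field; rewrite gt_eqF.
rewrite sqrtrM ?addr_ge0 ?sqr_ge0 // -exprVn sqrtr_sqr ger0_norm // invr_ge0.
exact: ltW.
Qed.

Lemma ln_sqrt (u : R) : 0 < u -> ln (Num.sqrt u) = ln u / 2.
Proof.
move=> u0; rewrite -[in RHS](sqr_sqrtr (ltW u0)) lnXn ?sqrtr_gt0 // mulr2n.
by lra.
Qed.

(** [argUp] is an [acos], so it is enough that the difference of arctangents lies in [0, pi] and has
    the right cosine. The cosine is computed from sin (atan u) = u cos (atan u). *)
Lemma logUp_ratioE z n : 0 < cIm z -> 0 < n ->
  logUp ((z - rc n) / (z + rc n)) = log_ratio z n.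
Proof.
move=> z0 n0; set x := cRe z; set y := cIm z.
have Am : cabs (z - rc n) = Num.sqrt ((x - n) ^+ 2 + y ^+ 2).
  by rewrite /cabs cReD cImD cReN cImN /= subr0.
have Ap : cabs (z + rc n) = Num.sqrt ((x + n) ^+ 2 + y ^+ 2).
  by rewrite /cabs cReD cImD /= addr0.
have am0 := sqD_gt0 (x - n) z0; have ap0 := sqD_gt0 (x + n) z0.
rewrite -/y in am0 ap0.
have sm0 : 0 < Num.sqrt ((x - n) ^+ 2 + y ^+ 2) by rewrite sqrtr_gt0.
have sp0 : 0 < Num.sqrt ((x + n) ^+ 2 + y ^+ 2) by rewrite sqrtr_gt0.
rewrite /logUp /log_ratio -/x -/y; congr Complex.
  by rewrite cabsM cabsV Am Ap ln_div ?posrE // !ln_sqrt //; lra.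
rewrite /argUp.
set th := atan _ - atan _.
have thE : cos th = cRe ((z - rc n) / (z + rc n)) / cabs ((z - rc n) / (z + rc n)).
  rewrite /th cosB.
  have sE (u : R) : sin (atan u) = u * cos (atan u).
    rewrite -{2}(atanK u) /tan divfK // gt_eqF //.
    by apply: cos_gt0_pihalf; rewrite atan_gtNpi2 atan_ltpi2.
  rewrite !sE !cos_atan !sqrt_atan // cabsM cabsV Am Ap.
  rewrite cReM cRe_inv cIm_inv !cReD !cImD !cReN !cImN /= !oppr0 !addr0 -/x -/y.
  set S := Num.sqrt ((x - n) ^+ 2 + _) in sm0 *.
  set T := Num.sqrt ((x + n) ^+ 2 + _) in sp0 *.
  have TT : T ^+ 2 = (x + n) ^+ 2 + y ^+ 2 by rewrite sqr_sqrtr // ltW.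
  rewrite -TT; field.
  by rewrite (gt_eqF sm0) (gt_eqF sp0) gt_eqF.
rewrite -thE cosK // in_itv /= subr_ge0; apply/andP; split.
  by apply: le_atan; rewrite ler_wpM2r ?invr_ge0 ?(ltW z0) //; lra.
have := atan_ltpi2 ((x + n) / y); have := atan_gtNpi2 ((x - n) / y).
by rewrite /th; lra.
Qed.
End Log.

(** * Plancherel's identity on the line and the multiplier W_n *)

Section Pform.
Variable R : realType.
Local Notation C := R[i].
Implicit Types (s : seq C) (c d : C -> C) (z w : C) (t x n : R).

(* The integral of |sum_z d_z / (z - t)|^2 over (-n,n), with the primitive of 1 / ((t - z) (t - conj w)) explicit. *)
Definition line_form s d n : R :=
  cRe (\sum_(z <- s) \sum_(w <- s)
    d z * cconj (d w) * ((log_ratio z n - cconj (log_ratio w n)) / (z - cconj w))).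

Lemma line_form0 s d : line_form s d 0 = 0.
Proof.
rewrite /line_form cRe_sum big1 // => z _; rewrite cRe_sum big1 // => w _.
have -> : cconj (log_ratio w 0) = 0 by rewrite log_ratio0 /cconj /= oppr0.
by rewrite log_ratio0 subr0 mul0r mulr0.
Qed.

Lemma cBrc_neq0 z t : 0 < cIm z -> z - rc t != 0.
Proof. by rewrite -rcN; exact: crc_neq0. Qed.

(** Both ends of (-n,n) move, hence two squares. In each, the difference of the simple fractions at
    z and conj w contains the factor z - conj w, which cancels the denominator and leaves a rank-one
    matrix. *)
Lemma is_derive_line_form s d n : upper s ->
  is_derive n 1 (line_form s d)
    (cabs (\sum_(z <- s) d z / (z - rc n)) ^+ 2 +
     cabs (\sum_(z <- s) d z / (z + rc n)) ^+ 2).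
Proof.
move=> us.
pose G z := - (z - rc n)^-1 - (z + rc n)^-1.
have [h _] : cder (fun n => \sum_(z <- s) \sum_(w <- s)
    d z * cconj (d w) * ((log_ratio z n - cconj (log_ratio w n)) / (z - cconj w))) n
  (\sum_(z <- s) \sum_(w <- s)
    d z * cconj (d w) * ((G z - cconj (G w)) / (z - cconj w))).
  apply: cder_sum_seq => z zs; apply: cder_sum_seq => w ws.
  apply: cderZ.
  have h1 := cderD (cder_log_ratio n (us _ zs)) (cderN (cder_conj (cder_log_ratio n (us _ ws)))).
  apply: (cder_ext (cderZ (z - cconj w)^-1 h1)) => [x|]; by rewrite mulrC.
apply: (is_derive_ext h) => //.
rewrite -[RHS]/(cRe (rc _ + rc _)) -!mul_cconj -!sum_mul_conj; congr cRe.
rewrite -big_split /=; apply: eq_big_seq => z zs.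
rewrite -big_split /=; apply: eq_big_seq => w ws.
have zw := subJ_neq0 (us _ zs) (us _ ws).
have z1 := cBrc_neq0 n (us _ zs); have z2 := crc_neq0 n (us _ zs).
have : cconj (w - rc n) != 0.
  by rewrite -cabs_eq0 cabs_conj cabs_eq0 cBrc_neq0 // us.
have : cconj (w + rc n) != 0.
  by rewrite -cabs_eq0 cabs_conj cabs_eq0 crc_neq0 // us.
rewrite /G !cconjD !cconjN !cconjM !cconjV !cconjD !cconjN !cconj_rc.
move=> w2 w1; field.
by rewrite zw z1 z2 w1 w2.
Qed.

Lemma line_form_ndecr s d t x : upper s -> t <= x -> line_form s d t <= line_form s d x.
Proof.
move=> us tx.
apply: (is_derive_ndecr tx) => [n _|n _]; first exact: is_derive_line_form.
by rewrite addr_ge0 ?sqr_ge0.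
Qed.

Lemma cabs_le_sum s z : z \in s -> cabs z <= \sum_(w <- s) cabs w.
Proof.
by move=> zs; rewrite (big_rem z) //= lerDl sumr_ge0 // => w _; exact: cabs_ge0.
Qed.

(** Since [log_ratio z n] tends to i pi, each entry tends to 2 pi i / (z - conj w), which is 2 pi
    [kern z w]; [log_ratio_cvg] gives the rate for z and for w, whence 24 = 12 + 12. *)
Lemma line_form_lim s d : upper s -> exists B N, [/\ 0 <= B, 0 < N &
  forall n, N <= n -> `|line_form s d n - 2 * pi * gram s d| <= B / n].
Proof.
move=> us; pose M := \sum_(w <- s) cabs w.
have M0 : 0 <= M by apply: sumr_ge0 => w _; exact: cabs_ge0.
exists (\sum_(z <- s) \sum_(w <- s) cabs (d z) * cabs (d w) * (24 * M / cabs (z - cconj w))).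
exists (2 * M + 1); split; last first.
- move=> n Nn; have n0 : 0 < n by lra.
  rewrite -[2 * pi * _]cRe_rcM -cReN -cReD (le_trans (cabs_Re _)) //.
  have -> : \sum_(z <- s) \sum_(w <- s) d z * cconj (d w) * ((log_ratio z n - cconj (log_ratio w n)) / (z - cconj w)) -
    rc (2 * pi) * (\sum_(z <- s) \sum_(w <- s) d z * cconj (d w) * kern z w) =
    \sum_(z <- s) \sum_(w <- s) d z * cconj (d w) *
       (((log_ratio z n - i_pi R) - cconj (log_ratio w n - i_pi R)) / (z - cconj w)).
    rewrite big_distrr /= -sumrN -big_split /=; apply: eq_big_seq => z zs.
    rewrite big_distrr /= -sumrN -big_split /=; apply: eq_big_seq => w ws.
    have zw := subJ_neq0 (us _ zs) (us _ ws); have i0 := @ci_neq0 R.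
    have -> : kern z w = ci R / (z - cconj w).
      by rewrite /kern invrN invfM; apply: (mulfI i0); rewrite mulrN !mulrA mulfV // ci2; ring.
    have piE : i_pi R = ci R * rc pi by rewrite ciM /= oppr0.
    rewrite cconjD cconjN piE cconjM cconj_ci cconj_rc.
    have -> : rc (2 * pi) = rc pi + rc pi :> C by rewrite -rcD; congr rc; ring.
    by ring.
  rewrite (le_trans (cabs_sum _ _ _)) // mulr_suml big_seq [leRHS]big_seq.
  apply: ler_sum => z zs; rewrite (le_trans (cabs_sum _ _ _)) // mulr_suml big_seq [leRHS]big_seq.
  apply: ler_sum => w ws; rewrite !cabsM cabs_conj cabsV -!mulrA.
  apply: ler_wpM2l; first exact: cabs_ge0.
  apply: ler_wpM2l; first exact: cabs_ge0.
  rewrite mulrC.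
  have zM := cabs_le_sum zs; have wM := cabs_le_sum ws.
  have h v : v \in s -> cabs (log_ratio v n - i_pi R) <= 12 * M / n.
    move=> vs; have vM := cabs_le_sum vs.
    rewrite (le_trans (log_ratio_cvg (us _ vs) n0 _)) //; first by rewrite -/M in vM; lra.
    by rewrite ler_wpM2r ?invr_ge0 ?(ltW n0) // ler_wpM2l.
  have H : cabs (log_ratio z n - i_pi R - cconj (log_ratio w n - i_pi R)) <= 24 * M / n.
    rewrite (le_trans (cabsB _ _)) // cabs_conj.
    have -> : 24 * M / n = 12 * M / n + 12 * M / n by ring.
    by rewrite lerD ?h.
  have -> : 24 * (M * ((cabs (z - cconj w))^-1 / n)) = (cabs (z - cconj w))^-1 * (24 * M / n) by ring.
  by rewrite ler_wpM2l ?invr_ge0 ?cabs_ge0.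
- by lra.
- apply: sumr_ge0 => z _; apply: sumr_ge0 => w _.
  by rewrite !mulr_ge0 ?invr_ge0 ?cabs_ge0.
Qed.

Lemma le_of_le_div (a b B N : R) : 0 <= B -> 0 < N ->
  (forall n, N <= n -> a <= b + B / n) -> a <= b.
Proof.
move=> B0 N0 h; rewrite leNgt; apply/negP => ba.
have ab : 0 < a - b by rewrite subr_gt0.
have n0 : 0 < N + B / (a - b) by rewrite ltr_wpDr // divr_ge0 // ltW.
have := h (N + B / (a - b)); rewrite lerDl divr_ge0 ?(ltW ab) // => /(_ isT).
rewrite -lerBlDl ler_pdivlMr // mulrDr [_ * (B / _)]mulrC divfK ?gt_eqF //.
by have := mulr_gt0 ab N0; lra.
Qed.

Lemma line_form_le s d n : upper s -> line_form s d n <= 2 * pi * gram s d.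
Proof.
move=> us; have [B [N [B0 N0 h]]] := line_form_lim d us.
have M0 : 0 < Num.max N n by rewrite lt_max N0.
apply: (le_of_le_div B0 M0) => m; rewrite ge_max => /andP[Nm nm].
have := h m Nm; rewrite ler_norml => /andP[_ h1].
by have := line_form_ndecr d us nm; lra.
Qed.

(* Plancherel's identity for sum_z d_z exp(izt), in the form line_form n --> 2 pi gram. *)
Lemma gram_paley s d X : upper s ->
  (forall t, cabs (\sum_(z <- s) d z / (z - rc t)) ^+ 2 <= X / (1 + t ^+ 2)) ->
  gram s d <= X.
Proof.
move=> us h; have X0 : 0 <= X.
  by have := le_trans (sqr_ge0 _) (h 0); rewrite expr0n addr0 divr1.
have p0 := pi_gt0 R.
have P n : 0 <= n -> line_form s d n <= X * pi.
  move=> n0; have := @is_derive_le R (line_form s d) (fun x => 2 * X * atan x) _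
    (fun x => 2 * X * (1 + x ^+ 2)^-1) 0 n n0 (fun t _ => is_derive_line_form d t us).
  rewrite line_form0 atan0 mulr0 !subr0 => H.
  apply: (le_trans (H _ _)).
  - move=> t _; have h1 := h t; have := h (- t).
    rewrite sqrrN rcN opprK => h2.
    by rewrite -mulrA mulr_natl mulr2n lerD.
  - by have := atan_ltpi2 n; nra.
have [B [N [B0 N0 H]]] := line_form_lim d us.
suff : 2 * pi * gram s d <= X * pi by have := gram_ge0 d us; nra.
apply: (le_of_le_div B0 N0) => m Nm.
have := H m Nm; rewrite ler_norml => /andP[h1 _].
have := P m (le_trans (ltW N0) Nm); lra.
Qed.

Definition multW (l n : R) z : C := cexp (- (rc l * (rc pi + ci R * log_ratio z n))).

Lemma multWE (l : R) (k : nat) z : 0 < cIm z -> 0 < k%:R :> R -> Wn l k z = multW l k%:R z.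
Proof.
move=> z0 n0; rewrite /Wn logUp_ratioE // /multW; congr cexp; rewrite rcM; ring.
Qed.

(* Minus the derivative of gram along exp(- t h), where h = pi + i log_ratio, is the nonnegative 2 pi gram - line_form. *)
Lemma gram_multW s d l n : upper s -> 0 <= l ->
  gram s (fun z => multW l n z * d z) <= gram s d.
Proof.
move=> us l0.
pose h z : C := rc pi + ci R * log_ratio z n.
pose D t z := cexp (- (rc t * h z)) * d z.
pose f t := gram s (D t).
suff H : f l <= f 0.
  apply: le_trans H _; rewrite le_eqVlt; apply/orP; left; apply/eqP; apply: eq_gram => z _.
  by rewrite /D rc0 mul0r oppr0 cexp0 mul1r.
rewrite -lerN2; pose Q t := 2 * pi * gram s (D t) - line_form s (D t) n.
apply: (@is_derive_ndecr R (fun t => - f t) Q 0 l l0) => [t _|t _]; last first.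
  by rewrite subr_ge0 line_form_le.
have dD z : cder (D^~ z) t (- h z * D t z).
  have h1 : cder (fun t => - (rc t * h z)) t (- h z).
    apply: cderN; apply: (cder_ext (cderZ (h z) (cder_id t))) => [x|].
      by rewrite mulrC.
    by rewrite mulr1.
  apply: (cder_ext (cderZ (d z) (cder_exp h1))) => [x|]; first by rewrite mulrC.
  by rewrite /D; ring.
have [k _] : cder (fun t => \sum_(z <- s) \sum_(w <- s) kern z w * (D t z * cconj (D t w))) t
   (\sum_(z <- s) \sum_(w <- s) kern z w *
      (- h z * D t z * cconj (D t w) + D t z * cconj (- h w * D t w))).
  apply: cder_sum => z; apply: cder_sum => w; apply: cderZ.
  by apply: cderM; [|apply: cder_conj].
apply: (is_derive_ext (is_deriveN k)) => [x|].
  congr (- cRe _); apply: eq_bigr => z _; apply: eq_bigr => w _.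
  by rewrite mulrC.
rewrite /Q -[2 * pi * _]cRe_rcM -!cReN -cReD; congr cRe.
rewrite big_distrr /= -!sumrN -big_split /=; apply: eq_big_seq => z zs.
rewrite big_distrr /= -!sumrN -big_split /=; apply: eq_big_seq => w ws.
have zw := subJ_neq0 (us _ zs) (us _ ws); have i0 := @ci_neq0 R; have ii := @ci2 R.
have -> : kern z w = ci R / (z - cconj w).
  by rewrite /kern invrN invfM; apply: (mulfI i0); rewrite mulrN !mulrA mulfV // ci2; ring.
rewrite /h !(cconjM, cconjN, cconjD) cconj_ci cconj_rc.
have -> : rc (2 * pi) = rc pi + rc pi :> C by rewrite -rcD; congr rc; ring.
by field: ii.
Qed.
End Pform.

(** * Integrals over (-1,0) and the space M *)

Section Mspace.
Variable R : realType.
Local Notation C := R[i].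
Local Notation mu := (@lebesgue_measure R).
Local Notation II := (@Iv R).
Implicit Types (f g : R -> C) (h k : R -> R) (t x e : R) (a b : C).

Definition intIv h := mu.-integrable II (EFin \o h).

Lemma measurable_Iv : measurable (II : set (measurableTypeR R)).
Proof. exact: measurable_itv. Qed.
Hint Resolve measurable_Iv : core.

Lemma intIv_le h k : measurable_fun II h -> (forall t, II t -> `|h t| <= k t) ->
  intIv k -> intIv h.
Proof.
move=> mh hk; apply: le_integrable => //; first exact/measurable_EFinP.
move=> t It; rewrite /= lee_fin (le_trans (hk _ It)) ?ler_norm //.
Qed.

Lemma intIv_meas h : intIv h -> measurable_fun II h.
Proof. by move=> /measurable_int /measurable_EFinP. Qed.

Lemma intIvD h k : intIv h -> intIv k -> intIv (fun t => h t + k t).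
Proof. by move=> ih ik; exact: (integrableD measurable_Iv ih ik). Qed.

Lemma intIvZ (c : R) h : intIv h -> intIv (fun t => c * h t).
Proof. by move=> ih; exact: (integrableZl measurable_Iv c ih). Qed.

Lemma intIv_cont h : continuous h -> intIv h.
Proof.
move=> ch; apply: continuous_compact_integrable; first exact: segment_compact.
exact: continuous_subspaceT.
Qed.

Lemma int_le h k : intIv h -> intIv k -> (forall t, II t -> h t <= k t) ->
  Rintegral mu II h <= Rintegral mu II k.
Proof. by move=> ih ik hk; exact: le_Rintegral. Qed.

Lemma int_norm_le h k : measurable_fun II h -> (forall t, II t -> `|h t| <= k t) ->
  intIv k -> `|Rintegral mu II h| <= Rintegral mu II k.
Proof.
move=> mh hk ik; have ih := intIv_le mh hk ik.
rewrite (le_trans (le_normr_Rintegral _ ih)) //; apply: int_le => //.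
apply: (intIv_le _ _ ik) => [|t It]; first exact: measurableT_comp.
by rewrite normr_id hk.
Qed.

Lemma int_cst x : Rintegral mu II (fun=> x) = x.
Proof.
have E := @lebesgue_measure_itv R (`[(-1)%R, 0%R])%O.
rewrite /= lte_fin ltrN10 -EFinD opprK add0r in E.
by rewrite Rintegral_cst // -[RHS]mulr1; congr (x * _); rewrite -[RHS]/(fine 1%:E); congr fine.
Qed.

Definition ccont f := continuous (fun t => cRe (f t)) /\ continuous (fun t => cIm (f t)).

Lemma ccont_cder f (f' : R -> C) : (forall t, cder f t (f' t)) -> ccont f.
Proof. by move=> df; split => t; have [h1 h2] := df t; [exact: is_derive_cont h1|exact: is_derive_cont h2]. Qed.

Lemma ccontM f g : ccont f -> ccont g -> ccont (fun t => f t * g t).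
Proof.
move=> [fr fi] [gr gi]; split.
  have -> : (fun t => cRe (f t * g t)) =
      (fun t => cRe (f t) * cRe (g t) - cIm (f t) * cIm (g t)).
    by apply/funext => u; rewrite cReM.
  by move=> t; apply: cvgB; apply: cvgM; [exact: fr|exact: gr|exact: fi|exact: gi].
have -> : (fun t => cIm (f t * g t)) =
    (fun t => cRe (f t) * cIm (g t) + cIm (f t) * cRe (g t)).
  by apply/funext => u; rewrite cImM.
by move=> t; apply: cvgD; apply: cvgM; [exact: fr|exact: gi|exact: fi|exact: gr].
Qed.

Lemma ccont_sqr f : ccont f -> continuous (fun t => cabs (f t) ^+ 2).
Proof.
move=> [fr fi].
have -> : (fun t => cabs (f t) ^+ 2) =
    (fun t => cRe (f t) * cRe (f t) + cIm (f t) * cIm (f t)).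
  by apply/funext => u; rewrite sqr_cabs !expr2.
by move=> t; apply: cvgD; apply: cvgM; [exact: fr|exact: fr|exact: fi|exact: fi].
Qed.

Lemma inL2_ccont f : ccont f -> inL2 f.
Proof.
move=> cf; have [fr fi] := cf; split; last split; last exact: (intIv_cont (ccont_sqr cf)).
  exact: (intIv_meas (intIv_cont fr)).
exact: (intIv_meas (intIv_cont fi)).
Qed.

Definition sqI f := Rintegral mu II (fun t => cabs (f t) ^+ 2).

Lemma sqI_ge0 f : 0 <= sqI f.
Proof. by apply: Rintegral_ge0 => t _; exact: sqr_ge0. Qed.

Lemma inL2_sq f : inL2 f -> intIv (fun t => cabs (f t) ^+ 2).
Proof. by case=> _ []. Qed.

Lemma inL2D f g : inL2 f -> inL2 g -> inL2 (fun t => f t + g t).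
Proof.
move=> [fr [fi f2]] [gr [gi g2]].
have mr : measurable_fun II (fun t => cRe (f t + g t)).
  rewrite (_ : (fun t => _) = (fun t => cRe (f t)) \+ (fun t => cRe (g t))).
    exact: measurable_funD.
  by apply/funext => u; rewrite cReD.
have mi : measurable_fun II (fun t => cIm (f t + g t)).
  rewrite (_ : (fun t => _) = (fun t => cIm (f t)) \+ (fun t => cIm (g t))).
    exact: measurable_funD.
  by apply/funext => u; rewrite cImD.
split => //; split => //.
apply: (@intIv_le _ (fun t => 2 * cabs (f t) ^+ 2 + 2 * cabs (g t) ^+ 2)).
- rewrite (_ : (fun t => _) = (fun t => cRe (f t + g t) ^+ 2) \+ (fun t => cIm (f t + g t) ^+ 2)).
    by apply: measurable_funD; apply: measurable_funX.
  by apply/funext => u; rewrite sqr_cabs.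
- move=> t _; rewrite ger0_norm ?sqr_ge0 //.
  have := cabsD (f t) (g t); have := cabs_ge0 (f t + g t).
  by have := sqr_ge0 (cabs (f t) - cabs (g t)); nra.
- by apply: intIvD; apply: intIvZ.
Qed.

Lemma inL2Z a f : inL2 f -> inL2 (fun t => a * f t).
Proof.
move=> [fr [fi f2]].
split; last split.
- rewrite (_ : (fun t => _) = (fun t => cRe a * cRe (f t)) \- (fun t => cIm a * cIm (f t))).
    by apply: measurable_funB; apply: measurable_funM.
  by apply/funext => u; rewrite cReM.
- rewrite (_ : (fun t => _) = (fun t => cRe a * cIm (f t)) \+ (fun t => cIm a * cRe (f t))).
    by apply: measurable_funD; apply: measurable_funM.
  by apply/funext => u; rewrite cImM.
- rewrite (_ : (fun t => _) = EFin \o (fun t => cabs a ^+ 2 * cabs (f t) ^+ 2)).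
    exact: intIvZ.
  by apply/funext => u /=; rewrite cabsM exprMn.
Qed.

Lemma inL2B f g : inL2 f -> inL2 g -> inL2 (fun t => f t - g t).
Proof.
move=> fL gL; have := inL2D fL (inL2Z (-1) gL).
by congr inL2; apply/funext => t; rewrite mulN1r.
Qed.

Lemma inL2_conj f : inL2 f -> inL2 (fun t => cconj (f t)).
Proof.
move=> [fr [fi f2]]; split => //; split; first exact: measurable_funN.
by move: f2; congr (mu.-integrable _ _); apply/funext => t; rewrite cabs_conj.
Qed.

Lemma sqIB f g : inL2 f -> inL2 g ->
  sqI (fun t => f t - g t) <= 2 * sqI f + 2 * sqI g.
Proof.
move=> fL gL; rewrite /sqI -!RintegralZl //; [|exact: inL2_sq..].
rewrite -RintegralD //; [|by apply: intIvZ; exact: inL2_sq..].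
apply: int_le; first exact: inL2_sq (inL2B fL gL).
  by apply: intIvD; apply: intIvZ; exact: inL2_sq.
move=> t _; have := cabsB (f t) (g t); have := cabs_ge0 (f t - g t).
by have := sqr_ge0 (cabs (f t) - cabs (g t)); nra.
Qed.

Definition intIvC f := intIv (fun t => cRe (f t)) /\ intIv (fun t => cIm (f t)).

Lemma intIvC_mul f g : inL2 f -> inL2 g -> intIvC (fun t => f t * g t).
Proof.
move=> fL gL; have [fr [fi f2]] := fL; have [gr [gi g2]] := gL.
have k2 : intIv (fun t => cabs (f t) ^+ 2 + cabs (g t) ^+ 2) by exact: intIvD.
have bnd t : cabs (f t * g t) <= cabs (f t) ^+ 2 + cabs (g t) ^+ 2.
  rewrite cabsM; have := sqr_ge0 (cabs (f t) - cabs (g t)).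
  by have := cabs_ge0 (f t); have := cabs_ge0 (g t); nra.
split; apply: (intIv_le _ _ k2).
- rewrite (_ : (fun t => _) = (fun t => cRe (f t) * cRe (g t)) \- (fun t => cIm (f t) * cIm (g t))).
    by apply: measurable_funB; apply: measurable_funM.
  by apply/funext => u; rewrite cReM.
- by move=> t _; rewrite (le_trans (cabs_Re _)).
- rewrite (_ : (fun t => _) = (fun t => cRe (f t) * cIm (g t)) \+ (fun t => cIm (f t) * cRe (g t))).
    by apply: measurable_funD; apply: measurable_funM.
  by apply/funext => u; rewrite cImM.
- by move=> t _; rewrite (le_trans (cabs_Im _)).
Qed.

Lemma cintD f g : intIvC f -> intIvC g -> cint (fun t => f t + g t) = cint f + cint g.
Proof.
move=> [fr fi] [gr gi]; apply: complex_eqP; rewrite ?cReD ?cImD /= -RintegralD //;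
  by apply: eq_Rintegral => t _; rewrite ?cReD ?cImD.
Qed.

Lemma intIvCZ a f : intIvC f -> intIvC (fun t => a * f t).
Proof.
move=> [fr fi]; split.
  have := intIvD (intIvZ (cRe a) fr) (intIvZ (- cIm a) fi).
  by congr intIv; apply/funext => t; rewrite cReM mulNr.
have := intIvD (intIvZ (cRe a) fi) (intIvZ (cIm a) fr).
by congr intIv; apply/funext => t; rewrite cImM.
Qed.

Lemma intIvCD f g : intIvC f -> intIvC g -> intIvC (fun t => f t + g t).
Proof.
move=> [fr fi] [gr gi]; split.
  by have := intIvD fr gr; congr intIv; apply/funext => t; rewrite cReD.
by have := intIvD fi gi; congr intIv; apply/funext => t; rewrite cImD.
Qed.

Lemma cintZ a f : intIvC f -> cint (fun t => a * f t) = a * cint f.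
Proof.
move=> [fr fi]; apply: complex_eqP; rewrite ?cReM ?cImM /= -!RintegralZl //.
  rewrite -RintegralB //; [|exact: intIvZ..].
  by apply: eq_Rintegral => t _; rewrite cReM.
rewrite -RintegralD //; [|exact: intIvZ..].
by apply: eq_Rintegral => t _; rewrite cImM.
Qed.

Lemma cint0 : cint (fun=> 0) = 0 :> C.
Proof. by apply: complex_eqP; rewrite /= int_cst. Qed.

Lemma intIvC0 : intIvC (fun=> 0).
Proof. by split; apply: intIv_cont; exact: cst_continuous. Qed.

Lemma cint_sum (I : Type) (r : seq I) (F : I -> R -> C) :
  (forall i, intIvC (F i)) ->
  cint (fun t => \sum_(i <- r) F i t) = \sum_(i <- r) cint (F i).
Proof.
move=> iF; suff [] : cint (fun t => \sum_(i <- r) F i t) = \sum_(i <- r) cint (F i) /\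
   intIvC (fun t => \sum_(i <- r) F i t) by [].
elim: r => [|i r [IH iIH]].
  rewrite big_nil -[0 in RHS]cint0; split.
    by congr cint; apply/funext => t; rewrite big_nil.
  by have := intIvC0; congr intIvC; apply/funext => t; rewrite big_nil.
have E : (fun t => \sum_(j <- i :: r) F j t) = (fun t => F i t + \sum_(j <- r) F j t).
  by apply/funext => t; rewrite big_cons.
by rewrite E big_cons -IH; split; [exact: cintD|exact: intIvCD].
Qed.

(** The arithmetic-geometric inequality with a free weight stands in for Cauchy-Schwarz. The halves
    in [k] pay for bounding the modulus by |Re| + |Im|. *)
Lemma cint_mul_le f g e : inL2 f -> inL2 g -> 0 < e ->
  cabs (cint (fun t => f t * g t)) <= e * sqI f + e^-1 * sqI g.
Proof.
move=> fL gL e0; have [fr [fi f2]] := fL; have [gr [gi g2]] := gL.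
have [ir ii] := intIvC_mul fL gL.
pose k t := e / 2 * cabs (f t) ^+ 2 + e^-1 / 2 * cabs (g t) ^+ 2.
have ik : intIv k by apply: intIvD; apply: intIvZ; exact: inL2_sq.
have bnd t : cabs (f t * g t) <= k t.
  rewrite cabsM /k; have := sqr_ge0 (e * cabs (f t) - cabs (g t)).
  have -> : e / 2 * cabs (f t) ^+ 2 + e^-1 / 2 * cabs (g t) ^+ 2 =
     ((e * cabs (f t) - cabs (g t)) ^+ 2 / e + 2 * (cabs (f t) * cabs (g t))) / 2.
    by field; rewrite gt_eqF.
  move=> /(divr_ge0)/(_ (ltW e0)) => h; lra.
have E : Rintegral mu II k = (e * sqI f + e^-1 * sqI g) / 2.
  rewrite /k RintegralD //; [|by apply: intIvZ; exact: inL2_sq..].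
  rewrite !RintegralZl //; [|exact: inL2_sq..].
  by rewrite -/(sqI f) -/(sqI g); ring.
rewrite (le_trans (cabs_ReIm _)) //.
have -> : e * sqI f + e^-1 * sqI g = Rintegral mu II k + Rintegral mu II k by rewrite E; lra.
apply: lerD; apply: int_norm_le => //.
- exact: intIv_meas.
- by move=> t _; rewrite (le_trans (cabs_Re _)).
- exact: intIv_meas.
- by move=> t _; rewrite (le_trans (cabs_Im _)).
Qed.

Lemma sqI_le g k : inL2 g -> intIv k -> (forall t, II t -> cabs (g t) ^+ 2 <= k t) ->
  sqI g <= Rintegral mu II k.
Proof. by move=> gL ik gk; apply: int_le => //; exact: inL2_sq. Qed.

Lemma cint_mul_sup f g (K : R) : inL2 f -> inL2 g -> 0 <= K ->
  (forall t, -1 <= t <= 0 -> cabs (g t) <= K) ->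
  cabs (cint (fun t => f t * g t)) <= K * (sqI f + 1).
Proof.
move=> fL gL K0 gK; have f0 := sqI_ge0 f.
(* The natural weight is K, which may be 0; K + e is used and e is sent to 0. *)
have key e : 0 < e -> cabs (cint (fun t => f t * g t)) <= (K + e) * (sqI f + 1).
  move=> e0; have Ke : 0 < K + e by lra.
  rewrite (le_trans (cint_mul_le fL gL Ke)) // mulrDr mulr1 lerD2l.
  rewrite mulrC ler_pdivrMr // -expr2 -(int_cst ((K + e) ^+ 2)).
  apply: sqI_le => //; first by apply: intIv_cont; exact: cst_continuous.
  move=> t; rewrite /Iv /= in_itv /= => /gK h; have := cabs_ge0 (g t); nra.
apply/ler_addgt0Pr => e e0.
have := key (e / (sqI f + 1)) (divr_gt0 e0 (ltr_wpDl f0 ltr01)).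
rewrite mulrDl divfK //; lra.
Qed.

Lemma int_FTC (h H : R -> R) : continuous h -> (forall t, is_derive t 1 H (h t)) ->
  Rintegral mu II h = H 0 - H (-1).
Proof.
move=> ch dH; have cH := fun t => is_derive_cont (dH t).
rewrite /Rintegral (@continuous_FTC2 R h H) //.
- exact: continuous_subspaceT.
- split; first by move=> t _; have [] := dH t.
    by apply: cvg_at_right_filter; exact: cH.
  by apply: cvg_at_left_filter; exact: cH.
- by move=> t _; have [_] := dH t; rewrite derive1E.
Qed.
End Mspace.

(** * The characteristic function and its divided differences *)

Section Trans.
Variable R : realType.
Local Notation C := R[i].
Implicit Types (s : seq C) (c d : C -> C) (z w a : C) (t x n : R).

Lemma cReiM z t : cRe (ci R * z * rc t) = - (cIm z * t).
Proof. by rewrite ciM !cReM /=; ring. Qed.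

Lemma cder_expi z t :
  cder (fun t => cexp (ci R * z * rc t)) t (ci R * z * cexp (ci R * z * rc t)).
Proof.
apply: cder_exp; apply: (cder_ext (cderZ _ (cder_id t))) => //.
by rewrite mulr1.
Qed.

Lemma cabs_expi z t : cabs (cexp (ci R * z * rc t)) = expR (- (cIm z * t)).
Proof. by rewrite cabs_cexp cReiM. Qed.

Lemma cabs_expi_le z t : 0 <= cIm z -> -1 <= t ->
  cabs (cexp (ci R * z * rc t)) <= expR (cIm z).
Proof.
move=> z0 t1; rewrite cabs_expi ler_expR -mulrN; have := ler_wpM2l z0 t1; lra.
Qed.

(** [sqr_cabs_increment] along the segment from 0 to a serves as the mean value inequality. *)
Lemma cexp_sub1 a : cabs (cexp a - 1) <= cabs a * expR (cabs a).
Proof.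
have h := @sqr_cabs_increment R (fun t => cexp (a * rc t)) (fun t => a * cexp (a * rc t))
  (fun t => (cabs a * expR (cabs a)) ^+ 2 * t) (fun=> (cabs a * expR (cabs a)) ^+ 2) 0 1 ltr01.
rewrite -ler_sqr ?nnegrE ?mulr_ge0 ?cabs_ge0 ?expR_ge0 //.
rewrite rc0 mulr0 cexp0 rc1 mulr1 in h.
rewrite (le_trans (h _ _ _)) //.
- move=> t _; apply: cder_exp; apply: (cder_ext (cderZ a (cder_id t))) => //.
  by rewrite mulr1.
- move=> t _; apply: (is_derive_ext (is_deriveZ _ (is_derive_id t 1))) => //.
  by rewrite /GRing.scale /= mulr1.
- move=> t /andP[t0 t1]; rewrite ler_sqr ?nnegrE ?mulr_ge0 ?cabs_ge0 ?expR_ge0 //.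
  rewrite cabsM cabs_cexp ler_wpM2l ?cabs_ge0 // ler_expR.
  rewrite mulrC cRe_rcM (le_trans (ler_norm _)) // normrM (ger0_norm t0).
  have := cabs_Re a; have := normr_ge0 (cRe a); nra.
- by rewrite subr0 mul1r mulr0 subr0 mulr1.
Qed.

Lemma cexp_sub1_sub a : cabs (cexp a - 1 - a) <= cabs a ^+ 2 * expR (cabs a).
Proof.
have h := @sqr_cabs_increment R (fun t => cexp (a * rc t) - a * rc t)
  (fun t => a * (cexp (a * rc t) - 1))
  (fun t => (cabs a ^+ 2 * expR (cabs a)) ^+ 2 * t)
  (fun=> (cabs a ^+ 2 * expR (cabs a)) ^+ 2) 0 1 ltr01.
rewrite -ler_sqr ?nnegrE ?mulr_ge0 ?sqr_ge0 ?cabs_ge0 ?expR_ge0 //.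
rewrite rc0 mulr0 cexp0 rc1 mulr1 subr0 in h.
have -> : cexp a - 1 - a = cexp a - a - 1 by ring.
rewrite (le_trans (h _ _ _)) //.
- move=> t _; have e1 : cder (fun t => a * rc t) t a.
    by apply: (cder_ext (cderZ a (cder_id t))) => //; rewrite mulr1.
  apply: (cder_ext (cderD (cder_exp e1) (cderN e1))) => //.
  by rewrite mulrBr mulr1.
- move=> t _; apply: (is_derive_ext (is_deriveZ _ (is_derive_id t 1))) => //.
  by rewrite /GRing.scale /= mulr1.
- move=> t /andP[t0 t1]; rewrite ler_sqr ?nnegrE ?mulr_ge0 ?sqr_ge0 ?cabs_ge0 ?expR_ge0 //.
  rewrite cabsM expr2 -mulrA ler_wpM2l ?cabs_ge0 // (le_trans (cexp_sub1 _)) //.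
  have ta : cabs (a * rc t) <= cabs a.
    by rewrite cabsM cabs_rc ger0_norm //; have := cabs_ge0 a; nra.
  by rewrite ler_pM ?cabs_ge0 ?expR_ge0 // ler_expR.
- by rewrite mulr0 !subr0 mulr1 mul1r.
Qed.

(* The integral of exp(iwx) over x from t to 0. *)
Definition exp_prim w t : C :=
  if w == 0 then - rc t else (1 - cexp (ci R * w * rc t)) / (ci R * w).

Lemma exp_prim0 w : exp_prim w 0 = 0.
Proof. by rewrite /exp_prim rc0 oppr0 mulr0 cexp0 subrr mul0r; case: ifP. Qed.

Lemma cder_exp_prim w t : cder (exp_prim w) t (- cexp (ci R * w * rc t)).
Proof.
rewrite /exp_prim; have [->|w0] := eqVneq w 0.
  by rewrite mulr0 mul0r cexp0; apply: cderN; exact: cder_id.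
have e := cderD (cder_cst 1 t) (cderN (cder_expi w t)).
apply: (cder_ext (cderZ (ci R * w)^-1 e)) => [x|].
  by rewrite mulrC.
by rewrite add0r mulrN mulrA mulVf ?mul1r // mulf_neq0 // ci_neq0.
Qed.

Lemma ccont_exp_prim w : ccont (exp_prim w).
Proof. exact: (ccont_cder (cder_exp_prim w)). Qed.
Lemma ccont_expi w : ccont (fun t => cexp (ci R * w * rc t)).
Proof. exact: (ccont_cder (cder_expi w)). Qed.

Lemma cder_exp_sum s c t : cder (exp_sum s c) t
  (\sum_(z <- s) c z * (ci R * z * cexp (ci R * z * rc t))).
Proof. by apply: cder_sum => z; apply: cderZ; exact: cder_expi. Qed.

Lemma sqI_exp_sum s c : upper s ->
  sqI (exp_sum s c) = gram s (fun z => c z * cexp (ci R * z * rc (-1))) - gram s c.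
Proof.
move=> us; have cu : ccont (exp_sum s c) := ccont_cder (cder_exp_sum s c).
have dN t : is_derive t 1 (fun t => - gram s (fun z => c z * cexp (ci R * z * rc t)))
    (cabs (exp_sum s c t) ^+ 2).
  by apply: (is_derive_ext (is_deriveN (is_derive_gram c t us))) => //; rewrite opprK.
rewrite /sqI (int_FTC (ccont_sqr cu) dN) opprK addrC; congr (_ - _).
by apply: eq_gram => z _; rewrite rc0 mulr0 cexp0 mulr1.
Qed.

(** The integral of exp(-izx) [exp_sum s c x] over x from t to 0. *)
Definition exp_sum_prim s c z t : C := \sum_(w <- s) c w * exp_prim (w - z) t.

Lemma cder_exp_sum_prim s c z t :
  cder (exp_sum_prim s c z) t (- (exp_sum s c t * cexp (ci R * - z * rc t))).
Proof.
have h : cder (exp_sum_prim s c z) t (\sum_(w <- s) c w * (- cexp (ci R * (w - z) * rc t))).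
  by apply: cder_sum => w; apply: cderZ; exact: cder_exp_prim.
apply: (cder_ext h) => //.
rewrite /exp_sum mulr_suml -sumrN; apply: eq_bigr => w _.
rewrite [LHS]mulrN; congr (- _); rewrite -[RHS]mulrA -cexpD; congr (_ * cexp _); ring.
Qed.

(** For x <= 0 and Im z >= 0 the weight exp(-izx) has modulus at most 1, so Cauchy-Schwarz on (t,0)
    costs no exponential factor. The primitive of the squared modulus of the exponential sum is
    minus its shifted [gram]. *)
Lemma exp_sum_prim_bound s c z t : upper s -> 0 <= cIm z -> -1 <= t <= 0 ->
  cabs (exp_sum_prim s c z t) ^+ 2 <= sqI (exp_sum s c).
Proof.
move=> us z0 /andP[t1]; rewrite le_eqVlt => /predU1P[->|t0].
  rewrite /exp_sum_prim big1 ?cabs0 ?expr0n ?sqI_ge0 // => w _.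
  by rewrite exp_prim0 mulr0.
have h := @sqr_cabs_increment R (exp_sum_prim s c z)
  (fun t => - (exp_sum s c t * cexp (ci R * - z * rc t)))
  (fun t => - gram s (fun z => c z * cexp (ci R * z * rc t)))
  (fun t => cabs (exp_sum s c t) ^+ 2) t 0 t0.
have -> : cabs (exp_sum_prim s c z t) = cabs (exp_sum_prim s c z 0 - exp_sum_prim s c z t).
  rewrite {2}/exp_sum_prim big1 ?add0r ?cabsN // => w _.
  by rewrite exp_prim0 mulr0.
rewrite (le_trans (h _ _ _)) //.
- by move=> x _; exact: cder_exp_sum_prim.
- move=> x _; apply: (is_derive_ext (is_deriveN (is_derive_gram c x us))) => //.
  by rewrite opprK.
- move=> x /andP[_ x0]; rewrite cabsN cabsM exprMn cabs_expi cImN mulNr opprK.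
  rewrite ler_piMr ?sqr_ge0 // exprn_ile1 ?expR_ge0 // -expR0 ler_expR.
  by rewrite mulr_ge0_le0.
- rewrite opprK sqI_exp_sum //.
  have m1 := gram_shift_ndecr c us t1; have m2 := gram_shift_ndecr c us (ltW t0).
  have -> : gram s c = gram s (fun z => c z * cexp (ci R * z * rc 0)).
    by apply: eq_gram => w _; rewrite rc0 mulr0 cexp0 mulr1.
  by nra.
Qed.
End Trans.

(** * Divided differences of D bounded by the norm of M *)

Section Delay.
Variable R : realType.
Local Notation C := R[i].
Implicit Types (s : seq C) (c d : C -> C) (z w a : C) (t x n : R).
Variable phi : R -> C.
Hypothesis phiL2 : inL2 phi.

Lemma normM_lincomb s c :
  normM (lincomb s c) ^+ 2 = cabs (\sum_(z <- s) c z) ^+ 2 + sqI (exp_sum s c).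
Proof.
rewrite sqr_sqrtr; last first.
  by rewrite addr_ge0 ?sqr_ge0 // Rintegral_ge0 // => t _; exact: sqr_ge0.
by rewrite /lincomb /=; under eq_bigr do rewrite mulr1.
Qed.

Lemma normM_ge0 (u : Melt R) : 0 <= normM u.
Proof. exact: sqrtr_ge0. Qed.

Lemma cabs_sum_le_normM s c : cabs (\sum_(z <- s) c z) <= normM (lincomb s c).
Proof.
rewrite -ler_sqr ?nnegrE ?cabs_ge0 ?normM_ge0 // normM_lincomb.
by rewrite lerDl sqI_ge0.
Qed.

Lemma sqI_le_normM s c : sqI (exp_sum s c) <= normM (lincomb s c) ^+ 2.
Proof. by rewrite normM_lincomb lerDr sqr_ge0. Qed.

(** A majorant of the L^2 norm of phi that avoids the square root. *)
Definition Phi : R := sqI phi + 1.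

Lemma Phi_ge1 : 1 <= Phi. Proof. by rewrite /Phi lerDr sqI_ge0. Qed.

Lemma phi_sup (k : R -> C) (K : R) : ccont k -> 0 <= K ->
  (forall t, -1 <= t <= 0 -> cabs (k t) <= K) ->
  cabs (cint (fun t => phi t * k t)) <= K * Phi.
Proof. by move=> kc K0 hk; apply: cint_mul_sup => //; exact: inL2_ccont. Qed.

(** The L^2 norm of exp(-yt) on (-1,0) is smaller than its supremum exp(y) by a factor of order sqrt
    y. This gain makes the phi term of D small against exp(-iz) high in the half-plane. *)
Lemma phi_exp (k : R -> C) y : ccont k -> 0 < y ->
  (forall t, -1 <= t <= 0 -> cabs (k t) <= expR (- (y * t))) ->
  cabs (cint (fun t => phi t * k t)) <= Phi * expR y / Num.sqrt y.
Proof.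
move=> kc y0 hk; have kL := inL2_ccont kc.
have r0 : 0 < Num.sqrt y by rewrite sqrtr_gt0.
have E0 := expR_gt0 y.
have e0 : 0 < expR y / Num.sqrt y by rewrite divr_gt0.
rewrite (le_trans (cint_mul_le phiL2 kL e0)) //.
have dH t : is_derive t 1 (fun t => - (2 * y)^-1 * expR (- (2 * y) * t)) (expR (- (2 * y) * t)).
  have D1 : is_derive t 1 (fun t => - (2 * y) * t) (- (2 * y)).
    apply: (is_derive_ext (is_deriveZ (- (2 * y)) (is_derive_id t 1))) => //.
    by rewrite /GRing.scale /= mulr1.
  have D2 := @is_derive1_comp R (@expR R) (fun t => - (2 * y) * t) t _ _ (is_derive_expR _) D1.
  apply: (is_derive_ext (is_deriveZ (- (2 * y)^-1) D2)) => //.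
  by rewrite /GRing.scale /=; field; rewrite gt_eqF.
have ch : continuous (fun t => expR (- (2 * y) * t)).
  move=> t; apply: continuous_comp; first exact: mulrl_continuous.
  exact: continuous_expR.
have hs : sqI k <= expR y ^+ 2 / (2 * y).
  have := sqI_le kL (intIv_cont ch) _; rewrite (int_FTC ch dH) => /(_ _)/le_trans -> //.
    move=> t; rewrite /Iv /= in_itv /= => /hk h.
    have -> : expR (- (2 * y) * t) = expR (- (y * t)) ^+ 2.
      by rewrite -expRM_natl; congr expR; ring.
    by rewrite ler_sqr ?nnegrE ?cabs_ge0 ?expR_ge0.
  rewrite mulr0 expR0 mulrN1 opprK mulr1 mulNr opprK expRM_natl.
  rewrite [_ ^+ 2 / _]mulrC gerDr oppr_le0 invr_ge0; lra.
have rr : Num.sqrt y ^+ 2 = y by rewrite sqr_sqrtr // ltW.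
have : (expR y / Num.sqrt y)^-1 * sqI k <= expR y / Num.sqrt y / 2.
  rewrite (le_trans (ler_wpM2l _ hs)) ?invr_ge0 ?(ltW e0) //.
  have -> : expR y ^+ 2 / (2 * y) = expR y ^+ 2 / (2 * Num.sqrt y ^+ 2) by rewrite rr.
  rewrite le_eqVlt; apply/orP; left; apply/eqP; field.
  by rewrite (gt_eqF r0) (gt_eqF E0).
have -> : Phi * expR y / Num.sqrt y = expR y / Num.sqrt y * sqI phi + expR y / Num.sqrt y.
  by rewrite /Phi; ring.
by move: (sqI_ge0 phi); nra.
Qed.

Definition phiInt (k : R -> C) : C := cint (fun t => phi t * k t).

Lemma phi_intIvC (k : R -> C) : ccont k -> intIvC (fun t => phi t * k t).
Proof. by move=> kc; apply: intIvC_mul => //; exact: inL2_ccont. Qed.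

Lemma phiIntB (k k' : R -> C) : ccont k -> ccont k' ->
  phiInt (fun t => k t - k' t) = phiInt k - phiInt k'.
Proof.
move=> kc kc'; rewrite -[- phiInt k']mulN1r -cintZ; last exact: phi_intIvC.
rewrite -cintD; [|exact: phi_intIvC|exact/intIvCZ/phi_intIvC].
by congr cint; apply/funext => t; ring.
Qed.

Lemma phiIntZ a (k : R -> C) : ccont k -> phiInt (fun t => a * k t) = a * phiInt k.
Proof.
move=> kc; rewrite -cintZ; last exact: phi_intIvC.
by congr cint; apply/funext => t; ring.
Qed.

Lemma phiInt_sum s c (k : C -> R -> C) : (forall z, ccont (k z)) ->
  phiInt (fun t => \sum_(z <- s) c z * k z t) = \sum_(z <- s) c z * phiInt (k z).
Proof.
move=> kc; transitivity (cint (fun t => \sum_(z <- s) c z * (phi t * k z t))).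
  congr cint; apply/funext => t; rewrite big_distrr /=; apply: eq_bigr => z _; ring.
rewrite cint_sum => [|z]; last exact/intIvCZ/phi_intIvC.
by apply: eq_bigr => z _; rewrite cintZ //; exact: phi_intIvC.
Qed.

Lemma DfunE z : Dfun phi z =
  - (ci R * z) + cexp (- (ci R * z)) + phiInt (fun t => cexp (ci R * z * rc t)).
Proof.
congr (_ + _); congr cint; apply/funext => t; rewrite mulrC; congr (_ * cexp _); ring.
Qed.

(* If D(w) = 0, this is (D(z) - D(w)) / (i (w - z)), continued to w = z (see div_diffE). *)
Definition div_diff z w : C := 1 + cexp (- (ci R * z)) * exp_prim (w - z) (-1) +
  phiInt (fun t => cexp (ci R * z * rc t) * exp_prim (w - z) t).

Lemma div_diffE z w : Dfun phi w = 0 -> w != z ->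
  div_diff z w = Dfun phi z / (ci R * (w - z)).
Proof.
move=> Dw wz; have wz0 : w - z != 0 by rewrite subr_eq0.
have i0 := @ci_neq0 R; have iwz : ci R * (w - z) != 0 by rewrite mulf_neq0.
apply: (mulIf iwz); rewrite divfK // -[Dfun phi z]subr0 -Dw !DfunE /div_diff.
rewrite /exp_prim (negbTE wz0) !mulrDl mul1r.
have -> : phiInt (fun t => cexp (ci R * z * rc t) * ((1 - cexp (ci R * (w - z) * rc t)) / (ci R * (w - z)))) *
    (ci R * (w - z)) = phiInt (fun t => cexp (ci R * z * rc t)) - phiInt (fun t => cexp (ci R * w * rc t)).
  rewrite -phiIntB; [|exact: ccont_expi..].
  rewrite mulrC -phiIntZ; last first.
    by apply: ccontM; [exact: ccont_expi|have := ccont_exp_prim (w - z); rewrite /exp_prim (negbTE wz0)].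
  congr phiInt; apply/funext => t.
  have -> : cexp (ci R * w * rc t) = cexp (ci R * z * rc t) * cexp (ci R * (w - z) * rc t).
    by rewrite -cexpD; congr cexp; ring.
  by field; rewrite i0 wz0.
have -> : cexp (- (ci R * w)) = cexp (- (ci R * z)) * cexp (ci R * (w - z) * rc (-1)).
  by rewrite -cexpD; congr cexp; rewrite rcN rc1; ring.
by field; rewrite i0 wz0.
Qed.

Lemma ccont_exp_sum_prim s c z : ccont (exp_sum_prim s c z).
Proof. exact: (ccont_cder (cder_exp_sum_prim s c z)). Qed.

(** On the right the coefficients enter only through their sum and through the exponential sum on
    (-1,0), that is, through the two components of the element of M; hence the bound by its norm. *)
Lemma sum_div_diff s c z : \sum_(w <- s) c w * div_diff z w =
  \sum_(w <- s) c w + cexp (- (ci R * z)) * exp_sum_prim s c z (-1) +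
  phiInt (fun t => cexp (ci R * z * rc t) * exp_sum_prim s c z t).
Proof.
have -> : phiInt (fun t => cexp (ci R * z * rc t) * exp_sum_prim s c z t) =
   \sum_(w <- s) c w * phiInt (fun t => cexp (ci R * z * rc t) * exp_prim (w - z) t).
  rewrite -phiInt_sum; last first.
    by move=> w; apply: ccontM; [exact: ccont_expi|exact: ccont_exp_prim].
  congr phiInt; apply/funext => t; rewrite /exp_sum_prim big_distrr /=.
  by apply: eq_bigr => w _; ring.
rewrite /exp_sum_prim big_distrr /= -!big_split /=; apply: eq_bigr => w _.
by rewrite /div_diff; ring.
Qed.

Lemma sum_div_diff_bound s c z : upper s -> 0 <= cIm z ->
  cabs (\sum_(w <- s) c w * div_diff z w) <=
  (Phi + 2) * expR (cIm z) * normM (lincomb s c).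
Proof.
move=> us z0; rewrite sum_div_diff; set N := normM _.
have N0 : 0 <= N by exact: normM_ge0.
have E1 : 1 <= expR (cIm z) by rewrite -expR0 ler_expR.
have U t : -1 <= t <= 0 -> cabs (exp_sum_prim s c z t) <= N.
  move=> ht; rewrite -ler_sqr ?nnegrE ?cabs_ge0 //.
  exact: le_trans (exp_sum_prim_bound _ us z0 ht) (sqI_le_normM _ _).
have h1 := cabs_sum_le_normM s c; rewrite -/N in h1.
have h2 : cabs (cexp (- (ci R * z)) * exp_sum_prim s c z (-1)) <= expR (cIm z) * N.
  rewrite cabsM ler_pM ?cabs_ge0 ?U ?lexx ?lerN10 //.
  by rewrite cabs_cexp cReN ciM /= opprK.
have h3 : cabs (phiInt (fun t => cexp (ci R * z * rc t) * exp_sum_prim s c z t)) <= expR (cIm z) * N * Phi.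
  apply: phi_sup.
  - by apply: ccontM; [exact: ccont_expi|exact: ccont_exp_sum_prim].
  - by rewrite mulr_ge0 ?expR_ge0.
  - move=> t ht; rewrite cabsM ler_pM ?cabs_ge0 ?U //.
    by case/andP: ht => ht _; exact: cabs_expi_le.
rewrite (le_trans (cabsD _ _)) // (le_trans (lerD (cabsD _ _) (lexx _))) //.
by have := lerD (lerD h1 h2) h3; nra.
Qed.
End Delay.

(** * D on the real axis and the equivalence of norms *)

Section Delay2.
Variable R : realType.
Local Notation C := R[i].
Implicit Types (s : seq C) (c d : C -> C) (z w a : C) (t x n : R).
Variable phi : R -> C.
Hypothesis phiL2 : inL2 phi.
Local Notation Phi := (Phi phi).
Local Notation phiInt := (phiInt phi).

Lemma expi_sub_le z w t : -1 <= t <= 0 ->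
  cabs (cexp (ci R * z * rc t) - cexp (ci R * w * rc t)) <=
  expR (- (cIm w * t)) * (cabs (z - w) * expR (cabs (z - w))).
Proof.
move=> /andP[t1 t0].
have -> : cexp (ci R * z * rc t) - cexp (ci R * w * rc t) =
   cexp (ci R * w * rc t) * (cexp (ci R * (z - w) * rc t) - 1).
  by rewrite mulrBr mulr1 -cexpD; congr (cexp _ - _); ring.
rewrite cabsM cabs_expi ler_wpM2l ?expR_ge0 // (le_trans (cexp_sub1 _)) //.
have h : cabs (ci R * (z - w) * rc t) <= cabs (z - w).
  rewrite !cabsM cabs_ci cabs_rc mul1r ler_piMr ?cabs_ge0 //.
  by rewrite ler_norml t1 (le_trans t0).
by rewrite ler_pM ?cabs_ge0 ?expR_ge0 // ler_expR.
Qed.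

Lemma cexpN_ciE z : cexp (- (ci R * z)) = cexp (ci R * z * rc (-1)).
Proof. by congr cexp; rewrite rcN rc1; ring. Qed.

Lemma Dfun_lip z w : cabs (Dfun phi z - Dfun phi w) <=
  cabs (z - w) * (1 + (1 + Phi) * expR `|cIm w| * expR (cabs (z - w))).
Proof.
rewrite !DfunE //; set A := phiInt _; set B := phiInt _.
have -> : - (ci R * z) + cexp (- (ci R * z)) + A - (- (ci R * w) + cexp (- (ci R * w)) + B) =
  - (ci R * (z - w)) + (cexp (- (ci R * z)) - cexp (- (ci R * w))) + (A - B) by ring.
set N := cabs (z - w).
have key t : -1 <= t <= 0 ->
    cabs (cexp (ci R * z * rc t) - cexp (ci R * w * rc t)) <= expR `|cIm w| * (N * expR N).
  move=> ht; rewrite (le_trans (expi_sub_le _ _ ht)) // ler_wpM2r ?mulr_ge0 ?cabs_ge0 ?expR_ge0 //.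
  rewrite ler_expR (le_trans (ler_norm _)) // normrN normrM ler_piMr //.
  by case/andP: ht => t1 t0; rewrite ler_norml t1 (le_trans t0).
have h1 : cabs (- (ci R * (z - w))) = N by rewrite cabsN cabsM cabs_ci mul1r.
have h2 : cabs (cexp (- (ci R * z)) - cexp (- (ci R * w))) <= expR `|cIm w| * (N * expR N).
  by rewrite !cexpN_ciE key // lexx lerN10.
have h3 : cabs (A - B) <= expR `|cIm w| * (N * expR N) * Phi.
  rewrite /A /B -phiIntB //; [|exact: ccont_expi..].
  apply: phi_sup => //.
    by apply: ccont_cder => t; exact: cderD (cder_expi z t) (cderN (cder_expi w t)).
  by rewrite !mulr_ge0 ?expR_ge0 ?cabs_ge0.
rewrite (le_trans (cabsD _ _)) // (le_trans (lerD (cabsD _ _) (lexx _))) // h1.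
rewrite (le_trans (lerD (lerD (lexx _) h2) h3)) // le_eqVlt; apply/orP; left; apply/eqP.
ring.
Qed.

Hypothesis Lam_upper : forall z, Lam phi z -> 0 < cIm z.

Definition subLam s := forall z, z \in s -> Lam phi z.

Lemma subLam_upper s : subLam s -> upper s.
Proof. by move=> sL z /sL /Lam_upper. Qed.

Lemma Dfun_rc_ge t : `|t| - 1 - Phi <= cabs (Dfun phi (rc t)).
Proof.
rewrite DfunE //.
have h1 : cabs (- (ci R * rc t)) = `|t| by rewrite cabsN cabsM cabs_ci mul1r cabs_rc.
have h2 : cabs (cexp (- (ci R * rc t))) = 1.
  by rewrite cabs_cexp cReN ciM /= oppr0 oppr0 expR0.
have h3 : cabs (phiInt (fun x => cexp (ci R * rc t * rc x))) <= Phi.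
  rewrite -[leRHS]mul1r; apply: phi_sup => //; first exact: ccont_expi.
  by move=> x _; rewrite cabs_expi /= mul0r oppr0 expR0.
move: h1 h2 h3; set a := - _; set b := cexp _; set k := phiInt _ => h1 h2 h3.
have := cabsB (a + b + k) (b + k); have -> : a + b + k - (b + k) = a by ring.
by have := cabsD b k; lra.
Qed.

Lemma Dfun_rc_cont : continuous (fun t => cabs (Dfun phi (rc t))).
Proof.
move=> t; apply/cvgrPdist_le => e e0.
pose L := 1 + (1 + Phi) * expR `|cIm (rc t)| * expR 1.
have P1 := Phi_ge1 phi.
have L0 : 0 < L.
  by rewrite /L ltr_wpDr // !mulr_ge0 ?expR_ge0 //; lra.
near=> u.
have ut : `|t - u| <= Num.min 1 (e / L).
  near: u; apply: cvgr_dist_le; first exact: cvg_id.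
  by rewrite lt_min ltr01 divr_gt0.
move: ut; rewrite le_min => /andP[u1 ue].
have h := Dfun_lip (rc u) (rc t).
have e1 : cabs (rc u - rc t) = `|t - u| by rewrite -rcN -rcD cabs_rc distrC.
rewrite e1 in h.
have h2 : cabs (Dfun phi (rc u) - Dfun phi (rc t)) <= e.
  rewrite (le_trans h) // -[leRHS](divfK (lt0r_neq0 L0)).
  rewrite ler_pM //; last first.
    rewrite /L lerD2l ler_wpM2l ?ler_expR // mulr_ge0 ?expR_ge0 //; lra.
  by rewrite addr_ge0 // !mulr_ge0 ?expR_ge0 //; lra.
rewrite (le_trans _ h2) // ler_norml.
have := cabsD (Dfun phi (rc t) - Dfun phi (rc u)) (Dfun phi (rc u)).
have := cabsD (Dfun phi (rc u) - Dfun phi (rc t)) (Dfun phi (rc t)).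
rewrite !subrK cabsBC => k1 k2; apply/andP; split; lra.
Unshelve. all: by end_near.
Qed.

(** Beyond T = 2 (Phi + 1) one has |D(t)| >= |t| / 2 and |t| >= 1, which gives the constant 1/8. On
    [-T,T] the continuous function |D| attains a minimum, positive because no zero is real. *)
Lemma Dfun_rc_lower : exists2 k, 0 < k & forall t, k * (1 + t ^+ 2) <= cabs (Dfun phi (rc t)) ^+ 2.
Proof.
have P1 := Phi_ge1 phi; pose T := 2 * (Phi + 1).
have T0 : 0 <= T by rewrite /T; lra.
have NT : - T <= T by lra.
have [c _ hc] := @EVT_min R (fun t => cabs (Dfun phi (rc t))) (- T) T NT (continuous_subspaceT Dfun_rc_cont).
have fc : 0 < cabs (Dfun phi (rc c)).
  rewrite cabs_gt0; apply/eqP => D0.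
  by have := @Lam_upper (rc c) D0; rewrite /= ltxx.
have T1 : 0 < 1 + T ^+ 2 by rewrite ltr_wpDr ?sqr_ge0.
exists (Num.min (8^-1) (cabs (Dfun phi (rc c)) ^+ 2 / (1 + T ^+ 2))).
  by rewrite lt_min divr_gt0 ?exprn_gt0 // andbT; lra.
move=> t; have t2 : 0 < 1 + t ^+ 2 by rewrite ltr_wpDr ?sqr_ge0.
have [tT|Tt] := leP `|t| T.
  have h : cabs (Dfun phi (rc c)) <= cabs (Dfun phi (rc t)).
    by apply: hc; rewrite in_itv /= -ler_norml.
  apply: (@le_trans _ _ (cabs (Dfun phi (rc c)) ^+ 2)); last first.
    by rewrite ler_sqr ?nnegrE ?cabs_ge0.
  apply: (@le_trans _ _ (cabs (Dfun phi (rc c)) ^+ 2 / (1 + T ^+ 2) * (1 + t ^+ 2))).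
    by rewrite ler_wpM2r ?(ltW t2) // ge_min lexx orbT.
  rewrite mulrAC ler_pdivrMr // ler_wpM2l ?sqr_ge0 // lerD2l -(real_normK (num_real t)).
  by rewrite ler_sqr ?nnegrE.
apply: (@le_trans _ _ (8^-1 * (1 + t ^+ 2))).
  by rewrite ler_wpM2r ?(ltW t2) // ge_min lexx.
have := Dfun_rc_ge t; move: (cabs _) => D hD.
rewrite -(real_normK (num_real t)); move: (`|t|) Tt hD => r; rewrite /T; nra.
Qed.

Lemma gram_le_normM : exists2 k, 0 <= k & forall s c, subLam s ->
  gram s c <= k * normM (lincomb s c) ^+ 2.
Proof.
have [k k0 hk] := Dfun_rc_lower.
exists ((Phi + 2) ^+ 2 / k); first by rewrite divr_ge0 ?sqr_ge0 ?ltW.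
move=> s c sL; have us := subLam_upper sL; apply: gram_paley => // t.
have z0 : 0 <= cIm (rc t) by [].
have := sum_div_diff_bound phiL2 c us z0; rewrite /= expR0 mulr1.
have -> : \sum_(w <- s) c w * div_diff phi (rc t) w =
    Dfun phi (rc t) / ci R * \sum_(z <- s) c z / (z - rc t).
  rewrite big_distrr /=; apply: eq_big_seq => w ws.
  have w0 := us _ ws; have wt : w != rc t.
    by apply/eqP => wE; rewrite wE /= ltxx in w0.
  rewrite div_diffE //; last exact: sL.
  by field; rewrite ci_neq0 subr_eq0 wt.
rewrite !cabsM cabsV cabs_ci invr1 mulr1.
set S := cabs (\sum_(z <- s) _); set N := normM _ => h.
have t2 : 0 < 1 + t ^+ 2 by rewrite ltr_wpDr ?sqr_ge0.
rewrite ler_pdivlMr //.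
have -> : (Phi + 2) ^+ 2 / k * N ^+ 2 = ((Phi + 2) * N) ^+ 2 / k by ring.
rewrite ler_pdivlMr //; apply: (@le_trans _ _ ((cabs (Dfun phi (rc t)) * S) ^+ 2)).
  by rewrite exprMn -mulrA [_ * k]mulrC [leLHS]mulrC ler_wpM2r ?sqr_ge0.
have DS0 : 0 <= cabs (Dfun phi (rc t)) * S by rewrite mulr_ge0 ?cabs_ge0.
by rewrite ler_sqr ?nnegrE //; exact: le_trans DS0 h.
Qed.

(* The coefficients, with respect to t + 1, of the same exponential sum on (-1,+oo). *)
Definition shift_coef c z : C := c z * cexp (ci R * z * rc (-1)).

(** The part over (0,+oo) is [gram_le_normM]; [sqI_exp_sum] adds the part over (-1,0). *)
Lemma gram_shift_coef_le : exists2 k, 0 <= k & forall s c, subLam s ->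
  gram s (shift_coef c) <= k * normM (lincomb s c) ^+ 2.
Proof.
have [k k0 hk] := gram_le_normM.
exists (k + 1); first by rewrite addr_ge0.
move=> s c sL; have := sqI_exp_sum c (subLam_upper sL); have := hk s c sL.
by have := sqI_le_normM s c; rewrite /shift_coef; lra.
Qed.

(** The scalar component sum_z c_z must be recovered from the exponential sum. D(z) = 0 gives z = -
    i (exp(-iz) + [phiInt] of exp(izt)); inserted in 1 = (z + i) / (z + i), it expresses the sum
    through the values of sum_z c_z exp(izt) / (z + i) at t = 0 and t = -1 and their phi-average,
    all bounded by [gram_eval]. *)
Lemma normM_le_gram s c : subLam s ->
  normM (lincomb s c) ^+ 2 <= ((Phi + 2) ^+ 2 + 1) * gram s (shift_coef c).
Proof.
move=> sL; have us := subLam_upper sL; set Q := gram s _.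
have Q0 : 0 <= Q by exact: gram_ge0.
have r0 := sqrtr_ge0 Q.
have ev t : -1 <= t -> cabs (\sum_(z <- s) c z * cexp (ci R * z * rc t) / (z + ci R)) <= Num.sqrt Q.
  move=> t1; rewrite -ler_sqr ?nnegrE ?cabs_ge0 // (sqr_sqrtr Q0).
  have h := gram_eval (fun z => c z * cexp (ci R * z * rc t)) us.
  by apply: (le_trans h); have := gram_shift_ndecr c us t1.
have E : \sum_(z <- s) c z = ci R * (\sum_(z <- s) c z * cexp (ci R * z * rc 0) / (z + ci R)) +
    - ci R * (\sum_(z <- s) c z * cexp (ci R * z * rc (-1)) / (z + ci R)) +
    - ci R * phiInt (fun t => \sum_(z <- s) c z * cexp (ci R * z * rc t) / (z + ci R)).
  have -> : phiInt (fun t => \sum_(z <- s) c z * cexp (ci R * z * rc t) / (z + ci R)) =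
      \sum_(z <- s) (c z / (z + ci R)) * phiInt (fun t => cexp (ci R * z * rc t)).
    rewrite -(phiInt_sum phiL2); last by move=> z; exact: ccont_expi.
    congr (phiInt _); apply/funext => t; apply: eq_bigr => z _; ring.
  rewrite !big_distrr /= -!big_split /=; apply: eq_big_seq => z zs.
  have z0 := @cpos_neq0 R z 1 (us _ zs) ltr01; rewrite rc1 mulr1 in z0.
  have := sL _ zs; rewrite /Lam /= DfunE // cexpN_ciE => D0.
  have ii := @ci2 R.
  have zE : z = - ci R * (cexp (ci R * z * rc (-1)) + phiInt (fun t => cexp (ci R * z * rc t))).
    apply: (mulfI (@ci_neq0 R)); rewrite mulrA mulrN ii opprK mul1r.
    by apply/eqP; rewrite -subr_eq0 opprD addrA -oppr_eq0 !opprD !opprK D0.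
  rewrite rc0 mulr0 cexp0 mulr1.
  transitivity (c z * (- ci R * (cexp (ci R * z * rc (-1)) +
      phiInt (fun t => cexp (ci R * z * rc t))) + ci R) / (z + ci R)); last by ring.
  by rewrite -zE mulfK.
have h0 := ev 0 (lerN10 R).
have h1 := ev (-1) (lexx _).
have h2 : cabs (phiInt (fun t => \sum_(z <- s) c z * cexp (ci R * z * rc t) / (z + ci R))) <=
    Num.sqrt Q * Phi.
  apply: phi_sup => // [|t /andP[t1 _]]; last exact: ev.
  apply: (@ccont_cder R _ (fun t => \sum_(z <- s) c z / (z + ci R) * (ci R * z * cexp (ci R * z * rc t)))) => t.
  apply: cder_sum => z; apply: (cder_ext (cderZ (c z / (z + ci R)) (cder_expi z t))) => // x.
  by ring.
have h3 : cabs (\sum_(z <- s) c z) <= (Phi + 2) * Num.sqrt Q.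
  rewrite E (le_trans (cabsD _ _)) // (le_trans (lerD (cabsD _ _) (lexx _))) //.
  rewrite !cabsM !cabsN cabs_ci !mul1r; lra.
have h4 : cabs (\sum_(z <- s) c z) ^+ 2 <= (Phi + 2) ^+ 2 * Q.
  rewrite -[X in _ * X](sqr_sqrtr Q0) -exprMn ler_sqr ?nnegrE ?cabs_ge0 //.
  exact: le_trans (cabs_ge0 _) h3.
rewrite normM_lincomb sqI_exp_sum // -/(shift_coef c) -/Q.
have := @gram_ge0 R s c us; lra.
Qed.
End Delay2.

(** * The zeros of the characteristic function *)

Section ZerosLoc.
Variable R : realType.
Local Notation C := R[i].
Implicit Types (s : seq C) (c d : C -> C) (z w a : C) (t x n : R).
Variable phi : R -> C.
Hypothesis phiL2 : inL2 phi.
Hypothesis Lam_simple : forall lam, Lam phi lam -> exists2 d : C, d != 0 &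
     forall eps : R, 0 < eps -> exists2 del : R, 0 < del &
       forall z, z != lam -> cabs (z - lam) < del ->
         cabs ((Dfun phi z - Dfun phi lam) / (z - lam) - d) < eps.
Local Notation Phi := (Phi phi).

(** Near a zero, the difference quotient at another zero would be 0, at distance |d| from the
    nonzero derivative d. Away from the zeros the Lipschitz bound keeps D from vanishing. *)
Lemma Lam_isolated z : exists2 r, 0 < r &
  forall w, Lam phi w -> cabs (w - z) < r -> w = z.
Proof.
have [Dz|Dz] := eqVneq (Dfun phi z) 0.
  have [d d0 /(_ (cabs d))] := Lam_simple Dz; rewrite cabs_gt0 => /(_ d0) [r r0 h].
  exists r => // w Dw wz; apply/eqP/negPn/negP => /h/(_ wz).
  by rewrite Dw Dz subrr mul0r sub0r cabsN ltxx.
have P1 := Phi_ge1 phi.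
pose L := 1 + (1 + Phi) * expR `|cIm z| * expR 1.
have L0 : 0 < L.
  by rewrite /L ltr_wpDr // !mulr_ge0 ?expR_ge0 //; lra.
exists (Num.min 1 (cabs (Dfun phi z) / L)).
  by rewrite lt_min ltr01 divr_gt0 // cabs_gt0.
move=> w Dw; rewrite lt_min => /andP[w1 wL]; exfalso.
have := Dfun_lip phiL2 w z; rewrite Dw sub0r cabsN => h.
suff : cabs (Dfun phi z) < cabs (Dfun phi z) by rewrite ltxx.
apply: (le_lt_trans h); apply: le_lt_trans (_ : cabs (w - z) * L < _).
  rewrite ler_wpM2l ?cabs_ge0 // /L lerD2l ler_wpM2l ?ler_expR ?(ltW w1) //.
  by rewrite mulr_ge0 ?expR_ge0 //; lra.
by rewrite -ltr_pdivlMr.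
Qed.

Lemma Lam_finite r : exists2 s, uniq s & forall z, (z \in s) <-> Lam phi z /\ cabs z < r.
Proof.
suff /finite_seqP[s sE] : finite_set [set z | Lam phi z /\ cabs z < r].
  exists (undup s) => [|z]; first exact: undup_uniq.
  rewrite mem_undup; suff -> : (z \in s) = [set` s] z :> Prop by rewrite -sE.
  by [].
pose cpl (p : 'rV[R]_2) : C := Complex (p ord0 ord0) (p ord0 ord_max).
have iso (p : 'rV[R]_2) : exists e : R, 0 < e /\
    forall w, Lam phi w -> cabs (w - cpl p) < e -> w = cpl p.
  by have [e e0 h] := Lam_isolated (cpl p); exists e.
have [rho hrho] := choice iso.
have cK : cover_compact [set v : 'rV[R]_2 | forall i, `[- r, r] (v ord0 i)].
  by rewrite -compact_cover; apply: (@rV_compact R 2 (fun=> `[- r, r])) => _; exact: segment_compact.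
(* Balls in 'rV_2 are those of the sup norm, while the modulus is bounded by |Re| + |Im|: hence half
   the isolation radius. *)
have [] := cK _ setT (fun p => (ball p (rho p / 2))°).
- by move=> p _; exact: open_interior.
- move=> p _; exists p => //; apply: nbhsx_ballx.
  by have [h _] := hrho p; rewrite divr_gt0.
move=> D _ hD.
have fB : finite_set (cpl @` [set` D]) by exact/finite_image/finite_fset.
apply: sub_finite_set fB.
move=> z [Dz zr].
pose v : 'rV[R]_2 := \row_i (if i == ord0 then cRe z else cIm z).
have [] : cover [set` D] (fun p => (ball p (rho p / 2))°) v.
  apply: hD => i; rewrite mxE /= in_itv /= -ler_norml.
  by case: ifP => _; rewrite (le_trans _ (ltW zr)) // ?cabs_Re ?cabs_Im.
move=> p pD /interior_subset [_ bp].
exists p => //; apply/esym; have [_] := hrho p; apply => //.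
rewrite (le_lt_trans (cabs_ReIm _)) // cReD cImD cReN cImN /=.
have := bp ord0 ord0; have := bp ord0 ord_max; rewrite !mxE /= /ball /=.
by rewrite distrC [X in _ -> X < _ -> _]distrC; lra.
Qed.
End ZerosLoc.

(** * Location and separation of the large zeros *)

Section ZerosSep.
Variable R : realType.
Local Notation C := R[i].
Implicit Types (s : seq C) (c d : C -> C) (z w a : C) (t x n : R).
Variable phi : R -> C.
Hypothesis phiL2 : inL2 phi.
Local Notation Phi := (Phi phi).
Local Notation phiInt := (phiInt phi).

(* The height above which phiInt is a relative perturbation of size at most 1/64. *)
Definition high : R := (64 * Phi) ^+ 2.

Lemma high_ge1 : 1 <= high.
Proof. by have := Phi_ge1 phi; rewrite /high; nra. Qed.

Lemma phi_exp_high (k : R -> C) y (K : R) : ccont k -> high <= y -> 0 < K ->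
  (forall t, -1 <= t <= 0 -> cabs (k t) <= K * expR (- (y * t))) ->
  cabs (phiInt k) <= K * expR y / 64.
Proof.
move=> kc yY K0 hk; have Y1 := high_ge1; have y0 : 0 < y by lra.
have r0 : 0 < Num.sqrt y by rewrite sqrtr_gt0.
have P1 := Phi_ge1 phi.
have hr : 64 * Phi <= Num.sqrt y.
  rewrite -ler_sqr ?nnegrE ?(ltW r0) //; last lra.
  by rewrite sqr_sqrtr // ltW.
have cK : ccont (fun t => (rc K)^-1 * k t).
  have [c1 c2] := kc; rewrite -rcV; split.
    have -> : (fun t => cRe (rc K^-1 * k t)) = (fun t => K^-1 * cRe (k t)).
      by apply/funext => t; rewrite cRe_rcM.
    by move=> t; apply: cvgM; [exact: cvg_cst|exact: c1].
  have -> : (fun t => cIm (rc K^-1 * k t)) = (fun t => K^-1 * cIm (k t)).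
    by apply/funext => t; rewrite cIm_rcM.
  by move=> t; apply: cvgM; [exact: cvg_cst|exact: c2].
have hk' t : -1 <= t <= 0 -> cabs ((rc K)^-1 * k t) <= expR (- (y * t)).
  move=> /hk h; rewrite cabsM cabsV cabs_rc gtr0_norm // mulrC ler_pdivrMr //.
  by rewrite mulrC.
have := phi_exp phiL2 cK y0 hk'.
rewrite -/(phiInt _) phiIntZ // cabsM cabsV cabs_rc gtr0_norm // mulrC ler_pdivrMr //.
move=> h; rewrite (le_trans h) // mulrC -!mulrA ler_wpM2l ?(ltW K0) //.
rewrite mulrA mulrAC mulrC ler_wpM2l ?expR_ge0 // ler_pdivrMr //; lra.
Qed.

Lemma Lam_eq z : Lam phi z ->
  ci R * z = cexp (ci R * z * rc (-1)) + phiInt (fun t => cexp (ci R * z * rc t)).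
Proof.
rewrite /Lam /= DfunE // cexpN_ciE => D0; apply/eqP.
by rewrite -subr_eq0 opprD addrA -oppr_eq0 !opprD !opprK D0.
Qed.

Lemma expR_Im z : cabs (cexp (ci R * z * rc (-1))) = expR (cIm z).
Proof. by rewrite cabs_expi mulrN1 opprK. Qed.

(** In iz = exp(-iz) + (phi term) the last term is at most exp(Im z) / 64, so the high zeros lie
    close to the curve |z| = exp(Im z). *)
Lemma Lam_high z : Lam phi z -> high <= cIm z ->
  `|expR (cIm z) - cabs z| <= expR (cIm z) / 64.
Proof.
move=> /Lam_eq zE zY.
have h : cabs (phiInt (fun t => cexp (ci R * z * rc t))) <= expR (cIm z) / 64.
  rewrite -[expR _]mul1r; apply: phi_exp_high => //; first exact: ccont_expi.
  by move=> t _; rewrite mul1r cabs_expi.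
have az : cabs (ci R * z) = cabs z by rewrite cabsM cabs_ci mul1r.
have azE := congr1 (@cabs R) zE; rewrite az in azE.
rewrite -expR_Im azE; move: h; rewrite -expR_Im.
set a := cexp _; set b := phiInt _ => h.
have h1 := cabsD a b; have h2 := cabsB (a + b) b; rewrite addrK in h2.
by rewrite ler_norml; apply/andP; split; lra.
Qed.

(** A zero of height below [high] has modulus below exp(high) (1 + Phi), so only high zeros lie
    beyond this radius. The added 64 provides the lower bound on the modulus used in [Lam_sep]. *)
Definition far_radius : R := expR high * (1 + Phi) + 64.

Lemma Lam_far z : Lam phi z -> 0 < cIm z -> far_radius <= cabs z -> high <= cIm z /\ 64 <= cabs z.
Proof.
move=> /Lam_eq zE z0 zr; have P1 := Phi_ge1 phi; have E0 := expR_gt0 high.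
split; last first.
  by apply: le_trans zr; rewrite /far_radius lerDr mulr_ge0 ?expR_ge0 //; lra.
rewrite leNgt; apply/negP => zY.
have az : cabs (ci R * z) = cabs z by rewrite cabsM cabs_ci mul1r.
have h : cabs (phiInt (fun t => cexp (ci R * z * rc t))) <= expR (cIm z) * Phi.
  apply: phi_sup => //; first exact: ccont_expi.
  by move=> t /andP[t1 _]; apply: cabs_expi_le => //; exact: ltW.
have := cabsD (cexp (ci R * z * rc (-1))) (phiInt (fun t => cexp (ci R * z * rc t))).
rewrite -zE az expR_Im; have : expR (cIm z) <= expR high by rewrite ler_expR ltW.
by move: zr; rewrite /far_radius; nra.
Qed.

Lemma expR_quarter : expR (4^-1) <= 4 / 3 :> R.
Proof.
have h := expR_ge1Dx (- (4^-1) : R); have := expRxMexpNx_1 (4^-1 : R).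
by have := expR_gt0 (4^-1 : R); nra.
Qed.

(** Subtracting the equations of two zeros at distance N equates i(z - w) with exp(-iw) (exp(-i(z -
    w)) - 1) plus a small term. The left side has size N, while the product has size at least (2/3)
    N exp(Im w): impossible once exp(Im w) >= 2. *)
Lemma Lam_close z w : Lam phi z -> Lam phi w -> high <= cIm w ->
  cabs (z - w) <= 4^-1 -> z = w.
Proof.
move=> /Lam_eq zE /Lam_eq wE wY zw; apply/eqP/negPn/negP => zNw.
pose N := cabs (z - w); have N0 : 0 < N by rewrite cabs_gt0 subr_eq0.
have q := expR_quarter.
have shift_coef : expR N <= 4 / 3 by rewrite (le_trans _ q) // ler_expR.
pose k t := cexp (ci R * z * rc t) - cexp (ci R * w * rc t).
have hk : cabs (phiInt k) <= 4 / 3 * N * expR (cIm w) / 64.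
  apply: phi_exp_high => //.
  - by apply: ccont_cder => t; exact: cderD (cder_expi z t) (cderN (cder_expi w t)).
  - by rewrite mulr_gt0 // divr_gt0.
  - move=> t ht; rewrite mulrC (le_trans (expi_sub_le _ _ ht)) // ler_wpM2l ?expR_ge0 //.
    by rewrite mulrC ler_wpM2r // ltW.
have E : ci R * (z - w) = cexp (ci R * w * rc (-1)) * (cexp (- (ci R * (z - w))) - 1) + phiInt k.
  rewrite phiIntB //; [|exact: ccont_expi..].
  have e1 : cexp (ci R * z * rc (-1)) = cexp (ci R * w * rc (-1)) * cexp (- (ci R * (z - w))).
    by rewrite -cexpD; congr cexp; rewrite rcN rc1; ring.
  transitivity (ci R * z - ci R * w); first by ring.
  rewrite {1}zE {1}wE e1; ring.
pose a := - (ci R * (z - w)).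
have aN : cabs a = N by rewrite cabsN cabsM cabs_ci mul1r.
have h1 := cexp_sub1_sub a; rewrite aN in h1.
have h2 : N - cabs (cexp a - 1 - a) <= cabs (cexp a - 1).
  have := cabsB (cexp a - 1) (cexp a - 1 - a).
  have -> : cexp a - 1 - (cexp a - 1 - a) = a by ring.
  by rewrite aN; lra.
have h3 : expR (cIm w) * cabs (cexp a - 1) <= N + cabs (phiInt k).
  rewrite -expR_Im -cabsM.
  have -> : cexp (ci R * w * rc (-1)) * (cexp a - 1) = ci R * (z - w) - phiInt k.
    by rewrite E /a; ring.
  by rewrite (le_trans (cabsB _ _)) // cabsM cabs_ci mul1r.
have Y1 := high_ge1; have E2 : 2 <= expR (cIm w).
  by rewrite (le_trans _ (expR_ge1Dx _)) //; lra.
have N2 : N ^+ 2 * expR N <= N / 3.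
  rewrite expr2 -mulrA ler_wpM2l ?(ltW N0) //.
  have h : N * expR N <= 4^-1 * (4 / 3) by rewrite ler_pM ?expR_ge0 ?(ltW N0).
  by rewrite (le_trans h) //; lra.
have h4 : 2 / 3 * N <= cabs (cexp a - 1) by lra.
move: (cabs (cexp a - 1)) (cabs (phiInt k)) (expR (cIm w)) hk h3 E2 h4 => A B E'; nra.
Qed.

(** If the heights differ by d, the moduli have ratio at least about exp(d) >= 1 + d by [Lam_high].
    But |z - w| <= 1/16 + d and |w| >= 64 allow only a ratio 1 + (1/16 + d) / 64. Hence d <= 1/27,
    and 1/16 + 1/27 is within the range of [Lam_close]. *)
Lemma Lam_sep z w : Lam phi z -> Lam phi w -> high <= cIm z -> high <= cIm w ->
  64 <= cabs z -> 64 <= cabs w -> `|cRe z - cRe w| <= 16^-1 -> z = w.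
Proof.
wlog zw : z w / cIm w <= cIm z => [hw|] Dz Dw zY wY z64 w64 re.
  have [/hw|/ltW/hw h] := leP (cIm w) (cIm z); first exact.
  by apply/esym/h => //; rewrite distrC.
apply: Lam_close => //.
pose d := cIm z - cIm w; have d0 : 0 <= d by rewrite subr_ge0.
have := Lam_high Dz zY; have := Lam_high Dw wY.
rewrite !ler_norml => /andP[w1 w2] /andP[z1 z2].
have zwd : cabs (z - w) <= 16^-1 + d.
  rewrite (le_trans (cabs_ReIm _)) // cReD cImD cReN cImN lerD //.
  by rewrite ger0_norm.
have tr := cabsD (z - w) w; rewrite subrK in tr.
have Ed : expR (cIm z) = expR d * expR (cIm w) by rewrite -expRD subrK.
have d1 := expR_ge1Dx d.
have Ew := expR_gt0 (cIm w).
suff : d <= 27^-1 by lra.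
rewrite leNgt; apply/negP => dl.
move: z1 z2 w1 w2; rewrite Ed; move: (expR d) (expR (cIm w)) (cabs z) (cabs w) (cabs (z - w)) d1 Ew tr zwd w64 z64
  => e E a b n d1 Ew tr zwd w64 z64 z1 z2 w1 w2.
have : (1 + d) * E <= e * E by rewrite ler_wpM2r // ltW.
move=> h1.
have h2 : 63 / 64 * ((1 + d) * E) <= a by lra.
have h3 : a <= b * (1 + (16^-1 + d) / 64) by nra.
have h4 : b <= 65 / 64 * E by lra.
have h5 : a <= 65 / 64 * E * (1 + (16^-1 + d) / 64).
  rewrite (le_trans h3) // ler_wpM2r //; lra.
have : 63 / 64 * (1 + d) * E <= 65 / 64 * (1 + (16^-1 + d) / 64) * E by lra.
rewrite ler_pM2r //; lra.
Qed.

Lemma expR_Im_le : exists2 K, 1 <= K & forall z, Lam phi z -> expR (cIm z) <= K * (1 + cabs z).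
Proof.
have E0 := expR_ge0 high.
exists (2 + expR high); first by lra.
move=> z Dz; have z0 := cabs_ge0 z; have [zY|/ltW zY] := leP high (cIm z).
  by have := Lam_high Dz zY; rewrite ler_norml => /andP[h1 h2]; nra.
have : expR (cIm z) <= expR high by rewrite ler_expR.
by nra.
Qed.

(** At the zero z every off-diagonal divided difference vanishes, so the sum reduces to c_z times
    the diagonal value i D'(z). That value has size about exp(Im z) and cancels the exponential in
    [sum_div_diff_bound]. *)
Lemma coef_high s c z : upper s -> subLam phi s -> uniq s -> z \in s ->
  high <= cIm z -> cabs (c z) <= 4 * (Phi + 2) * normM (lincomb s c).
Proof.
move=> us sL us' zs zY; have Y1 := high_ge1.
have z0 : 0 <= cIm z by lra.
have := sum_div_diff_bound phiL2 c us z0.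
rewrite (bigD1_seq z) //= big_seq_cond big1 ?addr0; last first.
  move=> w /andP[ws wz]; rewrite div_diffE //; last exact: sL.
  by rewrite (sL _ zs) mul0r mulr0.
have E2 : 2 <= expR (cIm z) by rewrite (le_trans _ (expR_ge1Dx _)) //; lra.
have h : expR (cIm z) / 4 <= cabs (div_diff phi z z).
  rewrite /div_diff subrr /exp_prim eqxx rcN rc1 opprK mulr1 cexpN_ciE.
  have h1 : cabs (phiInt (fun t => cexp (ci R * z * rc t) * - rc t)) <= 1 * expR (cIm z) / 64.
    apply: phi_exp_high => //.
      by have := ccontM (ccont_expi z) (ccont_exp_prim 0); rewrite /exp_prim eqxx.
    move=> t /andP[t1 t0]; rewrite mul1r cabsM cabs_expi cabsN cabs_rc ler_piMr ?expR_ge0 //.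
    by rewrite ler_norml t1 (le_trans t0).
  have := expR_Im z; move: h1; set b := phiInt _; set a := cexp _ => h1 h2.
  have := cabsB (1 + a + b) (1 + b); have := cabsD 1 b; rewrite cabs1.
  have -> : 1 + a + b - (1 + b) = a by ring.
  by rewrite h2; lra.
rewrite cabsM => h2.
have : cabs (c z) * (expR (cIm z) / 4) <= (Phi + 2) * expR (cIm z) * normM (lincomb s c).
  by rewrite (le_trans _ h2) // ler_wpM2l ?cabs_ge0.
move=> h3; rewrite -(@ler_pM2r _ (expR (cIm z) / 4)); last lra.
by rewrite (le_trans h3) // le_eqVlt; apply/orP; left; apply/eqP; field.
Qed.
End ZerosSep.

(** * Counting and summing over points with separated real parts *)

Section Counting.
Variable R : realType.
Local Notation C := R[i].
Implicit Types (s : seq C) (z w : C) (a B : R).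

Definition sepRe s := {in s &, forall z w, `|cRe z - cRe w| <= 16^-1 -> z = w}.

Lemma truncn_inj_dist (x y : R) : 0 <= x -> 0 <= y ->
  Num.truncn x = Num.truncn y -> `|x - y| <= 1.
Proof.
move=> /Num.Theory.truncn_itv hx /Num.Theory.truncn_itv hy e; move: hx hy; rewrite e.
set n := Num.truncn y; rewrite -natr1 => /andP[h1 h2] /andP[h3 h4].
by rewrite ler_norml; apply/andP; split; lra.
Qed.

(** The integer part of 16 (Re z - a + B) is injective on the points counted, since equal values put
    the real parts within 1/16, and it runs over 0, ..., floor(32 B). *)
Lemma sep_count s a B : uniq s -> sepRe s -> 0 <= B ->
  (count (fun z => `|cRe z - a| <= B) s)%:R <= 32 * B + 1.
Proof.
move=> us ss B0; rewrite -size_filter; set t := seq.filter _ s.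
pose f z := Num.truncn (16 * (cRe z - a + B)).
have tP z : z \in t -> 0 <= cRe z - a + B <= 2 * B /\ z \in s.
  rewrite mem_filter ler_norml => /andP[/andP[h1 h2] zs].
  by split => //; apply/andP; split; lra.
have B32 : 0 <= 32 * B by lra.
have ut : uniq (map f t).
  rewrite map_inj_in_uniq ?filter_uniq // => z w /tP[/andP[z1 z2] zs] /tP[/andP[w1 w2] ws] e.
  apply: ss => //; have := truncn_inj_dist _ _ e.
  rewrite -mulrBr normrM ger0_norm // => /(_ _ _)/= h.
  have {h} : 16 * `|cRe z - a + B - (cRe w - a + B)| <= 1 by apply: h; lra.
  have -> : cRe z - a + B - (cRe w - a + B) = cRe z - cRe w by ring.
  lra.
have sub : {subset map f t <= iota 0 (Num.truncn (32 * B)).+1}.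
  move=> _ /mapP[z /tP[/andP[h1 h2] _] ->]; rewrite mem_iota /= add0n ltnS.
  apply: Num.Theory.le_truncn; lra.
have := uniq_leq_size ut sub; rewrite size_map size_iota => h.
have /andP[h1 _] := Num.Theory.truncn_itv B32.
apply: (@le_trans _ _ (Num.truncn (32 * B)).+1%:R); first by rewrite ler_nat.
by rewrite -natr1; lra.
Qed.

Lemma uniq_sum_le (t : seq nat) (A : R) : 0 < A -> uniq t ->
  \sum_(j <- t) ((A + j%:R) * (A + j.+1%:R))^-1 <= A^-1.
Proof.
move=> A0 ut; pose a j : R := ((A + j%:R) * (A + j.+1%:R))^-1.
have Aj j : 0 < A + j%:R by rewrite ltr_wpDr.
have a0 j : 0 <= a j by rewrite invr_ge0 mulr_ge0 // ltW.
(* The distinct indices are enlarged to a full initial segment, over which the sum telescopes. *)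
pose J := (\max_(j <- t) j).+1.
have -> : \sum_(j <- t) ((A + j%:R) * (A + j.+1%:R))^-1 = \sum_(j <- iota 0 J | j \in t) a j.
  rewrite -[RHS]big_filter -[LHS]/(\sum_(j <- t) a j); apply: perm_big; apply: uniq_perm => //.
    by rewrite filter_uniq ?iota_uniq.
  move=> j; rewrite mem_filter mem_iota /= add0n; case jt : (j \in t) => //=.
  by rewrite ltnS; apply/esym; apply: (@leq_bigmax_seq _ t xpredT id).
apply: (@le_trans _ _ (\sum_(j <- iota 0 J) a j)).
  by rewrite big_mkcond /=; apply: ler_sum => j _; case: ifP.
have -> : \sum_(j <- iota 0 J) a j = A^-1 - (A + J%:R)^-1.
  elim: J => [|n IH]; first by rewrite big_nil addr0 subrr.
  rewrite -addn1 iotaD big_cat /= big_seq1 add0n IH addn1 /a.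
  have := Aj n; have := Aj n.+1; rewrite -natr1 => h1 h2.
  by field; rewrite !gt_eqF.
by rewrite gerDl oppr_le0 invr_ge0 ltW.
Qed.

(** The sign e restricts to one half of the line, where |Re z| inherits the separation of Re z;
    points of opposite sign could share a value. *)
Lemma half_decay s (e rho : R) : uniq s -> sepRe s -> e ^+ 2 = 1 ->
  (forall z, z \in s -> 0 <= e * cRe z) -> 1 <= rho ->
  \sum_(z <- s) ((rho + `|cRe z|) ^+ 2)^-1 <= 32 / rho.
Proof.
move=> us ss e2 es r1.
pose f z := Num.truncn (16 * `|cRe z|).
have ne : `|e| = 1.
  by apply/eqP; rewrite -(@eqrXn2 _ 2) ?expr1n // real_normK ?num_real ?e2.
have fI : {in s &, injective f}.
  move=> z w zs ws /(truncn_inj_dist (mulr_ge0 (ler0n _ _) (normr_ge0 _)) (mulr_ge0 (ler0n _ _) (normr_ge0 _))) h.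
  apply: ss => //; move: h.
  have En v : v \in s -> `|cRe v| = e * cRe v.
    by move=> vs; rewrite -[RHS]ger0_norm ?es // normrM ne mul1r.
  rewrite !En // -!mulrBr !normrM ne mul1r ger0_norm //; lra.
have A0 : 0 < 16 * rho by lra.
have um : uniq (map f s) by rewrite map_inj_in_uniq.
(* 512 = 16 times 32: with n the integer part of 16 |Re z|, the factors 16 rho + n and 16 rho + n +
   1 are at most 16 (rho + |Re z|) and 32 (rho + |Re z|). The telescoped sum then gives 512 / (16
   rho) = 32 / rho. *)
apply: (@le_trans _ _ (512 * \sum_(j <- map f s) ((16 * rho + j%:R) * (16 * rho + j.+1%:R))^-1)).
  rewrite big_map mulr_sumr; apply: ler_sum => z _.
  have z0 : 0 <= 16 * `|cRe z| by rewrite mulr_ge0.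
  have /andP[h1 h2] := Num.Theory.truncn_itv z0.
  rewrite -/(f z) in h1 h2 *; set n : R := (f z)%:R in h1 h2 *.
  have fS : (f z).+1%:R = n + 1 :> R by rewrite /n natr1.
  rewrite fS in h2 *.
  have n0 : 0 <= n by [].
  have p1 : 0 < (rho + `|cRe z|) ^+ 2 by rewrite exprn_gt0 // ltr_wpDr //; lra.
  have p2 : 0 < (16 * rho + n) * (16 * rho + (n + 1)) by rewrite mulr_gt0 //; lra.
  rewrite -[leLHS]mul1r ler_pdivrMr // mulrAC ler_pdivlMr // mul1r.
  have -> : 512 * (rho + `|cRe z|) ^+ 2 = (16 * (rho + `|cRe z|)) * (32 * (rho + `|cRe z|)).
    by ring.
  by apply: ler_pM; lra.
apply: (@le_trans _ _ (512 * (16 * rho)^-1)).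
  by apply: ler_wpM2l; [exact: ler0n|exact: uniq_sum_le].
by rewrite le_eqVlt; apply/orP; left; apply/eqP; field; lra.
Qed.

Lemma sep_decay s (rho : R) : uniq s -> sepRe s -> 1 <= rho ->
  \sum_(z <- s) ((rho + `|cRe z|) ^+ 2)^-1 <= 64 / rho.
Proof.
move=> us ss r1; rewrite (bigID (fun z => 0 <= cRe z)) /= -[X in X + _]big_filter -[X in _ + X]big_filter.
have sf (P : pred C) : sepRe [seq z <- s | P z].
  by move=> z w; rewrite !mem_filter => /andP[_ zs] /andP[_ ws]; exact: ss.
have -> : 64 / rho = 32 / rho + 32 / rho by ring.
apply: lerD.
  apply: (@half_decay _ 1) => //; rewrite ?filter_uniq ?expr1n // => z.
  by rewrite mem_filter mul1r => /andP[].
apply: (@half_decay _ (-1)) => //; rewrite ?filter_uniq ?sqrrN ?expr1n // => z.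
by rewrite mem_filter mulN1r oppr_ge0 -ltNge => /andP[/ltW].
Qed.
End Counting.

(** * Uniform constants for the zeros and for the coefficients *)

Section Stats.
Variable R : realType.
Local Notation C := R[i].
Implicit Types (s : seq C) (c d : C -> C) (z w a : C) (t x n : R) (u v : Melt R).

Lemma sqr_normM u : normM u ^+ 2 = cabs u.1 ^+ 2 + sqI u.2.
Proof. by rewrite sqr_sqrtr // addr_ge0 ?sqr_ge0 ?sqI_ge0. Qed.

Lemma cint_mul_bound (f g : R -> C) (N : R) : inL2 f -> inL2 g -> 0 <= N ->
  sqI f <= N ^+ 2 -> cabs (cint (fun t => f t * g t)) <= N * (1 + sqI g).
Proof.
move=> fL gL N0 fN; have g0 := sqI_ge0 g; have g1 : 0 < 1 + sqI g by lra.
have key e : 0 < e -> cabs (cint (fun t => f t * g t)) <= (N + e) * (1 + sqI g).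
  move=> e0; have Ne : 0 < N + e by lra.
  have Ni : 0 < (N + e)^-1 by rewrite invr_gt0.
  rewrite (le_trans (cint_mul_le fL gL Ni)) // invrK mulrDr mulr1 lerD2r.
  rewrite mulrC ler_pdivrMr // (le_trans fN) //; nra.
apply/ler_addgt0Pr => e e0.
have := key (e / (1 + sqI g)) (divr_gt0 e0 g1).
by rewrite mulrDl divfK ?gt_eqF.
Qed.

Lemma ipM_bound u v : inM u -> inM v ->
  cabs (ipM u v) <= (cabs v.1 + 1 + sqI (fun t => cconj (v.2 t))) * normM u.
Proof.
move=> uM vM; have N0 := normM_ge0 u.
have h1 : cabs u.1 <= normM u.
  by rewrite -ler_sqr ?nnegrE ?cabs_ge0 // sqr_normM lerDl sqI_ge0.
have h2 : sqI u.2 <= normM u ^+ 2 by rewrite sqr_normM lerDr sqr_ge0.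
have h3 := cint_mul_bound uM (inL2_conj vM) N0 h2.
rewrite (le_trans (cabsD _ _)) // cabsM cabs_conj.
by have := cabs_ge0 v.1; nra.
Qed.

Lemma inM_lincomb s c : inM (lincomb s c).
Proof. exact: inL2_ccont (ccont_cder (cder_exp_sum s c)). Qed.

Lemma inM_evec z : inM (evec z).
Proof. exact: inL2_ccont (ccont_expi z). Qed.

Lemma ipM_lincomb s c v : inM v ->
  ipM (lincomb s c) v = \sum_(z <- s) c z * ipM (evec z) v.
Proof.
move=> vM; have vL := inL2_conj vM.
have iz z : intIvC (fun t => (evec z).2 t * cconj (v.2 t)).
  by apply: intIvC_mul => //; exact: inM_evec.
transitivity ((\sum_(z <- s) c z) * cconj v.1 +
    cint (fun t => \sum_(z <- s) c z * ((evec z).2 t * cconj (v.2 t)))).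
  rewrite /ipM /=; under eq_bigr do rewrite mulr1; congr (_ + cint _).
  by apply/funext => t; rewrite mulr_suml; apply: eq_bigr => z _; rewrite mulrA.
rewrite cint_sum; last by move=> z; exact: intIvCZ.
rewrite mulr_suml -big_split /=; apply: eq_bigr => z _.
rewrite cintZ; last exact: iz.
by rewrite -[ipM _ _]/(1 * cconj v.1 + cint (fun t => (evec z).2 t * cconj (v.2 t))) mul1r mulrDr.
Qed.

Variable phi : R -> C.
Hypothesis phiL2 : inL2 phi.
Hypothesis Lam_upper : forall z, Lam phi z -> 0 < cIm z.
Hypothesis Lam_simple : forall lam, Lam phi lam -> exists2 d : C, d != 0 &
     forall eps : R, 0 < eps -> exists2 del : R, 0 < del &
       forall z, z != lam -> cabs (z - lam) < del ->
         cabs ((Dfun phi z - Dfun phi lam) / (z - lam) - d) < eps.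

Lemma far_sepRe s : subLam phi s -> (forall z, z \in s -> far_radius phi <= cabs z) -> sepRe s.
Proof.
move=> sL sf z w zs ws h; have [Dz Dw] := (sL _ zs, sL _ ws).
have [zY z64] := Lam_far phiL2 Dz (Lam_upper Dz) (sf _ zs).
have [wY w64] := Lam_far phiL2 Dw (Lam_upper Dw) (sf _ ws).
exact: (Lam_sep phiL2 Dz Dw).
Qed.

Lemma far_split s : uniq s -> subLam phi s -> exists s1 s2,
  [/\ perm_eq s (s1 ++ s2), uniq s2, subLam phi s2, sepRe s2 &
      forall z, z \in s1 -> cabs z < far_radius phi].
Proof.
move=> us sL; exists [seq z <- s | cabs z < far_radius phi], [seq z <- s | ~~ (cabs z < far_radius phi)].
have s2L : subLam phi [seq z <- s | ~~ (cabs z < far_radius phi)].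
  by move=> z; rewrite mem_filter => /andP[_ /sL].
split => //.
- by rewrite perm_sym; apply: permEl; exact: perm_filterC.
- by rewrite filter_uniq.
- apply: far_sepRe => // z; rewrite mem_filter => /andP[+ _].
  by rewrite -leNgt.
- by move=> z; rewrite mem_filter => /andP[].
Qed.

Lemma zero_stats : exists2 K, 1 <= K & [/\ forall z, Lam phi z -> K^-1 <= cIm z,
  forall s (a B : R), uniq s -> subLam phi s -> 0 <= B ->
    (count (fun z => `|cRe z - a| <= B) s)%:R <= K * (1 + B) &
  forall s rho, uniq s -> subLam phi s -> 1 <= rho ->
    \sum_(z <- s) ((rho + cabs z) ^+ 2)^-1 <= K / rho].
Proof.
have [s0 us0 s0P] := Lam_finite phiL2 Lam_simple (far_radius phi).
have us0' : upper s0 by move=> z /s0P[/Lam_upper].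
have [m m0 hm] := upper_min us0'.
pose k : R := (size s0)%:R; have k0 : 0 <= k by [].
have mi : 0 < m^-1 by rewrite invr_gt0.
have small s1 s2 s : uniq s -> subLam phi s -> perm_eq s (s1 ++ s2) ->
    (forall z, z \in s1 -> cabs z < far_radius phi) -> (size s1)%:R <= k.
  move=> us sL p12 s1r; rewrite ler_nat; apply: uniq_leq_size.
    by move: us; rewrite (perm_uniq p12) cat_uniq => /andP[].
  move=> z zs; apply/s0P; split; last exact: s1r.
  by apply: sL; rewrite (perm_mem p12) mem_cat zs.
(* 64 serves the separated zeros beyond [far_radius]; the finitely many others enter through their
   number k and their least height m. *)
exists (64 + k + m^-1); first lra; split.
- move=> z Dz; have K0 : 0 < 64 + k + m^-1 by lra.
  have [zr|zr] := ltP (cabs z) (far_radius phi).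
    have zm : m <= cIm z by apply: hm; exact/s0P.
    by rewrite (le_trans _ zm) // -[leRHS]invrK lef_pV2 ?posrE //; lra.
  have [zY _] := Lam_far phiL2 Dz (Lam_upper Dz) zr.
  rewrite (le_trans _ zY) // (le_trans _ (high_ge1 phi)) // invf_le1 //; lra.
- move=> s a B us sL B0; have [s1 [s2 [p12 us2 s2L s2s s1r]]] := far_split us sL.
  have h1 := small _ _ _ us sL p12 s1r.
  move/permP: (p12) => ->; rewrite count_cat natrD.
  have h2 := sep_count a us2 s2s B0.
  have h3 : (count (fun z => `|cRe z - a| <= B) s1)%:R <= (size s1)%:R :> R.
    by rewrite ler_nat count_size.
  rewrite (le_trans (lerD h3 h2)) //; nra.
- move=> s rho us sL r1; have [s1 [s2 [p12 us2 s2L s2s s1r]]] := far_split us sL.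
  have h1 := small _ _ _ us sL p12 s1r.
  have rho0 : 0 < rho by lra.
  have ri : 0 < rho^-1 by rewrite invr_gt0.
  rewrite (perm_big _ p12) big_cat /=.
  have h2 : \sum_(z <- s1) ((rho + cabs z) ^+ 2)^-1 <= k / rho.
    apply: (@le_trans _ _ (\sum_(z <- s1) rho^-1)); last first.
      by rewrite big_const_seq count_predT iter_addr_0 -mulr_natl ler_wpM2r // ltW.
    apply: ler_sum => z _; rewrite lef_pV2 ?posrE ?exprn_gt0 ?ltr_wpDr ?cabs_ge0 //.
    by have := cabs_ge0 z; nra.
  have h3 : \sum_(z <- s2) ((rho + cabs z) ^+ 2)^-1 <= 64 / rho.
    rewrite (le_trans _ (sep_decay us2 s2s r1)) //; apply: ler_sum => z _.
    rewrite lef_pV2 ?posrE ?exprn_gt0 ?ltr_wpDr ?cabs_ge0 //.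
    rewrite ler_sqr ?nnegrE ?addr_ge0 ?cabs_ge0 ?(ltW rho0) //.
    by rewrite lerD2l cabs_Re.
  rewrite (le_trans (lerD h2 h3)) // !mulrDl; have : 0 < m^-1 / rho by rewrite mulr_gt0.
  lra.
Qed.

Variable xs : C -> Melt R.
Hypothesis xsM : forall lam, Lam phi lam -> inM (xs lam).
Hypothesis xs_biorth : forall lam mu, Lam phi lam -> Lam phi mu ->
     ipM (evec mu) (xs lam) = (if mu == lam then 1 else 0).

Lemma ipM_lincomb_xs s c z : uniq s -> subLam phi s -> Lam phi z ->
  ipM (lincomb s c) (xs z) = if z \in s then c z else 0.
Proof.
move=> us sL Dz; rewrite ipM_lincomb; last exact: xsM.
case: ifPn => [zs|zs].
  rewrite (bigD1_seq z) //= xs_biorth // eqxx mulr1 big_seq_cond big1 ?addr0 //.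
  by move=> w /andP[ws wz]; rewrite xs_biorth ?(negbTE wz) ?mulr0 //; exact: sL.
rewrite big_seq big1 // => w ws; rewrite xs_biorth //; last exact: sL.
case: eqVneq => [e|_]; last by rewrite mulr0.
by rewrite -e ws in zs.
Qed.

(** The biorthogonal vectors give a constant for each zero separately, which is uniform over the
    finitely many zeros below [far_radius]; beyond it [coef_high] provides a uniform one. *)
Lemma coef_bound : exists2 K, 0 <= K & forall s c z, uniq s -> subLam phi s -> z \in s ->
  cabs (c z) <= K * normM (lincomb s c).
Proof.
have [s0 us0 s0P] := Lam_finite phiL2 Lam_simple (far_radius phi).
pose k z := cabs (xs z).1 + 1 + sqI (fun t => cconj ((xs z).2 t)).
have k0 z : 0 <= k z by rewrite !addr_ge0 ?cabs_ge0 ?sqI_ge0.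
have P1 := Phi_ge1 phi.
have S0 : 0 <= \sum_(z <- s0) k z by apply: sumr_ge0 => z _; exact: k0.
exists (4 * (Phi phi + 2) + \sum_(z <- s0) k z); first by lra.
move=> s c z us sL zs; have Dz := sL _ zs; have N0 := normM_ge0 (lincomb s c).
have [zr|zr] := ltP (cabs z) (far_radius phi).
  have zs0 : z \in s0 by apply/s0P.
  have := ipM_bound (inM_lincomb s c) (xsM Dz); rewrite ipM_lincomb_xs // zs -/(k z) => h.
  rewrite (le_trans h) // ler_wpM2r // (big_rem z) //=.
  have : 0 <= \sum_(y <- rem z s0) k y by apply: sumr_ge0 => w _; exact: k0.
  lra.
have [zY _] := Lam_far phiL2 Dz (Lam_upper Dz) zr.
have us' : upper s by move=> w /sL /Lam_upper.
rewrite (le_trans (coef_high phiL2 c us' sL us zs zY)) // ler_wpM2r //; lra.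
Qed.
End Stats.

(** * Uniform boundedness of the truncated multipliers *)

Section Mult.
Variable R : realType.
Local Notation C := R[i].
Implicit Types (s : seq C) (c d : C -> C) (z w a : C) (t x : R) (n m : nat).

(** The derivative in t is integrated from 0: for 0 <= u <= t both |z - u| and |z + u| are at least
    |z| / 2, so each of its two terms is at most 4 Im z / |z|^2. *)
Lemma cIm_log_ratio_le z t : 0 < cIm z -> 0 <= t -> 2 * t <= cabs z ->
  cIm (log_ratio z t) <= 8 * t * cIm z / cabs z ^+ 2.
Proof.
move=> z0 t0 tz; have az : 0 < cabs z by apply: lt_le_trans z0 (le_trans (ler_norm _) (cabs_Im z)).
have key u : 0 <= u <= t -> forall e : R, e ^+ 2 = 1 ->
    cIm (- (z + rc (e * u))^-1) <= 4 * cIm z / cabs z ^+ 2.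
  move=> /andP[u0 ut] e e2; rewrite cImN cIm_inv cImD cReD /= addr0 mulNr opprK.
  have h : cabs z ^+ 2 / 4 <= (cRe z + e * u) ^+ 2 + cIm z ^+ 2.
    have := cabsD (z + rc (e * u)) (- rc (e * u)); rewrite addrK cabsN cabs_rc normrM.
    have -> : `|e| = 1 by apply/eqP; rewrite -(@eqrXn2 _ 2) ?expr1n // real_normK ?num_real ?e2.
    rewrite mul1r ger0_norm // => h1.
    have h2 : cabs z / 2 <= cabs (z + rc (e * u)) by lra.
    have := sqr_cabs (z + rc (e * u)); rewrite cReD cImD /= addr0 => <-.
    have -> : cabs z ^+ 2 / 4 = (cabs z / 2) ^+ 2 by field.
    by rewrite ler_sqr ?nnegrE ?cabs_ge0 //; lra.
  have p : 0 < cabs z ^+ 2 / 4 by rewrite divr_gt0 // exprn_gt0.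
  have -> : 4 * cIm z / cabs z ^+ 2 = cIm z / (cabs z ^+ 2 / 4) by field; rewrite gt_eqF.
  rewrite ler_pM2l // lef_pV2 ?posrE //; exact: lt_le_trans h.
have := @is_derive_le R (fun u => cIm (log_ratio z u)) (fun u => 8 * cIm z / cabs z ^+ 2 * u)
  (fun u => cIm (- (z - rc u)^-1 - (z + rc u)^-1)) (fun=> 8 * cIm z / cabs z ^+ 2) 0 t t0.
rewrite log_ratio0 /= subr0 mulr0 subr0 => h.
have -> : 8 * t * cIm z / cabs z ^+ 2 = 8 * cIm z / cabs z ^+ 2 * t by ring.
apply: h => u ut.
- by have [_] := cder_log_ratio u z0.
- apply: (is_derive_ext (is_deriveZ (8 * cIm z / cabs z ^+ 2) (is_derive_id u 1))) => //.
  by rewrite /GRing.scale /= mulr1.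
- have k1 := key u ut 1 (expr1n _ _); have k2 := key u ut (-1) (etrans (sqrrN _) (expr1n _ _)).
  rewrite mul1r in k1; rewrite mulN1r rcN in k2.
  rewrite cImD; have -> : 8 * cIm z / cabs z ^+ 2 = 4 * cIm z / cabs z ^+ 2 + 4 * cIm z / cabs z ^+ 2 by ring.
  exact: lerD.
Qed.

Lemma cabs_multW l x z : cabs (multW l x z) = expR (l * cIm (log_ratio z x) - pi * l).
Proof.
by rewrite /multW cabs_cexp cReN cRe_rcM cReD ciM /=; congr expR; ring.
Qed.

Lemma cabs_multW_le1 l x z : 0 <= l -> 0 < cIm z -> cabs (multW l x z) <= 1.
Proof.
move=> l0 z0; rewrite cabs_multW -expR0 ler_expR.
have : cIm (log_ratio z x) <= pi.
  rewrite /=; have := atan_ltpi2 ((cRe z + x) / cIm z); have := atan_gtNpi2 ((cRe z - x) / cIm z).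
  by lra.
by nra.
Qed.

Lemma gram_origin_factorX s d x m : upper s -> 0 < x ->
  gram s (fun z => origin_factor x z ^+ m * d z) <= gram s d.
Proof.
move=> us x0; elim: m => [|m IH].
  by rewrite le_eqVlt; apply/orP; left; apply/eqP/eq_gram => z _; rewrite expr0 mul1r.
apply: le_trans IH; apply: le_trans (gram_origin_factor _ us x0).
by rewrite le_eqVlt; apply/orP; left; apply/eqP/eq_gram => z _; rewrite exprS mulrA.
Qed.

(* Close to 1 for |z| much smaller than x and O(x / |z|) for large |z|. *)
Definition low_pass1 x z : C := 1 - origin_factor x z ^+ 16.

Lemma gram_low_pass1 s d x : upper s -> 0 < x ->
  gram s (fun z => low_pass1 x z * d z) <= 4 * gram s d.
Proof.
move=> us x0; have := gramB d (fun z => origin_factor x z ^+ 16 * d z) us.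
have := gram_origin_factorX d 16 us x0.
have -> : gram s (fun z => d z - origin_factor x z ^+ 16 * d z) = gram s (fun z => low_pass1 x z * d z).
  by apply: eq_gram => z _; rewrite /low_pass1 mulrBl mul1r.
by lra.
Qed.

(** A third power because [shift_coef] grows linearly: the product then decays like |z|^-2, which
    [zero_stats] can sum. *)
Definition low_pass x z : C := low_pass1 x z ^+ 3.

Lemma gram_low_pass s d x : upper s -> 0 < x ->
  gram s (fun z => low_pass x z * d z) <= 64 * gram s d.
Proof.
move=> us x0; have h1 := gram_low_pass1 d us x0.
have h2 := gram_low_pass1 (fun z => low_pass1 x z * d z) us x0.
have h3 := gram_low_pass1 (fun z => low_pass1 x z * (low_pass1 x z * d z)) us x0.
have -> : gram s (fun z => low_pass x z * d z) =
    gram s (fun z => low_pass1 x z * (low_pass1 x z * (low_pass1 x z * d z))).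
  by apply: eq_gram => z _; rewrite /low_pass; ring.
by lra.
Qed.

Lemma cabs_shift_ge z x : 0 < cIm z -> 0 < x ->
  [/\ x <= cabs (z + ci R * rc x), cabs z <= cabs (z + ci R * rc x) &
      0 < cabs (z + ci R * rc x)].
Proof.
move=> z0 x0; have e : cabs (z + ci R * rc x) ^+ 2 = cRe z ^+ 2 + (cIm z + x) ^+ 2.
  by rewrite sqr_cabs cReD cImD ciM /= oppr0 addr0.
have e2 := sqr_cabs z.
have h1 : x <= cabs (z + ci R * rc x).
  by rewrite -ler_sqr ?nnegrE ?cabs_ge0 ?(ltW x0) // e; nra.
split => //; last exact: lt_le_trans h1.
by rewrite -ler_sqr ?nnegrE ?cabs_ge0 // e e2; nra.
Qed.

Lemma cabs_origin_factor z x : cabs (origin_factor x z) = cabs z / cabs (z + ci R * rc x).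
Proof. by rewrite cabsM cabsV. Qed.

Lemma cabs_origin_factor_le1 z x : 0 < cIm z -> 0 < x -> cabs (origin_factor x z) <= 1.
Proof.
move=> z0 x0; have [h1 h2 h3] := cabs_shift_ge z0 x0.
by rewrite cabs_origin_factor ler_pdivrMr // mul1r.
Qed.

Lemma cabs_origin_factor_le z x : 0 < cIm z -> 0 < x -> cabs (origin_factor x z) <= cabs z / x.
Proof.
move=> z0 x0; have [h1 h2 h3] := cabs_shift_ge z0 x0.
by rewrite cabs_origin_factor ler_wpM2l ?cabs_ge0 // lef_pV2.
Qed.

Lemma cabs_1sub_exp a m : cabs a <= 1 -> cabs (1 - a ^+ m) <= m%:R * cabs (1 - a).
Proof.
move=> a1; elim: m => [|m IH]; first by rewrite expr0 subrr cabs0 mul0r.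
have -> : 1 - a ^+ m.+1 = (1 - a) + a * (1 - a ^+ m) by rewrite exprS; ring.
rewrite (le_trans (cabsD _ _)) // cabsM -natr1.
have := cabs_ge0 (1 - a ^+ m); have := cabs_ge0 a; nra.
Qed.

Lemma cabs_low_pass1_le z x : 0 < cIm z -> 0 < x -> cabs (low_pass1 x z) <= 32 * x / (x + cabs z).
Proof.
move=> z0 x0; have [h1 h2 h3] := cabs_shift_ge z0 x0.
rewrite (le_trans (cabs_1sub_exp 16 (cabs_origin_factor_le1 z0 x0))) //.
have -> : 1 - origin_factor x z = ci R * rc x / (z + ci R * rc x).
  by rewrite /origin_factor; field; rewrite cpos_neq0.
rewrite !cabsM cabs_ci mul1r cabs_rc cabsV (gtr0_norm x0).
have p : 0 < x + cabs z by rewrite ltr_wpDr ?cabs_ge0.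
rewrite mulrA ler_pdivrMr // mulrAC ler_pdivlMr //.
have -> : 16 * x * (x + cabs z) = x * (16 * (x + cabs z)) by ring.
have -> : 32 * x * cabs (z + ci R * rc x) = x * (32 * cabs (z + ci R * rc x)) by ring.
by rewrite ler_wpM2l ?(ltW x0) //; lra.
Qed.

Lemma cabs_low_pass_le z x : 0 < cIm z -> 0 < x ->
  cabs (low_pass x z) <= (32 * x / (x + cabs z)) ^+ 3.
Proof.
by move=> z0 x0; rewrite /low_pass cabsX lerXn2r ?nnegrE ?cabs_ge0 ?cabs_low_pass1_le //;
  rewrite (le_trans (cabs_ge0 _) (cabs_low_pass1_le z0 x0)).
Qed.

Lemma cabs_1sub_low_pass z x : 0 < cIm z -> 0 < x -> cabs (1 - low_pass x z) <= 7 * (cabs z / x) ^+ 16.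
Proof.
move=> z0 x0; have b1 := cabs_origin_factor_le1 z0 x0; have b2 := cabs_origin_factor_le z0 x0.
set b := origin_factor x z ^+ 16 in b1 b2 *.
have B1 : cabs (origin_factor x z ^+ 16) <= 1 by rewrite cabsX exprn_ile1 ?cabs_ge0.
have B2 : cabs (origin_factor x z ^+ 16) <= (cabs z / x) ^+ 16.
  rewrite cabsX lerXn2r ?nnegrE ?cabs_ge0 //.
  by rewrite divr_ge0 ?cabs_ge0 // ltW.
rewrite /low_pass /low_pass1; move: (origin_factor x z ^+ 16) B1 B2 => B B1 B2.
have -> : 1 - (1 - B) ^+ 3 = B * (3%:R - 3%:R * B + B * B) by ring.
rewrite cabsM mulrC ler_pM ?cabs_ge0 //.
have c3 : cabs (3%:R : C) = 3 by rewrite -[3%:R](rmorph_nat (real_complex R)) cabs_rc ger0_norm.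
rewrite (le_trans (cabsD _ _)) // (le_trans (lerD (cabsB _ _) (lexx _))) // !cabsM c3.
have := cabs_ge0 B; nra.
Qed.
End Mult.

(** * The Gram form bounded by the sizes of the coefficients *)

Section GramBound.
Variable R : realType.
Local Notation C := R[i].
Implicit Types (s : seq C) (c d : C -> C) (z w : C).

Lemma gram_triv s d (k : R) : 0 < k -> (forall z, z \in s -> k^-1 <= cIm z) ->
  gram s d <= k * (\sum_(z <- s) cabs (d z)) ^+ 2.
Proof.
move=> k0 hk; rewrite (le_trans (gram_le_sum s d)) // expr2 mulr_suml mulr_sumr.
rewrite big_seq [leRHS]big_seq; apply: ler_sum => z zs.
rewrite !mulr_sumr big_seq [leRHS]big_seq; apply: ler_sum => w ws.
have h : k^-1 <= cabs (z - cconj w).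
  rewrite (le_trans _ (cabs_Im _)) // subJ_Im (le_trans _ (ler_norm _)) //.
  have := hk _ zs; have := hk _ ws; have : 0 < k^-1 by rewrite invr_gt0.
  lra.
rewrite [leRHS]mulrC ler_wpM2l ?mulr_ge0 ?cabs_ge0 //.
by rewrite -[k]invrK lef_pV2 ?posrE ?invr_gt0 // (lt_le_trans _ h) // invr_gt0.
Qed.

(** Row z is split at horizontal distance B. Within it there are at most k (1 + B) entries, with
    kernel at most k because Im >= 1/k; beyond it the kernel is at most 1/B and the sum of all
    coefficients is used. *)
Lemma gram_le_split s d (k B M S : R) : 0 < k -> 0 < B -> 0 <= M ->
  (forall z, z \in s -> k^-1 <= cIm z) ->
  (forall a : R, (count (fun z => `|cRe z - a| <= B) s)%:R <= k * (1 + B)) ->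
  (forall z, z \in s -> cabs (d z) <= M) ->
  \sum_(z <- s) cabs (d z) <= S ->
  gram s d <= S * (k ^+ 2 * M * (1 + B) + S / B).
Proof.
move=> k0 B0 M0 hk hc hM hS; rewrite (le_trans (gram_le_sum s d)) //.
have S0 : 0 <= S by rewrite (le_trans _ hS) // sumr_ge0 // => z _; exact: cabs_ge0.
apply: (@le_trans _ _ (\sum_(z <- s) cabs (d z) * (k ^+ 2 * M * (1 + B) + S / B))); last first.
  rewrite -mulr_suml ler_wpM2r // addr_ge0 ?divr_ge0 ?(ltW B0) //.
  by rewrite !mulr_ge0 ?sqr_ge0 //; lra.
rewrite big_seq [leRHS]big_seq; apply: ler_sum => z zs.
under eq_bigr do rewrite -mulrA.
rewrite -mulr_sumr ler_wpM2l ?cabs_ge0 //.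
have kz := hk _ zs; have ki : 0 < k^-1 by rewrite invr_gt0.
rewrite (bigID (fun w => `|cRe w - cRe z| <= B)) /= lerD //.
  apply: (@le_trans _ _ (\sum_(w <- s | `|cRe w - cRe z| <= B) M * k)).
    rewrite big_seq_cond [leRHS]big_seq_cond; apply: ler_sum => w /andP[ws _].
    rewrite ler_pM ?cabs_ge0 ?invr_ge0 ?cabs_ge0 ?hM //.
    have h : k^-1 <= cabs (z - cconj w).
      rewrite (le_trans _ (cabs_Im _)) // subJ_Im (le_trans _ (ler_norm _)) //.
      by have := hk _ ws; lra.
    by rewrite -[leRHS]invrK lef_pV2 ?posrE // (lt_le_trans _ h).
  rewrite big_const_seq iter_addr_0 -mulr_natl.
  have -> : k ^+ 2 * M * (1 + B) = k * (1 + B) * (M * k) by ring.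
  by rewrite ler_wpM2r // mulr_ge0 // ltW.
apply: (@le_trans _ _ (\sum_(w <- s | ~~ (`|cRe w - cRe z| <= B)) cabs (d w) / B)).
  apply: ler_sum => w; rewrite -ltNge => h.
  have h2 : B <= cabs (z - cconj w).
    rewrite (le_trans _ (cabs_Re _)) // cReD cReN /= distrC; exact: ltW.
  by rewrite ler_wpM2l ?cabs_ge0 // lef_pV2 ?posrE // (lt_le_trans _ h2).
rewrite -mulr_suml ler_wpM2r ?invr_ge0 ?(ltW B0) // (le_trans _ hS) //.
rewrite [leRHS](bigID (fun w => `|cRe w - cRe z| <= B)) /= lerDr.
by apply: sumr_ge0 => w _; exact: cabs_ge0.
Qed.
End GramBound.

Section MainBound.
Variable R : realType.
Local Notation C := R[i].
Implicit Types (s : seq C) (c d : C -> C) (z w : C).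
Variables (phi : R -> C) (xs : C -> Melt R).
Hypothesis phiL2 : inL2 phi.
Hypothesis Lam_upper : forall z, Lam phi z -> 0 < cIm z.
Hypothesis Lam_simple : forall lam, Lam phi lam -> exists2 d : C, d != 0 &
     forall eps : R, 0 < eps -> exists2 del : R, 0 < del &
       forall z, z != lam -> cabs (z - lam) < del ->
         cabs ((Dfun phi z - Dfun phi lam) / (z - lam) - d) < eps.
Hypothesis xsM : forall lam, Lam phi lam -> inM (xs lam).
Hypothesis xs_biorth : forall lam mu, Lam phi lam -> Lam phi mu ->
     ipM (evec mu) (xs lam) = (if mu == lam then 1 else 0).

Lemma shift_coef_bound : exists2 K, 1 <= K & forall s c z, uniq s -> subLam phi s -> z \in s ->
  cabs (shift_coef c z) <= K * (1 + cabs z) * normM (lincomb s c).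
Proof.
have [K1 K10 h1] := coef_bound phiL2 Lam_upper Lam_simple xsM xs_biorth.
have [K2 K21 h2] := expR_Im_le phiL2.
exists (1 + K1 * K2); first by rewrite lerDl mulr_ge0 //; lra.
move=> s c z us sL zs; have := h1 _ c _ us sL zs; have := h2 _ (sL _ zs).
rewrite /shift_coef cabsM expR_Im => e1 e2; have N0 := normM_ge0 (lincomb s c).
have z0 := cabs_ge0 z; have c0 := cabs_ge0 (c z); have E0 := expR_ge0 (cIm z).
apply: (@le_trans _ _ ((K1 * normM (lincomb s c)) * (K2 * (1 + cabs z)))).
  by apply: ler_pM.
have -> : (1 + K1 * K2) * (1 + cabs z) * normM (lincomb s c) =
  K1 * normM (lincomb s c) * (K2 * (1 + cabs z)) + (1 + cabs z) * normM (lincomb s c) by ring.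
by rewrite lerDl mulr_ge0 // addr_ge0.
Qed.

(** With R_n = r^8, the scale R_n^(9/8) and the cutoff sqrt R_n become the integral powers r^9 and
    r^4. *)
Lemma exists_root8 (x : R) : 1 <= x -> exists2 r, 1 <= r & r ^+ 8 = x.
Proof.
move=> x1; have sq (y : R) : 1 <= y -> exists2 r, 1 <= r & r ^+ 2 = y.
  move=> y1; exists (Num.sqrt y); last by rewrite sqr_sqrtr //; lra.
  by rewrite -[1]sqrtr1 ler_wsqrtr.
have [a a1 <-] := sq _ x1; have [b b1 <-] := sq _ a1; have [r r1 <-] := sq _ b1.
by exists r => //; rewrite -!exprM.
Qed.

(** By [cIm_log_ratio_le] the excess over - pi l in the exponent is at most 8 l n y / |z|^2 with y =
    Im z. It stays bounded because l <= sqrt n, n <= |z| / 2 and y = O(sqrt |z|); the last holds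
    since exp(y) = O(|z|). *)
Lemma multW_far : exists2 K, 0 <= K & forall (l : R) (n : nat) z, Lam phi z ->
  0 < l -> (0 < n)%N -> 1 <= cabs z -> 2 * n%:R <= cabs z -> l ^+ 2 <= n%:R ->
  cabs (multW l n%:R z) <= K * expR (- (pi * l)).
Proof.
have [K K1 hK] := expR_Im_le phiL2.
exists (expR (8 * K)); first exact: expR_ge0.
move=> l n z Dz l0 n0 z1 zn ln; have y0 := Lam_upper Dz.
have n0' : 0 < n%:R :> R by rewrite ltr0n.
rewrite cabs_multW expRD ler_wpM2r ?expR_ge0 // ler_expR.
have := cIm_log_ratio_le y0 (ltW n0') zn; set y := cIm z in y0 *; set a := cabs z in z1 zn *.
move=> h; apply: (@le_trans _ _ (l * (8 * n%:R * y / a ^+ 2))).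
  by rewrite ler_wpM2l // ltW.
have a0 : 0 < a by lra.
have y2 : y ^+ 2 <= 8 * K * a.
  have e := hK _ Dz; rewrite -/y -/a in e.
  have y2e : 1 + y / 2 <= expR (y / 2) := expR_ge1Dx _.
  have E : expR y = expR (y / 2) ^+ 2 by rewrite expr2 -expRD -splitr.
  by have : (y / 2) ^+ 2 <= expR y; [rewrite E; nra|nra].
have X0 : 0 <= l * (8 * n%:R * y / a ^+ 2).
  by rewrite !mulr_ge0 ?invr_ge0 ?sqr_ge0 ?(ltW l0) ?(ltW y0).
rewrite -ler_sqr ?nnegrE //; last lra.
have -> : (l * (8 * n%:R * y / a ^+ 2)) ^+ 2 = 64 * l ^+ 2 * n%:R ^+ 2 * y ^+ 2 / a ^+ 4.
  by field; rewrite gt_eqF.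
rewrite ler_pdivrMr ?exprn_gt0 //.
have h1 : 64 * l ^+ 2 * n%:R ^+ 2 * y ^+ 2 <= 64 * n%:R ^+ 3 * (8 * K * a).
  have -> : 64 * l ^+ 2 * n%:R ^+ 2 * y ^+ 2 = (l ^+ 2) * (64 * n%:R ^+ 2 * y ^+ 2) by ring.
  have -> : 64 * n%:R ^+ 3 * (8 * K * a) = n%:R * (64 * n%:R ^+ 2 * (8 * K * a)) by ring.
  apply: ler_pM => //; first exact: sqr_ge0.
    by apply: mulr_ge0; [apply: mulr_ge0 => //; exact: sqr_ge0|exact: sqr_ge0].
  by apply: ler_wpM2l => //; apply: mulr_ge0 => //; exact: sqr_ge0.
have h2 : 8 * n%:R ^+ 3 <= a ^+ 3.
  have -> : 8 * n%:R ^+ 3 = (2 * n%:R) ^+ 3 :> R by ring.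
  by rewrite lerXn2r ?nnegrE //; lra.
rewrite (le_trans h1) //.
have -> : 64 * n%:R ^+ 3 * (8 * K * a) = 64 * K * a * (8 * n%:R ^+ 3) by ring.
have -> : (8 * K) ^+ 2 * a ^+ 4 = 64 * K * a * (K * a ^+ 3) by ring.
rewrite ler_wpM2l //; first by rewrite !mulr_ge0 //; lra.
have : 0 <= a ^+ 3 by rewrite exprn_ge0 // ltW.
by move: h2; nra.
Qed.
End MainBound.

Section MainBound2.
Variable R : realType.
Local Notation C := R[i].
Implicit Types (s : seq C) (c d : C -> C) (z w : C).
Variables (phi : R -> C) (xs : C -> Melt R).
Hypothesis phiL2 : inL2 phi.
Hypothesis Lam_upper : forall z, Lam phi z -> 0 < cIm z.
Hypothesis Lam_simple : forall lam, Lam phi lam -> exists2 d : C, d != 0 &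
     forall eps : R, 0 < eps -> exists2 del : R, 0 < del &
       forall z, z != lam -> cabs (z - lam) < del ->
         cabs ((Dfun phi z - Dfun phi lam) / (z - lam) - d) < eps.
Hypothesis xsM : forall lam, Lam phi lam -> inM (xs lam).
Hypothesis xs_biorth : forall lam mu, Lam phi lam -> Lam phi mu ->
     ipM (evec mu) (xs lam) = (if mu == lam then 1 else 0).

(** The two corrections in w_n = W_n Psi + near - far, with Psi = [low_pass]: below the radius W_n
    (1 - Psi) is missing, from the radius on W_n Psi is in excess. *)
Definition near_part (l x rr : R) (n : nat) (e : C -> C) z : C :=
  if cabs z < rr then multW l n%:R z * (1 - low_pass x z) * e z else 0.

Definition far_part (l x rr : R) (n : nat) (e : C -> C) z : C :=
  if cabs z < rr then 0 else multW l n%:R z * low_pass x z * e z.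

Lemma near_part_bound : exists2 K, 0 <= K & forall (l r : R) (n : nat) s c,
  0 < l -> 1 <= r -> uniq s -> subLam phi s ->
  gram s (near_part l (r ^+ 9) (r ^+ 8) n (shift_coef c)) <= K * normM (lincomb s c) ^+ 2.
Proof.
have [Kz Kz1 [im cnt _]] := zero_stats phiL2 Lam_upper Lam_simple.
have [Ke Ke1 eb] := shift_coef_bound phiL2 Lam_upper Lam_simple xsM xs_biorth.
exists (Kz * (28 * Ke * Kz) ^+ 2); first by rewrite mulr_ge0 ?sqr_ge0 //; lra.
move=> l r n s c l0 r1 us sL; set N := normM _; have N0 : 0 <= N := normM_ge0 _.
have r0 : 0 < r by lra.
have rX m : 1 <= r ^+ m by rewrite exprn_ege1.
(* 14 = 7 times 2, from [cabs_1sub_low_pass] and from 1 + |z| <= 2 r^8. The at most 2 Kz r^8 zeros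
   below r^8 cancel the remaining r^-8. *)
pose mx := 14 * Ke * N * (r ^+ 8 * r^-1 ^+ 16).
have mx0 : 0 <= mx by rewrite !mulr_ge0 ?exprn_ge0 ?invr_ge0 //; lra.
have ptw z : z \in s -> cabs z < r ^+ 8 -> cabs (near_part l (r ^+ 9) (r ^+ 8) n (shift_coef c) z) <= mx.
  move=> zs zr; have z0 := Lam_upper (sL _ zs); rewrite /near_part zr.
  rewrite [cabs (_ * shift_coef c z)]cabsM [cabs (multW _ _ _ * _)]cabsM.
  have h1 := cabs_multW_le1 n%:R (ltW l0) z0.
  have h2 := cabs_1sub_low_pass z0 (lt_le_trans ltr01 (rX 9)).
  have h3 : cabs (1 - low_pass (r ^+ 9) z) <= 7 * r^-1 ^+ 16.
    rewrite (le_trans h2) // ler_wpM2l // lerXn2r ?nnegrE ?invr_ge0 ?(ltW r0) //.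
      by rewrite divr_ge0 ?cabs_ge0 // exprn_ge0 // ltW.
    rewrite ler_pdivrMr ?exprn_gt0 // [r ^+ 9]exprS mulKf ?gt_eqF //; exact: ltW.
  have h4 : cabs (shift_coef c z) <= Ke * (2 * r ^+ 8) * N.
    rewrite (le_trans (eb s c z us sL zs)) // ler_wpM2r // ler_wpM2l //; first lra.
    by have := rX 8; lra.
  have -> : mx = 1 * (7 * r^-1 ^+ 16) * (Ke * (2 * r ^+ 8) * N) by rewrite /mx; ring.
  apply: ler_pM => //; [by rewrite mulr_ge0 ?cabs_ge0|exact: cabs_ge0|].
  by apply: ler_pM => //; exact: cabs_ge0.
have kz0 : 0 < Kz by lra.
rewrite (le_trans (@gram_triv R s _ Kz kz0 _)) //; first by move=> z /sL; exact: im.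
rewrite -mulrA ler_wpM2l ?(ltW kz0) // -exprMn.
have S0 : 0 <= \sum_(z <- s) cabs (near_part l (r ^+ 9) (r ^+ 8) n (shift_coef c) z).
  by apply: sumr_ge0 => z _; exact: cabs_ge0.
suff h : \sum_(z <- s) cabs (near_part l (r ^+ 9) (r ^+ 8) n (shift_coef c) z) <= 28 * Ke * Kz * N.
  by rewrite ler_sqr ?nnegrE // (le_trans S0 h).
apply: (@le_trans _ _ (\sum_(z <- s | cabs z < r ^+ 8) mx)).
  rewrite [leRHS]big_mkcond big_seq [leRHS]big_seq; apply: ler_sum => z zs.
  case: ifPn => zr; first exact: ptw.
  by rewrite /near_part (negbTE zr) cabs0.
rewrite big_const_seq iter_addr_0 -[mx *+ _]mulr_natl.
have hc : (count (fun z => cabs z < r ^+ 8) s)%:R <= Kz * (2 * r ^+ 8).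
  apply: (@le_trans _ _ (count (fun z => `|cRe z - 0| <= r ^+ 8) s)%:R).
    rewrite ler_nat; apply: sub_count => z /= zr.
    by rewrite subr0 (le_trans (cabs_Re _)) // ltW.
  rewrite (le_trans (cnt s 0 (r ^+ 8) us sL (le_trans ler01 (rX 8)))) //.
  by rewrite ler_wpM2l ?(ltW kz0) //; have := rX 8; lra.
apply: (le_trans (ler_wpM2r mx0 hc)); rewrite le_eqVlt; apply/orP; left; apply/eqP.
rewrite /mx; field; lra.
Qed.

Lemma far_part_bound : exists2 K, 0 <= K & forall (l r : R) (n : nat) s c,
  0 < l -> (0 < n)%N -> 1 <= r -> 2 * n%:R <= r ^+ 8 -> l ^+ 2 <= n%:R ->
  expR (- (pi * l) / 2) * r ^+ 8 <= 1 -> uniq s -> subLam phi s ->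
  gram s (far_part l (r ^+ 9) (r ^+ 8) n (shift_coef c)) <= K * normM (lincomb s c) ^+ 2.
Proof.
have [Kz Kz1 [im cnt dec]] := zero_stats phiL2 Lam_upper Lam_simple.
have [Ke Ke1 eb] := shift_coef_bound phiL2 Lam_upper Lam_simple xsM xs_biorth.
have [Kw Kw0 wb] := multW_far phiL2 Lam_upper.
pose A : R := Kw * (32 ^+ 3 * 2) * Ke.
have A0 : 0 <= A by rewrite !mulr_ge0 ?exprn_ge0 //; lra.
have kz0 : 0 < Kz by lra.
have Kz3 : 0 <= 3 * Kz ^+ 3 by apply: mulr_ge0 => //; rewrite exprn_ge0 // ltW.
exists (3 * Kz ^+ 3 * A ^+ 2); first by apply: mulr_ge0 => //; exact: sqr_ge0.
move=> l r n s c l0 n0 r1 nr ln lr us sL.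
set N := normM _; have N0 : 0 <= N := normM_ge0 _.
have r0 : 0 < r by lra.
have rX m : 1 <= r ^+ m by rewrite exprn_ege1.
have rp m : 0 < r ^+ m by rewrite exprn_gt0.
pose E := expR (- (pi * l)); have E0 : 0 < E := expR_gt0 _.
pose M1 := A * E * N; have M10 : 0 <= M1 := mulr_ge0 (mulr_ge0 A0 (ltW E0)) N0.
set x := r ^+ 9; have x0 : 0 < x := rp 9; have x1 : 1 <= x := rX 9.
have ptw z : z \in s -> cabs (far_part l x (r ^+ 8) n (shift_coef c) z) <= M1 * x ^+ 3 * ((x + cabs z) ^+ 2)^-1.
  move=> zs; have z0 := Lam_upper (sL _ zs); have cz := cabs_ge0 z.
  have xz : 0 < x + cabs z by lra.
  rewrite /far_part; case: ltP => zr.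
    rewrite cabs0; apply: mulr_ge0; last by rewrite invr_ge0 sqr_ge0.
    by apply: mulr_ge0 => //; rewrite exprn_ge0 // ltW.
  rewrite [cabs (_ * shift_coef c z)]cabsM [cabs (multW _ _ _ * _)]cabsM.
  have h1 := wb l n z (sL _ zs) l0 n0 (le_trans (rX 8) zr) (le_trans nr zr) ln.
  have h2 := cabs_low_pass_le z0 x0.
  have h4 : cabs (shift_coef c z) <= Ke * (2 * (x + cabs z)) * N.
    rewrite (le_trans (eb s c z us sL zs)) // ler_wpM2r // ler_wpM2l //; first lra.
    by have := rX 8; lra.
  have -> : M1 * x ^+ 3 * ((x + cabs z) ^+ 2)^-1 =
     (Kw * E) * (32 * x / (x + cabs z)) ^+ 3 * (Ke * (2 * (x + cabs z)) * N).
    by rewrite /M1 /A; field; rewrite gt_eqF.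
  apply: ler_pM => //; [by rewrite mulr_ge0 ?cabs_ge0|exact: cabs_ge0|].
  by apply: ler_pM => //; exact: cabs_ge0.
pose S := M1 * Kz * x ^+ 2.
have hS : \sum_(z <- s) cabs (far_part l x (r ^+ 8) n (shift_coef c) z) <= S.
  apply: (@le_trans _ _ (\sum_(z <- s) M1 * x ^+ 3 * ((x + cabs z) ^+ 2)^-1)).
    by rewrite big_seq [leRHS]big_seq; apply: ler_sum.
  rewrite -mulr_sumr; have := dec s x us sL x1 => h.
  have -> : S = M1 * x ^+ 3 * (Kz / x) by rewrite /S; field; rewrite gt_eqF.
  by apply: ler_wpM2l => //; apply: mulr_ge0 => //; rewrite exprn_ge0 // ltW.
have hM z : z \in s -> cabs (far_part l x (r ^+ 8) n (shift_coef c) z) <= M1 * x.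
  move=> zs; rewrite (le_trans (ptw z zs)) //.
  have cz := cabs_ge0 z; have xz : 0 < x + cabs z by lra.
  have -> : M1 * x ^+ 3 / (x + cabs z) ^+ 2 = M1 * x * (x ^+ 2 / (x + cabs z) ^+ 2) by ring.
  rewrite ler_piMr ?(mulr_ge0 M10 (ltW x0)) // ler_pdivrMr ?exprn_gt0 // mul1r.
  by rewrite ler_sqr ?nnegrE ?(ltW x0) ?(ltW xz) //; lra.
(* The cutoff r^4 makes S^2 / B of order M1^2 r^32. The near-diagonal term is of lower order: M1 x
   r^4 is about M1 r^13, against S / r^4, about M1 r^14. *)
have B0 : 0 < r ^+ 4 := rp 4.
have Mx0 : 0 <= M1 * x := mulr_ge0 M10 (ltW x0).
have := @gram_le_split R s _ Kz (r ^+ 4) (M1 * x) S kz0 B0 Mx0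
  (fun z zs => im z (sL z zs)) (fun a => cnt s a _ us sL (ltW B0)) hM hS.
move=> h; apply: (le_trans h).
have SB : S / r ^+ 4 = M1 * Kz * r ^+ 14.
  by rewrite /S /x; field; rewrite gt_eqF.
rewrite SB.
have r13 : 1 + r ^+ 4 <= 2 * r ^+ 5.
  have : r ^+ 4 <= r ^+ 5 by rewrite ler_weXn2l.
  by have := rX 5; lra.
have -> : 3 * Kz ^+ 3 * A ^+ 2 * N ^+ 2 = 3 * Kz ^+ 3 * (A * N) ^+ 2 by ring.
apply: (@le_trans _ _ (3 * Kz ^+ 3 * (M1 * r ^+ 16) ^+ 2)); last first.
  apply: ler_wpM2l => //.
  rewrite ler_sqr ?nnegrE; [|exact: mulr_ge0 M10 (ltW (rp 16))|exact: mulr_ge0 A0 N0].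
  have -> : M1 * r ^+ 16 = A * N * (E * r ^+ 16) by rewrite /M1; ring.
  rewrite ler_piMr ?(mulr_ge0 A0 N0) //.
  have -> : E * r ^+ 16 = (expR (- (pi * l) / 2) * r ^+ 8) ^+ 2.
    by rewrite exprMn -exprM /E expr2 -expRD -splitr.
  by rewrite exprn_ile1 // mulr_ge0 ?expR_ge0 ?(ltW (rp 8)).
have -> : 3 * Kz ^+ 3 * (M1 * r ^+ 16) ^+ 2 = M1 * Kz * x ^+ 2 * (3 * Kz ^+ 2 * M1 * r ^+ 14).
  by rewrite /x; ring.
rewrite -/S; apply: ler_wpM2l; first by rewrite (mulr_ge0 (mulr_ge0 M10 (ltW kz0))) ?sqr_ge0.
have h1 : Kz ^+ 2 * (M1 * x) * (1 + r ^+ 4) <= Kz ^+ 2 * M1 * (2 * r ^+ 14).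
  have -> : Kz ^+ 2 * M1 * (2 * r ^+ 14) = Kz ^+ 2 * (M1 * x) * (2 * r ^+ 5).
    by rewrite /x; ring.
  by apply: ler_wpM2l => //; apply: mulr_ge0 => //; exact: sqr_ge0.
have h2 : M1 * Kz * r ^+ 14 <= Kz ^+ 2 * M1 * r ^+ 14.
  rewrite ler_wpM2r ?(ltW (rp 14)) // mulrC ler_wpM2r //; nra.
have -> : 3 * Kz ^+ 2 * M1 * r ^+ 14 = Kz ^+ 2 * M1 * (2 * r ^+ 14) + Kz ^+ 2 * M1 * r ^+ 14 by ring.
exact: lerD.
Qed.

Lemma main_bound : exists2 K, 0 <= K & forall (l rr : R) (n : nat) s c,
  0 < l -> (0 < n)%N -> 1 <= rr -> 2 * n%:R <= rr -> l ^+ 2 <= n%:R ->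
  expR (- (pi * l) / 2) * rr <= 1 -> uniq s -> subLam phi s ->
  normM (lincomb s (fun z => wn l rr n z * c z)) ^+ 2 <= K * normM (lincomb s c) ^+ 2.
Proof.
have [Kn Kn0 nb] := near_part_bound; have [Kf Kf0 fb] := far_part_bound.
have [Kq Kq0 qb] := gram_shift_coef_le phiL2 Lam_upper.
pose K0 := (Phi phi + 2) ^+ 2 + 1; have K00 : 0 <= K0 by rewrite addr_ge0 ?sqr_ge0.
(* 128 is twice the 64 of [gram_low_pass]; each 4 comes from two uses of [gramB]. *)
exists (K0 * (128 * Kq + 4 * Kn + 4 * Kf)).
  by rewrite mulr_ge0 //; lra.
move=> l rr n s c l0 n0 rr1 nr ln lr us sL.
have [r r1 rE] := exists_root8 rr1; rewrite -rE in nr lr *.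
have us' := subLam_upper Lam_upper sL.
have n0' : 0 < n%:R :> R by rewrite ltr0n.
rewrite (le_trans (normM_le_gram phiL2 Lam_upper _ sL)) // -mulrA ler_wpM2l //.
have x0 : 0 < r ^+ 9 by rewrite exprn_gt0 //; lra.
set p := near_part l (r ^+ 9) (r ^+ 8) n (shift_coef c).
set q := far_part l (r ^+ 9) (r ^+ 8) n (shift_coef c).
rewrite (@eq_gram R s _ (fun z => multW l n%:R z * (low_pass (r ^+ 9) z * shift_coef c z) - (q z - p z))); last first.
  move=> z zs; rewrite /q /p /near_part /far_part /wn /shift_coef.
  rewrite multWE //; last exact: us'.
  by case: ifP => _; ring.
have h1 := gramB (fun z => multW l n%:R z * (low_pass (r ^+ 9) z * shift_coef c z)) (fun z => q z - p z) us'.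
have h2 := gramB q p us'.
have h3 := gram_multW (fun z => low_pass (r ^+ 9) z * shift_coef c z) n%:R us' (ltW l0).
have h4 := gram_low_pass (shift_coef c) us' x0.
have h5 := qb s c sL.
have h6 := nb l r n s c l0 r1 us sL.
have h7 := fb l r n s c l0 n0 r1 nr ln lr us sL.
rewrite -/p in h6; rewrite -/q in h7.
by lra.
Qed.
End MainBound2.

(** * Convergence *)

Section Msub.
Variable R : realType.
Local Notation C := R[i].
Implicit Types (s : seq C) (c d : C -> C) (z : C) (u v w : Melt R).

Lemma Melt_eq u v : u.1 = v.1 -> (forall t, u.2 t = v.2 t) -> u = v.
Proof. by case: u v => u1 u2 [v1 v2] /= -> /funext ->. Qed.

Lemma inM_sub u v : inM u -> inM v -> inM (subM u v).
Proof. exact: inL2B. Qed.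

Lemma normM_sub u v : inM u -> inM v ->
  normM (subM u v) ^+ 2 <= 2 * normM u ^+ 2 + 2 * normM v ^+ 2.
Proof.
move=> uM vM; rewrite !sqr_normM /=; have := sqIB uM vM.
have := cabsB u.1 v.1; have := cabs_ge0 (u.1 - v.1).
by have := sqr_ge0 (cabs u.1 - cabs v.1); nra.
Qed.

Lemma normM_subC u v : normM (subM u v) = normM (subM v u).
Proof.
rewrite /normM /= cabsBC; congr (Num.sqrt (_ + Rintegral _ _ _)).
by apply/funext => t; rewrite cabsBC.
Qed.

Lemma ipM_sub u v w : inM u -> inM v -> inM w -> ipM (subM u v) w = ipM u w - ipM v w.
Proof.
move=> uM vM wM; rewrite /ipM /=.
have wc := inL2_conj wM.
have -> : (fun t => (u.2 t - v.2 t) * cconj (w.2 t)) =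
    (fun t => u.2 t * cconj (w.2 t) + -1 * (v.2 t * cconj (w.2 t))).
  by apply/funext => t; ring.
have i1 : intIvC (fun t => u.2 t * cconj (w.2 t)) by exact: intIvC_mul.
have i2 : intIvC (fun t => v.2 t * cconj (w.2 t)) by exact: intIvC_mul.
rewrite cintD //; last exact: intIvCZ.
by rewrite cintZ //; ring.
Qed.

Lemma lincombB s c d : subM (lincomb s c) (lincomb s d) = lincomb s (fun z => c z - d z).
Proof.
apply: Melt_eq => [|t] /=; rewrite -sumrN -big_split; apply: eq_bigr => z _ /=; ring.
Qed.

Lemma eq_lincomb s c d : (forall z, z \in s -> c z = d z) -> lincomb s c = lincomb s d.
Proof.
by move=> cd; apply: Melt_eq => [|t] /=; apply: eq_big_seq => z /cd ->.
Qed.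

Lemma lincomb_undup s c :
  lincomb s c = lincomb (undup s) (fun z => c z *+ count_mem z s).
Proof.
have E (g : C -> C) : \sum_(z <- s) c z * g z = \sum_(z <- undup s) (c z *+ count_mem z s) * g z.
  rewrite -[LHS]big_undup_iterop_count; apply: eq_bigr => z _.
  by rewrite mulrnAl -[RHS]/(iterop _ _ _ _).
by apply: Melt_eq => [|t] /=; rewrite E.
Qed.

Lemma near_ge_pinfty (f : nat -> R) (a : R) :
  f @ \oo --> +oo -> \forall n \near \oo, a <= f n.
Proof. by move=> /cvgryPge; apply. Qed.

Lemma near_seq (I : eqType) (s : seq I) (P : I -> nat -> Prop) :
  (forall i, i \in s -> \forall n \near \oo, P i n) ->
  \forall n \near \oo, forall i, i \in s -> P i n.
Proof.
elim: s => [|i s IH] h; first by apply: nearW => n j; rewrite in_nil.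
have h1 := h i (mem_head _ _).
have h2 : \forall n \near \oo, forall j, j \in s -> P j n.
  by apply: IH => j js; apply: h; rewrite inE js orbT.
near=> n; move=> j; rewrite inE => /predU1P[->|js].
  by near: n.
by move: j js; near: n.
Unshelve. all: by end_near.
Qed.
End Msub.

(** * Extension by density and the limit *)

Section Final.
Variable R : realType.
Local Notation C := R[i].
Implicit Types (s : seq C) (c d : C -> C) (z w : C) (u v : Melt R).
Variables (phi : R -> C) (xs : C -> Melt R).
Hypothesis phiL2 : inL2 phi.
Hypothesis Lam_upper : forall z, Lam phi z -> 0 < cIm z.
Hypothesis Lam_simple : forall lam, Lam phi lam -> exists2 d : C, d != 0 &
     forall eps : R, 0 < eps -> exists2 del : R, 0 < del &
       forall z, z != lam -> cabs (z - lam) < del ->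
         cabs ((Dfun phi z - Dfun phi lam) / (z - lam) - d) < eps.
Hypothesis Lam_complete : forall x : Melt R, inM x -> forall eps : R, 0 < eps ->
     exists (s : seq C) (c : C -> C),
       (forall mu, mu \in s -> Lam phi mu) /\ normM (subM x (lincomb s c)) < eps.
Hypothesis xsM : forall lam, Lam phi lam -> inM (xs lam).
Hypothesis xs_biorth : forall lam mu, Lam phi lam -> Lam phi mu ->
     ipM (evec mu) (xs lam) = (if mu == lam then 1 else 0).

Lemma complete_uniq u (e : R) : inM u -> 0 < e -> exists s c,
  [/\ uniq s, subLam phi s & normM (subM u (lincomb s c)) < e].
Proof.
move=> uM e0; have [s [c [sL h]]] := Lam_complete uM e0.
exists (undup s), (fun z => c z *+ count_mem z s); rewrite -lincomb_undup.
by split => //; [exact: undup_uniq|move=> z; rewrite mem_undup; exact: sL].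
Qed.

(** A crude bound, suited to a set of zeros that stays fixed: the truncation at one n, or one given
    combination as n grows. *)
Lemma normM_lincomb_le : exists2 K, 0 <= K & forall s d, subLam phi s ->
  normM (lincomb s d) ^+ 2 <= K * (\sum_(z <- s) cabs (shift_coef d z)) ^+ 2.
Proof.
have [Kz Kz1 [im _ _]] := zero_stats phiL2 Lam_upper Lam_simple.
have kz0 : 0 < Kz by lra.
pose K0 := (Phi phi + 2) ^+ 2 + 1; have K00 : 0 <= K0 by rewrite addr_ge0 ?sqr_ge0.
exists (K0 * Kz); first by rewrite (mulr_ge0 K00) // ltW.
move=> s d sL; rewrite (le_trans (normM_le_gram phiL2 Lam_upper _ sL)) //.
rewrite -[leRHS]mulrA ler_wpM2l //.
by apply: gram_triv => // z /sL; exact: im.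
Qed.

(** The sum over Lambda in [Sn] is meaningful only for finite support, being 0 otherwise. The list
    contains the whole support because w_n vanishes from the radius on. *)
Lemma SnE (l rr : R) n s v : uniq s -> (forall z, z \in s <-> Lam phi z /\ cabs z < rr) ->
  Sn phi xs l rr n v = lincomb s (fun z => wn l rr n z * ipM v (xs z)).
Proof.
move=> us sP.
have E (g : C -> C) : \sum_(z \in Lam phi) wn l rr n z * ipM v (xs z) * g z =
    \sum_(z <- s) wn l rr n z * ipM v (xs z) * g z.
  rewrite [RHS]fsbig_seq //; apply/esym; apply: fsbig_widen; first by move=> z /= /sP[].
  move=> z [Dz zs] /=; rewrite /wn; case: ifPn => zr; last by rewrite !mul0r.
  by exfalso; apply: zs; apply/sP.
by apply: Melt_eq => [|t]; rewrite /= E.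
Qed.

Lemma Sn_lincomb (l rr : R) n s c : uniq s -> subLam phi s ->
  Sn phi xs l rr n (lincomb s c) = lincomb s (fun z => wn l rr n z * c z).
Proof.
move=> us sL; have [s0 us0 s0P] := Lam_finite phiL2 Lam_simple rr.
rewrite (SnE _ _ _ us0 s0P).
have E (g : C -> C) : \sum_(z <- s0) wn l rr n z * ipM (lincomb s c) (xs z) * g z =
    \sum_(z <- s) wn l rr n z * c z * g z.
  transitivity (\sum_(z <- s0 | z \in s) wn l rr n z * c z * g z).
    rewrite [RHS]big_mkcond /=; apply: eq_big_seq => z /s0P[Dz _].
    rewrite (ipM_lincomb_xs xsM xs_biorth c us sL Dz).
    by case: ifP => //; rewrite mulr0 mul0r.
  transitivity (\sum_(z <- s | z \in s0) wn l rr n z * c z * g z).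
    rewrite -[LHS]big_filter -[RHS]big_filter; apply: perm_big.
    apply: uniq_perm; rewrite ?filter_uniq // => z.
    by rewrite !mem_filter andbC.
  rewrite [LHS]big_mkcond /=; apply: eq_big_seq => z zs.
  case: ifPn => // zs0; rewrite /wn; case: ifPn => zr; last by rewrite !mul0r.
  by move: zs0; rewrite (_ : z \in s0) //; apply/s0P; split => //; exact: sL.
by apply: Melt_eq => [|t]; rewrite /= E.
Qed.

Lemma inM_Sn (l rr : R) n u : inM (Sn phi xs l rr n u).
Proof.
have [s us sP] := Lam_finite phiL2 Lam_simple rr.
by rewrite (SnE _ _ _ us sP); exact: inM_lincomb.
Qed.

Lemma Sn_sub (l rr : R) n u v : inM u -> inM v ->
  Sn phi xs l rr n (subM u v) = subM (Sn phi xs l rr n u) (Sn phi xs l rr n v).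
Proof.
move=> uM vM; have [s us sP] := Lam_finite phiL2 Lam_simple rr.
rewrite !(SnE _ _ _ us sP) lincombB; apply: eq_lincomb => z /sP[Dz _].
by rewrite ipM_sub ?mulrBr //; exact: xsM.
Qed.

Lemma cabs_wn_le1 (l rr : R) n z : 0 < l -> (0 < n)%N -> 0 < cIm z -> cabs (wn l rr n z) <= 1.
Proof.
move=> l0 n0 z0; rewrite /wn; case: ifP => _; last by rewrite cabs0.
by rewrite multWE ?ltr0n //; apply: cabs_multW_le1 => //; exact: ltW.
Qed.

(** The constant depends on n. It only provides the continuity of each S_n that carries the uniform
    bound from linear combinations to all of M. *)
Lemma Sn_finite_rank (l rr : R) n : 0 < l -> (0 < n)%N ->
  exists2 K, 0 <= K & forall u, inM u -> normM (Sn phi xs l rr n u) ^+ 2 <= K * normM u ^+ 2.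
Proof.
move=> l0 n0; have [s us sP] := Lam_finite phiL2 Lam_simple rr.
have sL : subLam phi s by move=> z /sP[].
have [K K0 hK] := normM_lincomb_le.
pose k z := (cabs (xs z).1 + 1 + sqI (fun t => cconj ((xs z).2 t))) * expR (cIm z).
exists (K * (\sum_(z <- s) k z) ^+ 2); first by rewrite mulr_ge0 ?sqr_ge0.
move=> u uM; rewrite (SnE _ _ _ us sP) (le_trans (hK _ _ sL)) // -mulrA ler_wpM2l //.
rewrite -exprMn.
have h : \sum_(z <- s) cabs (shift_coef (fun z => wn l rr n z * ipM u (xs z)) z) <= (\sum_(z <- s) k z) * normM u.
  rewrite mulr_suml big_seq [leRHS]big_seq; apply: ler_sum => z zs.
  rewrite /shift_coef cabsM expR_Im cabsM /k [leRHS]mulrAC ler_wpM2r ?expR_ge0 //.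
  have h1 := cabs_wn_le1 rr l0 n0 (Lam_upper (sL _ zs)).
  have := ipM_bound uM (xsM (sL _ zs)).
  have := cabs_ge0 (wn l rr n z); have := cabs_ge0 (ipM u (xs z)); nra.
have h0 : 0 <= \sum_(z <- s) cabs (shift_coef (fun z => wn l rr n z * ipM u (xs z)) z).
  by apply: sumr_ge0 => z _; exact: cabs_ge0.
by rewrite ler_sqr ?nnegrE // (le_trans h0 h).
Qed.

Lemma absorb_error (K Kn e a b c d x y eps : R) :
  a <= 2 * b + 2 * c -> b <= K * d -> c <= Kn * x -> K * d <= K * (2 * y + 2 * e) ->
  Kn * x <= Kn * e -> 0 <= e -> (4 * K + 2 * Kn + 1) * e <= eps ->
  a <= 4 * K * y + eps.
Proof. lra. Qed.

Lemma Sn_bounded : exists2 K, 0 <= K & forall (l rr : R) n u,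
  0 < l -> (0 < n)%N -> 1 <= rr -> 2 * n%:R <= rr -> l ^+ 2 <= n%:R ->
  expR (- (pi * l) / 2) * rr <= 1 -> inM u ->
  normM (Sn phi xs l rr n u) ^+ 2 <= K * normM u ^+ 2.
Proof.
have [K K0 hK] := main_bound phiL2 Lam_upper Lam_simple xsM xs_biorth.
exists (4 * K); first by rewrite mulr_ge0.
move=> l rr n u l0 n0 r1 nr ln lr uM.
have [Kn Kn0 hKn] := Sn_finite_rank rr l0 n0.
apply/ler_addgt0Pr => e e0.
pose A := 4 * K + 2 * Kn + 1; have A0 : 0 < A by rewrite /A; lra.
(* The parameter n is fixed here, so the accuracy eta may depend on Kn. The minimum with 1 turns eta
   <= e / A into eta^2 <= e / A. *)
pose eta := Num.min 1 (e / A).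
have eta0 : 0 < eta by rewrite lt_min ltr01 divr_gt0.
have eta1 : eta ^+ 2 <= e / A.
  have h1 : eta <= 1 by rewrite ge_min lexx.
  have h2 : eta <= e / A by rewrite ge_min lexx orbT.
  by rewrite (le_trans _ h2) // expr2 ler_piMr // ltW.
have [s [c [us sL uy]]] := complete_uniq uM eta0.
set y := lincomb s c in uy; have yM : inM y := inM_lincomb s c.
have uyM := inM_sub uM yM.
have uy2 : normM (subM u y) ^+ 2 <= eta ^+ 2.
  by rewrite ler_sqr ?nnegrE ?normM_ge0 ?(ltW eta0) // ltW.
have e1 : Sn phi xs l rr n u = subM (Sn phi xs l rr n y) (Sn phi xs l rr n (subM y u)).
  rewrite -Sn_sub //; last exact: inM_sub.
  by congr Sn; apply: Melt_eq => [|t] /=; ring.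
have e2 : y = subM u (subM u y) by apply: Melt_eq => [|t] /=; ring.
have h1 := normM_sub (inM_Sn l rr n y) (inM_Sn l rr n (subM y u)); rewrite -e1 in h1.
have h2 := hK l rr n s c l0 n0 r1 nr ln lr us sL; rewrite -Sn_lincomb // -/y in h2.
have h3 := hKn _ (inM_sub yM uM); rewrite normM_subC in h3.
have h4 := normM_sub uM uyM; rewrite -e2 in h4.
have eA : A * eta ^+ 2 <= e by rewrite mulrC -ler_pdivlMr.
have h5 : K * normM y ^+ 2 <= K * (2 * normM u ^+ 2 + 2 * eta ^+ 2).
  by rewrite ler_wpM2l // (le_trans h4) // lerD2l ler_wpM2l.
have h6 : Kn * normM (subM u y) ^+ 2 <= Kn * eta ^+ 2 by rewrite ler_wpM2l.
have h7 : 0 <= eta ^+ 2 := sqr_ge0 _.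
exact: (absorb_error h1 h2 h3 h5 h6 h7 eA).
Qed.

(** The exponent is - i l ([log_ratio] - i pi), of modulus at most 12 l |z| / n; for l >= 1 this is
    at most 12 |z| l^2 / n, the quantity known to tend to 0. *)
Lemma multW_near1 (l : R) n z (e : R) : 0 < cIm z -> 1 <= l -> (0 < n)%N ->
  2 * cabs z <= n%:R -> 0 < e -> l ^+ 2 / n%:R <= Num.min 1 (e / expR 1) / (12 * cabs z + 1) ->
  cabs (multW l n%:R z - 1) <= e.
Proof.
move=> z0 l1 n0 zn e0 hl; have n0' : 0 < n%:R :> R by rewrite ltr0n.
pose a : C := - (rc l * (rc pi + ci R * log_ratio z n%:R)).
have aE : a = - (rc l * (ci R * (log_ratio z n%:R - i_pi R))).
  rewrite /a; have -> : i_pi R = ci R * rc pi by rewrite ciM /= oppr0.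
  have -> : ci R * (log_ratio z n%:R - ci R * rc pi) = ci R * log_ratio z n%:R - (ci R * ci R) * rc pi by ring.
  by rewrite ci2; ring.
have l0 : 0 < l by lra.
have z1 := cabs_ge0 z.
have ha : cabs a <= Num.min 1 (e / expR 1).
  rewrite aE cabsN !cabsM cabs_rc cabs_ci mul1r gtr0_norm //.
  apply: (@le_trans _ _ (l * (12 * cabs z / n%:R))).
    by rewrite ler_wpM2l ?(ltW l0) // log_ratio_cvg.
  have h : 12 * cabs z + 1 != 0 by rewrite gt_eqF //; lra.
  rewrite -[leRHS](divfK h).
  apply: (@le_trans _ _ (l ^+ 2 / n%:R * (12 * cabs z + 1))); last first.
    by rewrite ler_wpM2r //; lra.
  have -> : l * (12 * cabs z / n%:R) = l * (12 * cabs z) / n%:R by ring.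
  have ll : l <= l ^+ 2 by rewrite expr2 ler_peMl // ltW.
  rewrite [leRHS]mulrAC ler_wpM2r ?invr_ge0 ?(ltW n0') //.
  by apply: ler_pM => //; [exact: ltW|rewrite mulr_ge0|rewrite lerDl].
move: ha; rewrite le_min => /andP[a1 ae].
rewrite (le_trans (cexp_sub1 a)) // -[e](divfK (lt0r_neq0 (expR_gt0 1))).
by rewrite ler_pM ?cabs_ge0 ?expR_ge0 // ler_expR.
Qed.

Variables (l Rn : nat -> R).
Hypothesis l_gt0 : forall n, 0 < l n.
Hypothesis Rn_gt0 : forall n, 0 < Rn n.
Hypothesis l_oo : l @ \oo --> +oo.
Hypothesis Rn_oo : Rn @ \oo --> +oo.
Hypothesis l2n : (fun n => l n ^+ 2 / n%:R) @ \oo --> 0.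
Hypothesis nRn : (fun n => n%:R / Rn n) @ \oo --> 0.
Hypothesis elR : (fun n => expR (- (pi * l n) / 2) * Rn n) @ \oo --> 0.

Lemma near_params : \forall n \near \oo, [/\ (0 < n)%N, 1 <= Rn n, 2 * n%:R <= Rn n,
  l n ^+ 2 <= n%:R & expR (- (pi * l n) / 2) * Rn n <= 1].
Proof.
near=> n.
have n0 : (0 < n)%N by near: n; exact: nbhs_infty_gt.
have n0' : 0 < n%:R :> R by rewrite ltr0n.
split => //.
- by near: n; exact: (near_ge_pinfty _ Rn_oo).
- have : `|n%:R / Rn n| <= 2^-1.
    by near: n; apply: (cvgr0_norm_le _ nRn); rewrite invr_gt0.
  move=> /(le_trans (ler_norm _)); rewrite ler_pdivrMr //; lra.
- have : `|l n ^+ 2 / n%:R| <= 1 by near: n; exact: (cvgr0_norm_le _ l2n).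
  by move=> /(le_trans (ler_norm _)); rewrite ler_pdivrMr // mul1r.
- have : `|expR (- (pi * l n) / 2) * Rn n| <= 1 by near: n; exact: (cvgr0_norm_le _ elR).
  by move=> /(le_trans (ler_norm _)).
Unshelve. all: by end_near.
Qed.

Lemma wn_cvg1 z (e : R) : Lam phi z -> 0 < e ->
  \forall n \near \oo, cabs (wn (l n) (Rn n) n z - 1) <= e.
Proof.
move=> Dz e0; have z0 := Lam_upper Dz.
have b0 : 0 < Num.min 1 (e / expR 1) / (12 * cabs z + 1).
  rewrite divr_gt0 //; last by have := cabs_ge0 z; lra.
  by rewrite lt_min ltr01 divr_gt0 // expR_gt0.
near=> n.
have n0 : (0 < n)%N by near: n; exact: nbhs_infty_gt.
rewrite /wn ifT; last first.
  have : cabs z + 1 <= Rn n by near: n; exact: (near_ge_pinfty _ Rn_oo).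
  lra.
rewrite multWE ?ltr0n //; apply: multW_near1 => //.
- by near: n; exact: (near_ge_pinfty _ l_oo).
- by near: n; exact: nbhs_infty_ger.
- rewrite (le_trans (ler_norm _)) //; near: n; exact: (cvgr0_norm_le _ l2n).
Unshelve. all: by end_near.
Qed.

Lemma Sn_lincomb_cvg s c (e : R) : uniq s -> subLam phi s -> 0 < e ->
  \forall n \near \oo,
    normM (subM (Sn phi xs (l n) (Rn n) n (lincomb s c)) (lincomb s c)) ^+ 2 <= e.
Proof.
move=> us sL e0; have [K K0 hK] := normM_lincomb_le.
pose S := \sum_(z <- s) cabs (shift_coef c z).
have S0 : 0 <= S by apply: sumr_ge0 => z _; exact: cabs_ge0.
pose B := K * S ^+ 2 + 1; have B0 : 0 < B by rewrite ltr_wpDl // mulr_ge0 // sqr_ge0.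
pose del := Num.min 1 (e / B).
have del0 : 0 < del by rewrite lt_min ltr01 divr_gt0.
have del2 : del ^+ 2 <= e / B.
  have h1 : del <= 1 by rewrite ge_min lexx.
  have h2 : del <= e / B by rewrite ge_min lexx orbT.
  by rewrite (le_trans _ h2) // expr2 ler_piMr // ltW.
have := @near_seq C s (fun z n => cabs (wn (l n) (Rn n) n z - 1) <= del)
  (fun z zs => wn_cvg1 (sL z zs) del0).
apply: filterS => n hn.
rewrite Sn_lincomb // lincombB (le_trans (hK _ _ sL)) //.
have h : \sum_(z <- s) cabs (shift_coef (fun z => wn (l n) (Rn n) n z * c z - c z) z) <= del * S.
  rewrite mulr_sumr big_seq [leRHS]big_seq; apply: ler_sum => z zs.
  have -> : shift_coef (fun z => wn (l n) (Rn n) n z * c z - c z) z = (wn (l n) (Rn n) n z - 1) * shift_coef c z.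
    by rewrite /shift_coef; ring.
  by rewrite [leLHS]cabsM ler_wpM2r ?cabs_ge0 ?hn.
have h0 : 0 <= \sum_(z <- s) cabs (shift_coef (fun z => wn (l n) (Rn n) n z * c z - c z) z).
  by apply: sumr_ge0 => z _; exact: cabs_ge0.
apply: (@le_trans _ _ (K * (del * S) ^+ 2)).
  by rewrite ler_wpM2l // ler_sqr ?nnegrE // (le_trans h0 h).
rewrite exprMn mulrCA; apply: (@le_trans _ _ (e / B * B)); last by rewrite divfK // gt_eqF.
apply: ler_pM; rewrite ?sqr_ge0 //; first by rewrite mulr_ge0 // sqr_ge0.
by rewrite /B lerDl.
Qed.

Lemma Sn_cvg u : inM u ->
  (fun n => normM (subM (Sn phi xs (l n) (Rn n) n u) u)) @ \oo --> 0.
Proof.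
move=> uM; have [K K0 hK] := Sn_bounded.
apply/cvgr0Pnorm_le => e e0.
(* Two uses of [normM_sub] leave e^2 / 2 from the combination y and (4 K + 4) eta^2 from u - y. *)
pose B := 4 * K + 5; have B0 : 0 < B by rewrite /B; lra.
have e2 : 0 < e ^+ 2 / 4 by rewrite divr_gt0 // exprn_gt0.
pose eta := Num.min 1 (e ^+ 2 / 4 / B).
have eta0 : 0 < eta by rewrite lt_min ltr01 divr_gt0.
have eta2 : eta ^+ 2 <= e ^+ 2 / 4 / B.
  have h1 : eta <= 1 by rewrite ge_min lexx.
  have h2 : eta <= e ^+ 2 / 4 / B by rewrite ge_min lexx orbT.
  by rewrite (le_trans _ h2) // expr2 ler_piMr // ltW.
have [s [c [us sL uy]]] := complete_uniq uM eta0.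
set y := lincomb s c in uy; have yM : inM y := inM_lincomb s c.
have uyM := inM_sub uM yM.
have uy2 : normM (subM u y) ^+ 2 <= eta ^+ 2.
  by rewrite ler_sqr ?nnegrE ?normM_ge0 ?(ltW eta0) // ltW.
near=> n.
have [n0 r1 nr ln lr] : [/\ (0 < n)%N, 1 <= Rn n, 2 * n%:R <= Rn n,
  l n ^+ 2 <= n%:R & expR (- (pi * l n) / 2) * Rn n <= 1] by near: n; exact: near_params.
have h1 : normM (subM (Sn phi xs (l n) (Rn n) n y) y) ^+ 2 <= e ^+ 2 / 4.
  by near: n; exact: Sn_lincomb_cvg.
have SM v := inM_Sn (l n) (Rn n) n v.
have E : subM (Sn phi xs (l n) (Rn n) n u) u =
    subM (subM (Sn phi xs (l n) (Rn n) n y) y)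
         (subM (subM u y) (Sn phi xs (l n) (Rn n) n (subM u y))).
  rewrite Sn_sub //; apply: Melt_eq => [|t] /=; ring.
have h2 := hK (l n) (Rn n) n _ (l_gt0 n) n0 r1 nr ln lr uyM.
have h3 := normM_sub uyM (SM (subM u y)).
have h4 := normM_sub (inM_sub (SM y) yM) (inM_sub uyM (SM (subM u y))).
rewrite -E in h4.
have h5 : K * normM (subM u y) ^+ 2 <= K * eta ^+ 2 by rewrite ler_wpM2l.
have eB : B * eta ^+ 2 <= e ^+ 2 / 4 by rewrite mulrC -ler_pdivlMr.
rewrite ger0_norm ?normM_ge0 // -ler_sqr ?nnegrE ?normM_ge0 ?(ltW e0) //.
have h6 : 0 <= eta ^+ 2 := sqr_ge0 _.
rewrite /B in eB; lra.
Unshelve. all: by end_near.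
Qed.
End Final.

Theorem theorem2 (R : realType) (phi : R -> R[i]) (xs : R[i] -> Melt R)
    (l Rn : nat -> R) :
  (* phi in L^2(-1,0) *)
  inL2 phi ->
  (* standing assumptions: zeros of D lie in C_+ and are simple *)
  (forall lam, Lam phi lam -> 0 < cIm lam) ->
  (* (simplicity: the complex derivative D'(lam) exists and is nonzero) *)
  (forall lam, Lam phi lam -> exists2 d : R[i], d != 0 &
     forall eps : R, 0 < eps -> exists2 del : R, 0 < del &
       forall z, z != lam -> cabs (z - lam) < del ->
         cabs ((Dfun phi z - Dfun phi lam) / (z - lam) - d) < eps) ->
  (* {e_lam} is complete in M *)
  (forall x : Melt R, inM x -> forall eps : R, 0 < eps ->
     exists (s : seq R[i]) (c : R[i] -> R[i]),
       (forall mu, mu \in s -> Lam phi mu) /\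
       normM (subM x (lincomb s c)) < eps) ->
  (* {e_lam} is minimal in M *)
  (forall lam, Lam phi lam -> exists2 eps : R, 0 < eps &
     forall (s : seq R[i]) (c : R[i] -> R[i]),
       (forall mu, mu \in s -> Lam phi mu /\ mu != lam) ->
       eps <= normM (subM (evec lam) (lincomb s c))) ->
  (* {x_lam} is the biorthogonal system in M *)
  (forall lam, Lam phi lam -> inM (xs lam)) ->
  (forall lam mu, Lam phi lam -> Lam phi mu ->
     ipM (evec mu) (xs lam) = (if mu == lam then 1 else 0)) ->
  (* the parameters l_n, R_n *)
  (forall n, 0 < l n) -> (forall n, 0 < Rn n) ->
  l @ \oo --> +oo -> Rn @ \oo --> +oo ->
  (fun n => l n ^+ 2 / n%:R) @ \oo --> 0 ->
  (fun n => n%:R / Rn n) @ \oo --> 0 ->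
  (fun n => expR (- (pi * l n) / 2) * Rn n) @ \oo --> 0 ->
  (* conclusion: S_n x -> x in M *)
  forall x : Melt R, inM x ->
    (fun n => normM (subM (Sn phi xs (l n) (Rn n) n x) x)) @ \oo --> 0.
Proof.
move=> phiL2 Lam_upper Lam_simple Lam_complete _ xsM xs_biorth l_gt0 Rn_gt0 l_oo Rn_oo l2n nRn elR x xM.
exact: (Sn_cvg phiL2 Lam_upper Lam_simple Lam_complete xsM xs_biorth l_gt0 Rn_gt0 l_oo Rn_oo l2n nRn elR xM).
Qed.
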